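(* Let $a_n = n^2$, $n \geq 1$, and let $c = 1 - \frac{1 + \log_2 2}{\log 2}$. For every $\varepsilon > 0$ and almost all $\alpha \in [0,1]$ (with respect to Lebesgue measure), we have $$\delta_{\min}^{\alpha}(N) \leq \frac{(\log N)^{c-1} (\log_2 N)^{1/2}}{N^2} \qquad \text{for infinitely many } N,$$ as well as $$\delta_{\min}^{\alpha}(N) \geq \frac{(\log N)^{c-1} (\log_2 N)^{1/2}}{N^2 (\log_3 N)^{1+\varepsilon}} \qquad \text{for all sufficiently large } N.$$
   Context: For $\alpha \in [0,1]$ and $N \geq 2$, $\delta_{\min}^{\alpha}(N) = \min\{\|(a_m - a_n)\alpha\| : 1 \leq m,n \leq N,\ m \neq n\}$, where $\|x\|$ is the distance from $x$ to the nearest integer. Conventions: $\log x$ means $\max\{1,\log x\}$, $\log_2 x = \log\log x$, $\log_3 x = \log\log\log x$, each with the same convention (so all are positive for integers $\geq 1$); in the definition of $c$, $\log_2 2 = \log\log 2$ in the usual sense, giving $c \approx 0.086$. *)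

(* Defs.v *)
From HB Require Import structures.
From mathcomp Require Import all_boot all_order all_algebra.
From mathcomp Require Import all_classical all_reals all_analysis.
Set Implicit Arguments. Unset Strict Implicit. Unset Printing Implicit Defensive.
Import Order.TTheory GRing.Theory Num.Theory.
Local Open Scope ring_scope.

Definition dist_int {R : realType} (x : R) : R :=
  Num.min (x - (Num.floor x)%:~R) ((Num.floor x)%:~R + 1 - x).

Definition logp {R : realType} (x : R) : R := Num.max 1 (ln x).
Definition log2p {R : realType} (x : R) : R := logp (logp x).
Definition log3p {R : realType} (x : R) : R := logp (log2p x).

(* c = 1 - (1 + log log 2)/log 2, with the usual (unclipped) logarithms *)
Definition c_const {R : realType} : R := 1 - (1 + ln (ln 2)) / ln 2.

Definition a_sq (n : nat) : nat := n ^ 2.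

(* delta_min^alpha(N) = min over 1 <= m, n <= N, m <> n of ||(a_m - a_n) alpha||.
   Indices i, j : 'I_N stand for m = i+1, n = j+1.  The neutral value 1 is
   never attained-relevant since ||.|| <= 1/2 and the range is nonempty for N >= 2. *)
Definition delta_min {R : realType} (alpha : R) (N : nat) : R :=
  \big[Num.min/1]_(i < N) \big[Num.min/1]_(j < N | i != j)
     dist_int ((((a_sq i.+1)%:R - (a_sq j.+1)%:R) : R) * alpha).

(* Main.v *)
Require Import Defs.
From mathcomp Require Import all_boot all_order all_algebra.
From mathcomp Require Import all_classical all_reals all_analysis.
From mathcomp Require Import ring lra zify.
From mathcomp Require Import measurable_realfun.
Set Implicit Arguments. Unset Strict Implicit. Unset Printing Implicit Defensive.
Import Order.TTheory GRing.Theory Num.Theory.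
Import numFieldNormedType.Exports.
Local Open Scope ring_scope.

(** Since [m^2 - n^2 = (m - n)(m + n)], small values of [delta_min] come from
    rational approximations [a / z] whose denominator [z] lies in the [N x N]
    multiplication table. Write [rho = e ln 2], so that [(2^J)^(1-c) = rho^J].
    Averaged logarithmically over the dyadic scales [2^k], [k < 2^J], the number
    of such [z] is of exact order [rho^J J^(-3/2)] (Erdos, Tenenbaum, Ford). Both
    bounds are obtained by sorting primes into blocks [i] of reciprocal sum close
    to [ln 2], with primes of size [exp(2^i)] up to constants in the exponent, so
    that a squarefree integer becomes a walk with Poisson([ln 2])-like increments
    and the extremal integers correspond to walks staying below a linear barrier,
    i.e. to first passage problems with an explicit solution.

    Lower bound for [delta_min]: the upper bound for the multiplication table and
    Borel-Cantelli, along scales given by triply iterated exponentials.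

    Upper bound for [delta_min]: a second moment argument produces many [z = A B]
    with [A < B <= 2^16 A] and [totient z >= z / 2]. Reduced fractions with these
    denominators are nearly independent (Bonferroni), hence the good set has
    relative measure at least [1/32] in every interval [[j 4^-i, (j+1) 4^-i]], as
    [4^i z = (2^i A) (2^i B)] is again a difference of two squares. Lebesgue's
    density theorem then gives full measure. *)

(** A block of reciprocal sum [ln 2] doubles [ln p], so an integer built from [J] blocks has
    logarithm of order [2^J], and its divisors can fill the logarithmic scale only if there are
    about [2^J] of them, from [J] primes. Hence the barrier of one prime per block. For every level
    [j], the usable divisors are limited by 2 to the number of primes above [j], times the logarithm
    of the part below [j]; taking the best [j], not only the two extreme ones, turns the exponent
    [-1/2] of [J] into [-3/2]. The block weights [(ln 2)^n / n!] become critical weights [1 / n!]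
    once height [h] carries the factor [(ln 2)^-h], at a cost of one [ln 2] per block; first
    passages of the critical walk have a closed form of size [e^J J^(-3/2)]. The allowed error
    contributes [rho^-J J^(1/2)] against the count [rho^J J^(-3/2)], so each [J] carries mass about
    [1 / J]. This diverges, whence the first claim; over [2^(2^h) <= J < 2^(2^(h+1))] it adds up to
    about [2^h], the order of [log_3 N], and the exponent [1 + eps] makes the sum over [h]
    converge. *)

Ltac nng := repeat first [assumption | apply: ltW; assumption | match goal with
  | |- is_true (0 <= _ * _)%R => apply: mulr_ge0
  | |- is_true (0 <= _ + _)%R => apply: addr_ge0
  | |- is_true (0 <= _ ^+ _)%R => apply: exprn_ge0
  | |- is_true (0 <= _^-1)%R => rewrite invr_ge0
  | |- is_true (0 <= expR _)%R => exact: expR_ge0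
  | |- is_true (0 <= Num.sqrt _)%R => exact: sqrtr_ge0
  | |- is_true (0 <= _%:R)%R => exact: ler0n
  | |- is_true (0 <= 1)%R => exact: ler01
  | |- is_true (0 <= _)%R => done
  end].

(** * Logarithms and factorials *)

Section LogInequalities.
Context {R : realType}.
Implicit Types x y : R.

Lemma is_derive_ge0_le (f df : R -> R) (a y : R) :
  (forall x, a <= x -> is_derive x (1:R) f (df x)) ->
  (forall x, a <= x -> 0 <= df x) -> a <= y -> f a <= f y.
Proof.
move=> Hd H0 ay.
have [||c] := @MVT_segment R f df a y ay.
- by move=> x; rewrite in_itv/= => /andP[ax _]; apply/Hd/ltW.
- apply: derivable_within_continuous => x; rewrite in_itv/= => /andP[ax _].
  by have [] := Hd x ax.
rewrite in_itv/= => /andP[ac _] e.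
by rewrite -subr_ge0 e mulr_ge0 ?H0 ?subr_ge0.
Qed.

Lemma ln_le_sub1 x : 0 < x -> ln x <= x - 1.
Proof. by move=> x0; have := @le_ln1Dx R (x - 1); rewrite subrKC; apply; lra. Qed.

Lemma ln_ge_1subV x : 0 < x -> 1 - x^-1 <= ln x.
Proof.
move=> x0; have := @ln_le_sub1 (x^-1).
by rewrite invr_gt0 lnV ?posrE// => /(_ x0); lra.
Qed.

Lemma ln_le_half_sub_inv y : 1 <= y -> ln y <= (y - y^-1) / 2.
Proof.
move=> y1; have y0 : 0 < y by lra.
pose f := fun x : R => x * x - 2 * (x * ln x).
have : f 1 <= f y.
  apply: (@is_derive_ge0_le f (fun x => 2 * x - 2 * (ln x + 1))) => // x x1.
    have x0 : 0 < x by lra.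
    have := is_derive1_ln x0 => ?.
    have -> : f = (id * id - 2 \*: (id * @ln R)).
      by apply/funext => z; rewrite /f /= !fctE.
    apply: is_derive_eq; rewrite /= /GRing.scale /=.
    by rewrite mulfV ?gt_eqF//; ring.
  by have := @ln_le_sub1 x; lra.
rewrite /f ln1 !mulr0 subr0 mulr1 => h.
rewrite ler_pdivlMr// -(ler_pM2l y0) mulrBr mulfV ?gt_eqF//; lra.
Qed.

Lemma ln_ge_midpoint y : 1 <= y -> 2 * (y - 1) <= (y + 1) * ln y.
Proof.
move=> y1; pose f := fun x : R => x * ln x + ln x - 2 * x.
have : f 1 <= f y.
  apply: (@is_derive_ge0_le f (fun x => ln x + 1 + x^-1 - 2)) => // x x1.
    have x0 : 0 < x by lra.
    have := is_derive1_ln x0 => ?.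
    have -> : f = (id * @ln R + @ln R - 2 \*: id).
      by apply/funext => z; rewrite /f /= !fctE.
    apply: is_derive_eq; rewrite /= /GRing.scale /=.
    by rewrite mulfV ?gt_eqF//; ring.
  have := @ln_ge_1subV x; lra.
rewrite /f ln1; lra.
Qed.

Lemma expR1_gt2 : 2 < expR 1 :> R.
Proof. by have := @expR_gt1Dx R 1 (oner_neq0 _); lra. Qed.

Lemma ln2_gt : 1 / 2 < ln 2 :> R.
Proof.
have := @ln_ge_midpoint 2; rewrite (_ : 1 <= 2) ?ler1n// => /(_ isT); lra.
Qed.

(** Apply [exp t > 1 + t] at [t = ln 2 - 1], nonzero because [e > 2]. The strict inequality
    [e ln 2 < 2] is the room that [pot_base] turns into a damping factor below 1. *)
Lemma ln2_lt : ln 2 < 2 / expR 1 :> R.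
Proof.
have e0 := @expR_gt0 R 1; have e2 := expR1_gt2.
have h : ln (2 / expR 1) = ln 2 - 1 :> R by rewrite ln_div ?posrE// expRK.
have x0 : 0 < 2 / expR 1 :> R by rewrite divr_gt0.
have n1 : ln (2 / expR 1) != 0 :> R.
  rewrite h; apply/eqP => h1; have : ln 2 = ln (expR 1) :> R by rewrite expRK; lra.
  move=> /ln_inj h2; have : 2 = expR 1 :> R by apply: h2; rewrite posrE.
  lra.
have := expR_gt1Dx n1; rewrite lnK ?posrE// h; lra.
Qed.

Lemma ln2_lt1 : ln 2 < 1 :> R.
Proof.
apply: lt_trans ln2_lt _; rewrite ltr_pdivrMr ?expR_gt0// mul1r; exact: expR1_gt2.
Qed.

(* The logarithm of the ratio of [n!] to [(n / e)^n sqrt n]. *)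
Definition stir (n : nat) : R := ln n`!%:R + n%:R - (n%:R + 1/2) * ln n%:R.

(** The difference equals [(n + 1/2) ln (1 + 1/n) - 1]; the two bounds on [ln] above give its sign
    and an upper estimate that telescopes. *)
Lemma stir_step n : (0 < n)%N ->
  0 <= stir n - stir n.+1 <= 1 / 4 * (n%:R^-1 - n.+1%:R^-1).
Proof.
move=> n0; have m0 : 0 < n%:R :> R by rewrite ltr0n.
pose m : R := n%:R.
have mE : n.+1%:R = m + 1 :> R by rewrite -natr1.
have -> : stir n - stir n.+1 = (m + 1/2) * ln ((m + 1) / m) - 1.
  rewrite /stir factS natrM lnM ?posrE ?ltr0n ?fact_gt0// mE ln_div ?posrE//; first by ring.
  by rewrite -mE ltr0n.
set y := (m + 1) / m; have ym : y * m = m + 1 by rewrite /y mulfVK ?gt_eqF.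
have y1 : 1 <= y by rewrite /y ler_pdivlMr//; rewrite /m; lra.
have h1 := ln_ge_midpoint y1; have h2 := ln_le_half_sub_inv y1.
apply/andP; split.
  have e1 : (y + 1) * m = 2 * m + 1 by rewrite mulrDl ym; ring.
  have e2 : (y - 1) * m = 1 by rewrite mulrBl ym; ring.
  have : m * (2 * (y - 1)) <= m * ((y + 1) * ln y) by rewrite ler_wpM2l// ltW.
  rewrite (_ : m * (2 * (y - 1)) = 2); last by rewrite mulrCA (mulrC m) e2 mulr1.
  rewrite mulrA (mulrC m) e1; lra.
have mp : 0 < m by [].
have : (m + 1/2) * ln y <= (m + 1/2) * ((y - y^-1) / 2) by rewrite ler_wpM2l//; lra.
have -> : (m + 1/2) * ((y - y^-1) / 2) = 1 + 1 / 4 * (m^-1 - n.+1%:R^-1); last first.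
  rewrite -/m mE; move: (m^-1) ((m+1)^-1) => u v.
  lra.
rewrite mE /y; field.
by apply/andP; split; rewrite gt_eqF//; lra.
Qed.

Lemma stir_bounds n : (0 < n)%N -> 3/4 <= stir n <= 1.
Proof.
have s1 : stir 1 = 1 by rewrite /stir (_ : 1`! = 1)%N // ln1; lra.
suff H k : 3/4 + 1/4 * k.+1%:R^-1 <= stir k.+1 <= 1.
  case: n => // n _; have /andP[h ->] := H n; rewrite andbT.
  by apply: le_trans h; rewrite lerDl mulr_ge0.
elim: k => [|k /andP[a1 a2]]; first by rewrite s1 invr1; apply/andP; split; lra.
have /andP[] := @stir_step k.+1 isT; move: a1 a2.
move: (k.+1%:R^-1) (k.+2%:R^-1) (stir k.+1) (stir k.+2) => u v s t a1 a2 b1 b2.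
by apply/andP; split; lra.
Qed.

Lemma expR_stirling n : (0 < n)%N ->
  n`!%:R = expR (stir n) * (n%:R ^+ n * Num.sqrt n%:R) / expR 1 ^+ n :> R.
Proof.
move=> n0; have m0 : 0 < n%:R :> R by rewrite ltr0n.
rewrite /stir -[in LHS](@lnK R n`!%:R) ?posrE ?ltr0n ?fact_gt0//.
have -> : n%:R ^+ n * Num.sqrt n%:R = expR ((n%:R + 1/2) * ln n%:R) :> R.
  rewrite mulrDl expRD expRM_natl lnK ?posrE//; congr (_ * _).
  by rewrite -powR12_sqrt ?ltW// /powR gt_eqF// div1r.
by rewrite -expRM_natl mulr1 -expRD -expRB; congr expR; ring.
Qed.

End LogInequalities.

(** * Mertens estimates *)

Section Primorial.
Local Open Scope nat_scope.

Lemma dvdn_prod_primes a k N :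
  (forall p, a <= p < k -> prime p -> p %| N) ->
  \prod_(a <= p < k | prime p) p %| N.
Proof.
elim: k => [|k IH] H; first by rewrite big_geq.
have [ka|ak] := ltnP k a; first by rewrite big_geq.
rewrite big_mkcond big_nat_recr//= -big_mkcond.
have IH' : \prod_(a <= p < k | prime p) p %| N.
  by apply: IH => p /andP[ap pk]; apply: H; rewrite ap ltnS ltnW.
case: ifP => pk; last by rewrite muln1.
rewrite Gauss_dvd ?IH' ?H ?ak ?ltnS ?leqnn//.
rewrite big_nat_cond; apply: (big_ind (fun x => coprime x k)).
- by rewrite coprime1n.
- by move=> x y cx cy; rewrite coprimeMl cx.
- move=> i /andP[/andP[_ ik] pi].
  by rewrite prime_coprime// dvdn_prime2// neq_ltn ik.
Qed.

Lemma bin_leq_expn n k : 'C(n, k) <= 2 ^ n.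
Proof.
elim: n k => [|n IH] [|k]; rewrite ?bin0 ?expn_gt0//.
by rewrite binS expnS mul2n -addnn leq_add.
Qed.

(** Chebyshev's argument: for [n = 2k + 1] the primes in [(k + 1, n]] divide ['C(n, k)], and
    induction covers the primes up to [k + 1]. With base 8 the crude bound ['C(n, k) <= 2^n] is
    enough. *)
Lemma primorial_leq n : \prod_(0 <= p < n.+1 | prime p) p <= 8 ^ n.
Proof.
have [m] := ubnP n; elim: m n => // m IH n nm.
have [|n2] := leqP n 2.
  by case: n nm => [|[|[|//]]] _ _; rewrite !(big_mkcond prime) !big_nat_recr//= big_geq.
have [no|ne] := boolP (odd n); last first.
  rewrite big_mkcond big_nat_recr//= -big_mkcond.
  case: ifP => [pn|_].
    by case: (even_prime pn) ne n2 => [->//|->].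
  rewrite muln1; have := IH n.-1; rewrite prednK; last by case: (n) n2.
  move=> h; apply: leq_trans (h _) _; first by case: (n) nm n2.
  by rewrite leq_exp2l// leq_pred.
pose k := n./2; have nE : n = k.*2.+1 by rewrite -[LHS]odd_double_half no.
have k1 : 0 < k by rewrite -double_gt0; move: n2; rewrite nE; case: (k).
rewrite (@big_cat_nat _ _ _ k.+2)//=; last by rewrite nE -addnn; lia.
apply: (@leq_trans (8 ^ k.+1 * 2 ^ n)).
  apply: leq_mul; first by apply: IH; move: nm; rewrite nE -addnn; lia.
  apply: leq_trans (bin_leq_expn n k).
  apply: dvdn_leq; first by rewrite bin_gt0 nE -addnn; lia.
  apply: dvdn_prod_primes => p /andP[kp pn] pp.
  have : p %| n`! by rewrite dvdn_fact// prime_gt0.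
  rewrite -(@bin_fact n k); last by rewrite nE -addnn; lia.
  rewrite !Euclid_dvdM// => /or3P[//|h|h]; exfalso; move: h; rewrite fact_prod Euclid_dvd_prod // big_has.
  - by case/hasP => i; rewrite mem_index_iota => /andP[i1 ik] /dvdn_leq; lia.
  - by case/hasP => i; rewrite mem_index_iota => /andP[i1 ik] /dvdn_leq; lia.
rewrite (_ : 8 = 2 ^ 3)// -!expnM -expnD leq_exp2l//; lia.
Qed.
End Primorial.

(** * Mertens' two estimates and reciprocal sums of primes in windows *)

Section Mertens.
Context {R : realType}.

Definition chebA n : R := \sum_(0 <= p < n.+1 | prime p) ln p%:R / p%:R.
Definition primeH n : R := \sum_(0 <= p < n.+1 | prime p) p%:R^-1.

Lemma prime_lnr_ge0 n : 0 <= ln n%:R :> R.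
Proof. by case: n => [|n]; [rewrite ln0|rewrite ln_ge0// ler1n]. Qed.

Lemma theta_le n : \sum_(0 <= p < n.+1 | prime p) ln p%:R <= n%:R * 3 :> R.
Proof.
have -> : \sum_(0 <= p < n.+1 | prime p) ln p%:R =
    ln (\prod_(0 <= p < n.+1 | prime p) p)%:R :> R.
  suff : (0 < \prod_(0 <= p < n.+1 | prime p) p)%N /\
    \sum_(0 <= p < n.+1 | prime p) ln p%:R =
    ln (\prod_(0 <= p < n.+1 | prime p) p)%:R :> R by case.
  elim: (index_iota 0 n.+1) => [|p s [s0 IH]]; first by rewrite !big_nil ln1.
  rewrite !big_cons; case: ifP => // pp; have p0 := prime_gt0 pp; rewrite muln_gt0 p0 s0; split => //.
  by rewrite natrM lnM ?posrE ?ltr0n// IH.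
apply: (@le_trans _ _ (ln ((8 ^ n)%N)%:R)).
  rewrite ler_ln ?posrE ?ltr0n ?expn_gt0// ?ler_nat ?primorial_leq//.
  by rewrite prodn_cond_gt0// => i /prime_gt0.
rewrite natrX lnXn// -[leLHS]mulr_natl ler_wpM2l//.
rewrite (_ : 8%:R = 2 ^+ 3) ?lnXn//; last by rewrite -!natrX.
have := @ln2_lt1 R; rewrite mulrSr !mulrS; lra.
Qed.

Lemma ln_fact_legendre n :
  ln n`!%:R = \sum_(0 <= p < n.+1 | prime p) (logn p n`!)%:R * ln p%:R :> R.
Proof.
have e : n`! = (\prod_(0 <= p < n.+1 | prime p) p ^ logn p n`!)%N.
  rewrite -{1}[n`!]partnT ?fact_gt0// (@widen_partn (n`! + n))//; last by lia.
  rewrite (@big_cat_nat _ _ _ n.+1)//=; last by lia.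
  have -> : (\prod_(n.+1 <= p < (n`! + n).+1 | p \in predT) p ^ logn p n`! = 1)%N; last rewrite muln1.
    rewrite big_nat_cond big1// => p /andP[/andP[np _] _]; have [pp|] := boolP (prime p); last first.
      by rewrite lognE => /negbTE->.
    rewrite logn_fact// big_nat big1 ?expn0// => k /andP[k1 _].
    by rewrite divn_small// (leq_trans np)// -[leqLHS]expn1 leq_pexp2l// prime_gt0.
  rewrite [RHS]big_mkcond; apply: eq_bigr => p _.
  by case: ifP => // pp; rewrite lognE pp.
rewrite {1}e.
suff : (0 < \prod_(0 <= p < n.+1 | prime p) p ^ logn p n`!)%N /\
  ln (\prod_(0 <= p < n.+1 | prime p) p ^ logn p n`!)%N%:R =
  \sum_(0 <= p < n.+1 | prime p) (logn p n`!)%:R * ln p%:R :> R by case.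
elim: (index_iota 0 n.+1) => [|p s [s0 IH]]; first by rewrite !big_nil ln1.
rewrite !big_cons; case: ifP => // pp.
have p0 := prime_gt0 pp; rewrite muln_gt0 expn_gt0 p0 s0; split => //.
by rewrite natrM lnM ?posrE ?ltr0n ?expn_gt0 ?p0// IH natrX lnXn ?ltr0n// mulr_natl.
Qed.

Lemma logn_fact_ge p n : prime p -> (0 < n)%N -> n%:R / p%:R - 1 <= (logn p n`!)%:R :> R.
Proof.
move=> pp n0; have p0 : 0 < p%:R :> R by rewrite ltr0n prime_gt0.
apply: (@le_trans _ _ (n %/ p)%N%:R).
  rewrite lerBlDr ler_pdivrMr// natr1 -natrM ler_nat; apply/ltnW/ltn_ceil; exact: prime_gt0.
by rewrite ler_nat logn_fact// big_ltn// expn1 leq_addr.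
Qed.

Lemma logn_fact_le p n : prime p ->
  (logn p n`!)%:R <= n%:R * (p%:R^-1 + (p%:R * (p%:R - 1))^-1) :> R.
Proof.
move=> pp; have p1 : 1 < p%:R :> R by rewrite ltr1n prime_gt1.
have -> : p%:R^-1 + (p%:R * (p%:R - 1))^-1 = (p%:R - 1)^-1 :> R.
  by field; apply/andP; split; rewrite gt_eqF//; lra.
have H m : \sum_(1 <= k < m.+1) p%:R ^- k = (p%:R - 1)^-1 * (1 - p%:R ^- m) :> R.
  elim: m => [|m IH]; first by rewrite big_geq// expr0 invr1 subrr mulr0.
  rewrite big_nat_recr//= IH exprS; field.
  by rewrite expf_neq0 ?gt_eqF//=; lra.
rewrite logn_fact// natr_sum.
apply: (@le_trans _ _ (n%:R * \sum_(1 <= k < n.+1) p%:R ^- k)); last first.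
  rewrite ler_wpM2l// H ler_piMr//; first by rewrite invr_ge0; lra.
rewrite mulr_sumr ler_sum// => k _.
by rewrite ler_pdivlMr ?exprn_gt0 ?(lt_trans _ p1)// -natrX -natrM ler_nat leq_trunc_div.
Qed.

Lemma ln_fact_le n : ln n`!%:R <= n%:R * ln n%:R :> R.
Proof.
case: n => [|n]; first by rewrite fact0 ln1 mul0r.
rewrite mulr_natl -lnXn ?ltr0n// ler_ln ?posrE ?exprn_gt0 ?ltr0n ?fact_gt0//.
rewrite -natrX ler_nat fact_prod.
apply: leq_trans (_ : (\prod_(1 <= i < n.+2) n.+1 <= _)%N); last by rewrite prod_nat_const_nat subn1.
by rewrite big_nat [leqRHS]big_nat leq_prod// => i /andP[_].
Qed.

Lemma ln_fact_ge n : n%:R * ln n%:R - n%:R <= ln n`!%:R :> R.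
Proof.
case: n => [|n]; first by rewrite fact0 ln1 mul0r subrr.
have /andP[+ _] := @stir_bounds R n.+1 isT; rewrite /stir.
have := prime_lnr_ge0 n.+1; lra.
Qed.

(** The decrements of [G m = (3 + ln m) / m] dominate the terms. *)
Lemma sum_ln_telescope n : \sum_(2 <= m < n.+1) ln m%:R / (m%:R * (m%:R - 1)) <= 3 :> R.
Proof.
pose G m : R := (3 + ln m%:R) / m%:R.
have [|n1] := leqP n 1; first by move=> n1; rewrite big_geq.
suff : \sum_(2 <= m < n.+1) ln m%:R / (m%:R * (m%:R - 1)) <= G 1 - G n.
  have : 0 <= G n by rewrite divr_ge0// addr_ge0// prime_lnr_ge0.
  by rewrite [G 1]/G ln1; lra.
elim: n n1 => // n IH; rewrite ltnS leq_eqVlt => /predU1P[<-|n1].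
  rewrite big_nat1 /G ln1 (_ : 2%:R * (2%:R - 1) = 2 :> R); last by ring.
  have := @ln2_lt1 R; lra.
rewrite big_nat_recr//=; last by lia.
have {}IH := IH n1.
have n0 : 0 < n%:R :> R by rewrite ltr0n ltnW.
suff : ln n.+1%:R / (n.+1%:R * (n.+1%:R - 1)) <= G n - G n.+1.
  by move=> h; apply: le_trans (lerD IH h) _; rewrite addrA subrK.
have h : ln n.+1%:R - ln n%:R <= n%:R^-1 :> R.
  rewrite -ln_div ?posrE ?ltr0n ?(ltnW n1)//.
  apply: le_trans (ln_le_sub1 _) _; first by rewrite divr_gt0.
  by rewrite -natr1 mulrDl divff ?gt_eqF// mul1r; lra.
rewrite /G -natr1 addrK; move: h; rewrite -natr1.
move: (ln (n%:R + 1)) (ln n%:R) => L l h.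
have -> : (3 + l) / n%:R - (3 + L) / (n%:R + 1) =
   (3 + l + n%:R * (l - L)) / ((n%:R + 1) * n%:R).
  by field; apply/andP; split; rewrite gt_eqF//; lra.
rewrite ler_pM2r; last by rewrite invr_gt0 mulr_gt0//; lra.
have : n%:R * (L - l) <= 1.
  by rewrite -[leRHS](@mulfV _ (n%:R : R)) ?gt_eqF// ler_pM2l.
have : n%:R^-1 <= 1 :> R by rewrite invf_le1// ler1n ltnW.
nra.
Qed.

(** In Legendre's formula the exponent of [p] in [n!] is at least [n / p - 1]; the loss, the sum of
    [ln p], is [O(n)] by [theta_le]. *)
Lemma chebA_le n : (0 < n)%N -> chebA n <= ln n%:R + 3.
Proof.
move=> n0; have m0 : 0 < n%:R :> R by rewrite ltr0n.
rewrite -(ler_pM2l m0).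
have h1 := ln_fact_le n; rewrite ln_fact_legendre in h1.
have h2 := theta_le n.
suff : n%:R * chebA n - \sum_(0 <= p < n.+1 | prime p) ln p%:R
   <= \sum_(0 <= p < n.+1 | prime p) (logn p n`!)%:R * ln p%:R by lra.
rewrite /chebA mulr_sumr -sumrB ler_sum// => p pp.
have := @logn_fact_ge p n pp n0; have := prime_lnr_ge0 p; nra.
Qed.

(** The converse direction: higher prime powers add at most the sum of [ln p / (p (p - 1))], bounded
    by the sum over all integers. *)
Lemma chebA_ge n : (0 < n)%N -> ln n%:R - 4 <= chebA n.
Proof.
move=> n0; have m0 : 0 < n%:R :> R by rewrite ltr0n.
rewrite -(ler_pM2l m0).
have h1 := ln_fact_ge n; rewrite ln_fact_legendre in h1.
have h2 := sum_ln_telescope n.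
suff : \sum_(0 <= p < n.+1 | prime p) (logn p n`!)%:R * ln p%:R <=
   n%:R * (chebA n + \sum_(2 <= m < n.+1) ln m%:R / (m%:R * (m%:R - 1))) by nra.
have h3 : \sum_(0 <= p < n.+1 | prime p) ln p%:R / (p%:R * (p%:R - 1)) <=
   \sum_(2 <= m < n.+1) ln m%:R / (m%:R * (m%:R - 1)) :> R.
  rewrite (@big_cat_nat _ _ _ 2)//= [X in X + _]big_nat_cond big1 ?add0r; last first.
    by move=> p /andP[/andP[_ p2] /prime_gt1]; lia.
  rewrite big_mkcond ler_sum_nat// => m /andP[m2 _]; case: ifP => // _.
  rewrite divr_ge0 ?prime_lnr_ge0// mulr_ge0// subr_ge0 ler1n; lia.
apply: (@le_trans _ _ (n%:R * (chebA n + \sum_(0 <= p < n.+1 | prime p) ln p%:R / (p%:R * (p%:R - 1))))).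
  rewrite /chebA -big_split mulr_sumr ler_sum// => p pp /=.
  have := @logn_fact_le p n pp; have := prime_lnr_ge0 p.
  move=> l0 h; apply: le_trans (ler_wpM2r l0 h) _.
  rewrite -!mulrA ler_wpM2l// mulrDl; lra.
by rewrite ler_wpM2l// lerD2l.
Qed.

Lemma chebA_recr n : chebA n.+1 = chebA n + (if prime n.+1 then ln n.+1%:R / n.+1%:R else 0).
Proof. by rewrite /chebA big_mkcond big_nat_recr//= -big_mkcond. Qed.

Lemma primeH_recr n : primeH n.+1 = primeH n + (if prime n.+1 then n.+1%:R^-1 else 0).
Proof. by rewrite /primeH big_mkcond big_nat_recr//= -big_mkcond. Qed.

(** Partial summation one step at a time. The jump of [primeH] at a prime cancels the jump of
    [chebA / ln], leaving [chebA n] times the decrement of [1 / ln]; then [chebA n] is replaced by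
    [ln n] up to a bounded error. *)
Lemma mertens_step n : (1 < n)%N ->
  let Q k := primeH k - chebA k / ln k%:R in
  let d := (ln n%:R)^-1 - (ln n.+1%:R)^-1 in
  let D := ln (ln n.+1%:R) - ln (ln n%:R) in
  D - 5 * d <= Q n.+1 - Q n <= D + 3 * d.
Proof.
move=> n1; set Q := fun k => _; set d := _ - _; set D := _ - _ => /=.
have l0 : 0 < ln n%:R :> R by rewrite ln_gt0// ltr1n.
have lL : ln n%:R < ln n.+1%:R :> R by rewrite ltr_ln ?posrE ?ltr0n ?ltr_nat// ltnW.
have L0 := lt_trans l0 lL.
have lL1 : ln n.+1%:R <= ln n%:R + 1 :> R.
  have n0 : 0 < n%:R :> R by rewrite ltr0n ltnW.
  rewrite -lerBlDl -ln_div ?posrE ?ltr0n ?(ltnW n1)//.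
  apply: le_trans (ln_le_sub1 _) _; first by rewrite divr_gt0.
  rewrite lerBlDr ler_pdivrMr// -natr1.
  have : 1 <= n%:R :> R by rewrite ler1n ltnW.
  lra.
have a1 : chebA n <= ln n%:R + 3 by apply/chebA_le/ltnW.
have a2 : ln n%:R - 4 <= chebA n by apply/chebA_ge/ltnW.
have -> : Q n.+1 - Q n = chebA n * d.
  rewrite /Q primeH_recr chebA_recr /d; case: ifP => _.
    by field; rewrite !gt_eqF// addrC natr1 ltr0n.
  by field; rewrite !gt_eqF.
have hD1 : ln n%:R * d <= D.
  rewrite /D -ln_div ?posrE//; have := @ln_ge_1subV R (ln n.+1%:R / ln n%:R).
  rewrite divr_gt0// => /(_ isT); apply: le_trans.
  by rewrite invf_div /d mulrBr mulfV ?gt_eqF.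
have hD2 : D <= ln n.+1%:R * d.
  rewrite /D -ln_div ?posrE//; have := @ln_le_sub1 R (ln n.+1%:R / ln n%:R).
  rewrite divr_gt0// => /(_ isT) h; apply: le_trans h _.
  by rewrite /d mulrBr mulfV ?gt_eqF.
have d0 : 0 <= d by rewrite subr_ge0 lef_pV2 ?posrE// ltW.
move: a1 a2 hD1 hD2 lL1 d0; move: (chebA n) (ln n%:R) (ln n.+1%:R) D d => A l L D' d'.
by move=> *; apply/andP; split; nra.
Qed.

Lemma mertens2 : exists2 C : R, 0 < C &
  forall n, (1 < n)%N -> `|primeH n - ln (ln n%:R)| <= C.
Proof.
pose Q k := primeH k - chebA k / ln k%:R.
pose c0 : R := `|Q 2 - ln (ln 2%:R)| + 8 * (ln 2%:R)^-1.
have l2 : 0 < ln 2%:R :> R by rewrite ln_gt0// ltr1n.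
have i2 : 0 < (ln 2%:R)^-1 :> R by rewrite invr_gt0.
(* The slack terms [5 / ln n] and [3 / ln n] telescope against the errors of [mertens_step], so one
   constant [c0] survives the induction. *)
have H n : (1 < n)%N -> - c0 + 5 * (ln n%:R)^-1 <= Q n - ln (ln n%:R) <= c0 - 3 * (ln n%:R)^-1.
  elim: n => // n IH; rewrite ltnS leq_eqVlt => /predU1P[<-|n1].
    have := lexx `|Q 2 - ln (ln 2%:R)|; rewrite ler_norml /c0 => /andP[].
    by move=> h1 h2; apply/andP; split; move: h1 h2;
      move: (Q 2) (ln (ln 2)) (ln 2%:R)^-1 i2 => q v z i2; move: (`|q - v|) => u; lra.
  have /andP[h1 h2] := mertens_step n1; have /andP[h3 h4] := IH n1.
  by apply/andP; split; move: h1 h2 h3 h4; rewrite -!/(Q _); lra.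
exists (c0 + 10 + 10 * (ln 2%:R)^-1).
  by rewrite addr_gt0 ?mulr_gt0// ltr_wpDl// addr_ge0// mulr_ge0// ltW.
move=> n n1; have /andP[h1 h2] := H n n1.
have l0 : 0 < ln n%:R :> R by rewrite ln_gt0// ltr1n.
have ln2 : (ln n%:R)^-1 <= (ln 2%:R)^-1 :> R.
  by rewrite lef_pV2 ?posrE// ler_ln ?posrE ?ltr0n ?ler_nat// ltnW.
have iv0 : 0 < (ln n%:R)^-1 :> R by rewrite invr_gt0.
have a1 := chebA_le (ltnW n1); have a2 := chebA_ge (ltnW n1).
have b1 : chebA n / ln n%:R <= 1 + 3 * (ln n%:R)^-1.
  by rewrite ler_pdivrMr// mulrDl mul1r -mulrA mulVf ?gt_eqF// mulr1.
have b2 : 1 - 4 * (ln n%:R)^-1 <= chebA n / ln n%:R.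
  by rewrite ler_pdivlMr// mulrBl mul1r -mulrA mulVf ?gt_eqF// mulr1.
move: h1 h2 b1 b2; rewrite /Q; move: (chebA n / _) (primeH n) => A H'.
by move=> *; rewrite ler_norml; apply/andP; split; lra.
Qed.

Lemma ler_sum_sub_nat (X Y : nat) (P Q : pred nat) (f : nat -> R) :
  (forall p, (p < X)%N -> P p -> Q p /\ (p < Y)%N) -> (forall p, 0 <= f p) ->
  \sum_(0 <= p < X | P p) f p <= \sum_(0 <= p < Y | Q p) f p.
Proof.
move=> H f0.
rewrite (@big_nat_widen _ _ _ 0 X (X + Y)) ?leq_addr//.
rewrite (@big_nat_widen _ _ _ 0 Y (X + Y)) ?leq_addl//.
rewrite big_mkcond [leRHS]big_mkcond ler_sum// => p _.
case: ifP => [/andP[Pp pX]|_]; last by case: ifP.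
by have [-> ->] := H p pX Pp.
Qed.

(** A difference of two values of [chebA]; 10 covers the errors 3 and 4 of its bounds and the
    rounding of [x] and [y] to integers. *)
Lemma sum_primes_range (X : nat) (x y : R) : 0 < x -> x <= y ->
  \sum_(0 <= p < X | prime p && (x <= p%:R <= y)) ln p%:R / p%:R <= ln (y / x) + 10.
Proof.
move=> x0 xy; have y0 := lt_le_trans x0 xy.
have f0 p : 0 <= ln p%:R / p%:R :> R by rewrite divr_ge0// prime_lnr_ge0.
have lyx : 0 <= ln (y / x) by rewrite ln_ge0// ler_pdivlMr// mul1r.
have [y1|y1] := ltP y 1.
  rewrite big1 ?addr_ge0// => p /andP[pp /andP[_ py]].
  have := le_lt_trans py y1; rewrite ltrn1; have := prime_gt0 pp; lia.
have [n /andP[n1 n2]] : exists n : nat, n%:R <= y < n.+1%:R.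
  by exists (Num.truncn y); apply: truncn_itv; apply: ltW.
have ngt0 : (0 < n)%N by rewrite -ltnS -(ltr_nat R) (le_lt_trans y1).
have lnn : ln n%:R <= ln y by rewrite ler_ln ?posrE ?ltr0n.
have an := chebA_le ngt0.
have [x1|x1] := ltP x 1.
  apply: (@le_trans _ _ (chebA n)).
    apply: ler_sum_sub_nat => // p pX /andP[-> /andP[_ py]]; split => //.
    by rewrite -(ltr_nat R); apply: le_lt_trans py n2.
  have : ln y <= ln (y / x) by rewrite ler_ln ?posrE ?divr_gt0// ler_pdivlMr// ler_piMr// ltW.
  lra.
have [m /andP[m1 m2]] : exists n : nat, n%:R <= x < n.+1%:R.
  by exists (Num.truncn x); apply: truncn_itv; apply: ltW.
have mgt0 : (0 < m)%N by rewrite -ltnS -(ltr_nat R) (le_lt_trans x1).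
have am := chebA_ge mgt0.
have mn : (m <= n)%N by rewrite -ltnS -(ltr_nat R) (le_lt_trans m1)// (le_lt_trans xy).
have -> : ln (y / x) = ln y - ln x by rewrite ln_div.
have lx : ln x <= ln m%:R + 1.
  have mp : 0 < m%:R :> R by rewrite ltr0n.
  rewrite -lerBlDl -ln_div ?posrE//.
  apply: le_trans (ln_le_sub1 _) _; first by rewrite divr_gt0.
  rewrite lerBlDr ler_pdivrMr//; have : 1 <= m%:R :> R by rewrite ler1n.
  by move: m2; rewrite -natr1; lra.
apply: (@le_trans _ _ (\sum_(0 <= p < n.+1 | prime p && (m <= p)%N) ln p%:R / p%:R)).
  apply: ler_sum_sub_nat => // p pX /andP[-> /andP[xp py]]; split => /=.
    by rewrite -ltnS -(ltr_nat R); apply: (le_lt_trans (le_trans m1 xp)); rewrite ltr_nat.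
  by rewrite -(ltr_nat R); apply: le_lt_trans py n2.
have e : chebA n = chebA m.-1 + \sum_(0 <= p < n.+1 | prime p && (m <= p)%N) ln p%:R / p%:R.
  rewrite /chebA prednK// (@big_cat_nat _ _ _ m)//=; last by rewrite leqW.
  congr (_ + _); rewrite [RHS](@big_cat_nat _ _ _ m)//=; last by rewrite leqW.
  rewrite [X in X + _]big_nat_cond [X in X + _]big1 ?add0r.
    rewrite big_nat_cond [RHS]big_nat_cond; apply: eq_bigl => p.
    by case: (m <= p)%N; rewrite ?andbF// !andbT.
  by move=> p /andP[/andP[_ pm] /andP[_ mp]]; have := leq_ltn_trans mp pm; rewrite ltnn.
have em : chebA m <= chebA m.-1 + 1.
  rewrite -{1}(prednK mgt0) chebA_recr lerD2l; case: ifP => // _; rewrite prednK//.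
  have mp : 0 < m%:R :> R by rewrite ltr0n.
  by rewrite ler_pdivrMr// mul1r; have := @ln_le_sub1 R m%:R mp; lra.
move: an am e em lx lnn; move: (\sum_(_ <= _ < _ | _) _) (chebA n) (chebA m) (chebA m.-1).
move: (ln n%:R) (ln m%:R) (ln x) (ln y) => a b c d S An Am Am' *.
lra.
Qed.

(** The ratio [2^16] works because [16 ln 2 > 8 = 1 + 3 + 4], where 3 and 4 are the errors in the
    bounds on [chebA]. *)
Lemma sum_primes_ge (n m : nat) : (0 < n)%N -> (2 ^ 16 * n <= m)%N ->
  1 <= \sum_(n.+1 <= p < m.+1 | prime p) ln p%:R / p%:R :> R.
Proof.
move=> n0 nm.
have nm' : (n <= m)%N by apply: leq_trans nm; rewrite leq_pmull// expn_gt0.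
have e : chebA m = chebA n + \sum_(n.+1 <= p < m.+1 | prime p) ln p%:R / p%:R.
  by rewrite /chebA (@big_cat_nat _ _ _ n.+1).
have h1 := chebA_le n0; have h2 := chebA_ge (leq_trans n0 nm').
have : ln (2 ^ 16 * n)%N%:R <= ln m%:R :> R.
  by rewrite ler_ln ?posrE ?ltr0n ?ler_nat// ?muln_gt0 ?expn_gt0//; apply: leq_trans nm'.
rewrite natrM lnM ?posrE ?ltr0n ?expn_gt0// natrX lnXn// -[ln 2 *+ 16]mulr_natl.
by have := @ln2_gt R; lra.
Qed.

Lemma exp2_half_sum n : \sum_(0 <= h < n) 2 ^- h * (h%:R + 1) <= 4 :> R.
Proof.
suff : \sum_(0 <= h < n) 2 ^- h * (h%:R + 1) = 4 - (2 * n%:R + 4) * 2 ^- n :> R.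
  by move=> ->; rewrite lerBlDr lerDl mulr_ge0// ?invr_ge0 ?exprn_ge0// addr_ge0// mulr_ge0.
elim: n => [|n IH]; first by rewrite big_geq// expr0; lra.
rewrite big_nat_recr//= IH exprS -natr1; field.
by rewrite expf_neq0.
Qed.

Lemma ex_dyadic (t : R) : 1 < t -> exists h : nat, 2 ^+ h <= t < 2 ^+ h.+1.
Proof.
move=> t1; have H : exists n, t < 2 ^+ n.
  exists (Num.truncn t).+1; have /andP[_ h] := truncn_itv (ltW (lt_trans ltr01 t1)).
  by apply: lt_le_trans h _; rewrite -natrX ler_nat ltnW// ltn_expl.
case: (ex_minnP H) => [[|n]]; first by rewrite expr0; lra.
move=> h1 h2; exists n; rewrite h1 andbT leNgt; apply/negP => /h2; by rewrite ltnn.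
Qed.

Lemma kernel_scale_far (V a b : R) : 1 <= V -> 0 < b -> b * V < a ->
  exists h : nat, [/\ a <= b * V * 2 ^+ h.+1, b <= a * V * 2 ^+ h.+1 & V * b / a <= 2 ^- h].
Proof.
move=> V1 b0 ba; have V0 : 0 < V by lra.
have bV : 0 < b * V by rewrite mulr_gt0.
have [h /andP[]] := @ex_dyadic (a / (b * V)) ltac:(by rewrite ltr_pdivlMr// mul1r).
rewrite ler_pdivlMr// ltr_pdivrMr// => h1 h2; exists h; split.
- by rewrite mulrC ltW.
- have h3 : b <= a by apply: le_trans (ltW ba); rewrite ler_peMr// ltW.
  have h4 : 1 <= 2 ^+ h.+1 :> R by rewrite exprn_ege1// ler1n.
  have h5 : 1 <= V * 2 ^+ h.+1 by rewrite mulr_ege1.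
  rewrite -mulrA; nra.
- have a0 : 0 < a by lra.
  by rewrite ler_pdivrMr// mulrC ler_pdivlMl ?exprn_gt0// mulrA -mulrA (mulrC V).
Qed.

Lemma kernel_scale (V a b : R) : 1 <= V -> 0 < a -> 0 < b ->
  exists h : nat, [/\ a <= b * V * 2 ^+ h.+1, b <= a * V * 2 ^+ h.+1
     & Num.min 1 (Num.min (V * b / a) (V * a / b)) <= 2 ^- h].
Proof.
move=> V1 a0 b0; have V0 : 0 < V by lra.
have [ba|ab] := ltP (b * V) a.
  have [h [h1 h2 h3]] := kernel_scale_far V1 b0 ba.
  by exists h; split => //; rewrite !ge_min h3 !orbT.
have [ab'|ba'] := ltP (a * V) b.
  have [h [h1 h2 h3]] := kernel_scale_far V1 a0 ab'.
  by exists h; split => //; rewrite !ge_min h3 !orbT.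
exists 0; rewrite expr0 invr1 expr1 ge_min lexx; split => //.
  by apply: le_trans ab _; rewrite ler_peMr// ?mulr_ge0 ?ltW//; lra.
by apply: le_trans ba' _; rewrite ler_peMr// ?mulr_ge0 ?ltW//; lra.
Qed.

(** The kernel is 1 for [p] within a factor [V] of [y] and about [2^-h] at a further factor [2^h].
    Up to that distance the sum of [ln p / p] is of order [1 + ln V + h], and [L <= ln p] converts
    it into a sum of [1 / p]. Uniformity in [y] is essential, since [y] will be a ratio of arbitrary
    divisors. *)
Lemma sum_primes_kernel : exists2 C : R, 0 < C & forall (X : nat) (Q : pred nat) (L V y : R),
  0 < L -> 1 <= V -> 0 < y -> (forall p, prime p -> Q p -> L <= ln p%:R) ->
  \sum_(0 <= p < X | prime p && Q p) p%:R^-1 *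
     Num.min 1 (Num.min (V * y / p%:R) (V * p%:R / y)) <= C * (1 + ln V) / L.
Proof.
exists 56 => // X Q L V y L0 V1 y0 HL.
have V0 : 0 < V by lra.
have lV : 0 <= ln V by apply: ln_ge0.
pose w (p : nat) : R := Num.min 1 (Num.min (V * y / p%:R) (V * p%:R / y)).
pose I h p := (y / (V * 2 ^+ h.+1) <= (p%:R : R) <= y * V * 2 ^+ h.+1).
have p2 h : 0 < 2 ^+ h :> R by rewrite exprn_gt0.
have /choice[hh hP] : forall p : nat, exists h : nat, (0 < p)%N -> I h p /\ w p <= 2 ^- h.
  move=> p; have [->|p0] := posnP p; first by exists 0.
  have p0' : 0 < p%:R :> R by rewrite ltr0n.
  have [h [h1 h2 h3]] := kernel_scale V1 p0' y0; exists h => _; split => //.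
  by apply/andP; split => //; rewrite ler_pdivrMr ?mulr_gt0// mulrA.
pose H := (\max_(p < X) hh p).+1.
have g0 h p : 0 <= 2 ^- h * (if I h p then ln p%:R / p%:R else 0) :> R.
  apply: mulr_ge0; first by rewrite invr_ge0 ltW.
  by case: ifP => // _; rewrite divr_ge0 ?prime_lnr_ge0.
have step p : (p < X)%N -> prime p && Q p ->
    p%:R^-1 * w p <= L^-1 * \sum_(0 <= h < H) 2 ^- h * (if I h p then ln p%:R / p%:R else 0).
  move=> pX /andP[pp Qp]; have [Ip wp] := hP p (prime_gt0 pp).
  have p0 : 0 < p%:R :> R by rewrite ltr0n prime_gt0.
  have hH : (hh p < H)%N by rewrite ltnS; apply: (@leq_bigmax _ (fun i : 'I_X => hh i) (Ordinal pX)).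
  rewrite (bigD1_seq (hh p)) ?iota_uniq ?mem_index_iota//= Ip.
  apply: (@le_trans _ _ (L^-1 * (2 ^- hh p * (ln p%:R / p%:R)))); last first.
    by apply: ler_wpM2l; [rewrite invr_ge0 ltW|rewrite lerDl sumr_ge0].
  rewrite mulrC mulrCA; apply: ler_pM => //.
  - by rewrite !le_min ler01 !divr_ge0 ?mulr_ge0 ?ltW.
  - rewrite mulrA -[leLHS]mul1r; apply: ler_wpM2r; first by rewrite invr_ge0 ltW.
    by rewrite ler_pdivlMl// mulr1 HL.
apply: (@le_trans _ _ (\sum_(0 <= p < X | prime p && Q p) (L^-1 * \sum_(0 <= h < H) 2 ^- h * (if I h p then ln p%:R / p%:R else 0)))).
  rewrite big_nat_cond [leRHS]big_nat_cond ler_sum// => p /andP[/andP[_ pX] c].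
  exact: step.
rewrite -mulr_sumr mulrC; apply: ler_wpM2r; first by rewrite invr_ge0 ltW.
apply: (@le_trans _ _ (\sum_(0 <= p < X | prime p) \sum_(0 <= h < H) 2 ^- h * (if I h p then ln p%:R / p%:R else 0))).
  rewrite big_mkcondr ler_sum// => p _; case: ifP => // _; exact: sumr_ge0.
rewrite exchange_big/=.
apply: (@le_trans _ _ (\sum_(0 <= h < H) (2 ^- h * (h%:R + 1)) * (2 * ln V + 14))); last first.
  by rewrite -mulr_suml; have := exp2_half_sum H; move: (\sum_(_ <= _ < _) _) => S; nra.
apply: ler_sum => h _.
rewrite -mulr_sumr -mulrA; apply: ler_wpM2l; first by rewrite invr_ge0 ltW.
rewrite -big_mkcondr /=.
have V2 : 0 < V * 2 ^+ h.+1 by rewrite mulr_gt0.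
have V21 : 1 <= V * 2 ^+ h.+1 by rewrite mulr_ege1// exprn_ege1// ler1n.
apply: le_trans (sum_primes_range _ _ _) _.
- by rewrite divr_gt0.
- by rewrite ler_pdivrMr// -!mulrA; apply: ler_peMr; [exact: ltW|rewrite mulrA mulr_ege1].
have -> : y * V * 2 ^+ h.+1 / (y / (V * 2 ^+ h.+1)) = (V * 2 ^+ h.+1) ^+ 2.
  by field; rewrite expf_neq0 ?gt_eqF.
have -> : ln ((V * 2 ^+ h.+1) ^+ 2) = 2 * (ln V + (h%:R + 1) * ln 2).
  by rewrite lnXn// lnM ?posrE// lnXn// mulr2n -[ln 2 *+ _]mulr_natl -natr1; ring.
have := @ln2_lt1 R; have := @ln2_gt R.
have : 0 <= h%:R :> R by [].
move: (ln 2) (ln V) lV (h%:R : R) => l v v0 k k0 l1 l2.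
have : k * l <= k * 1 by rewrite ler_wpM2l// ltW.
have : 0 <= k * v by rewrite mulr_ge0.
lra.
Qed.

End Mertens.

(** * Blocks of primes *)

Section GreedyBlocks.
Context {R : realType}.

(* State of the greedy filling of blocks: index of the current block, its
   reciprocal sum, and the prime that opened it. *)
Record gstate := GState { gidx : nat; gsum : R; gfst : nat }.

Fixpoint greedy (n : nat) : gstate :=
  if n is m.+1 then
    let st := greedy m in
    if prime n then
      if gsum st + n%:R^-1 <= ln 2 then GState (gidx st) (gsum st + n%:R^-1) (gfst st)
      else GState (gidx st).+1 n%:R^-1 n
    else st
  else GState 0 0 1.

Definition blk n := gidx (greedy n).

Lemma invr_prime_le p : prime p -> p%:R^-1 <= 1/2 :> R.
Proof.
move=> pp; have p0 : 0 < p%:R :> R by rewrite ltr0n prime_gt0.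
have p2 : 2 <= p%:R :> R by rewrite ler_nat prime_gt1.
rewrite -[p%:R^-1]div1r ler_pdivrMr//; lra.
Qed.

Lemma greedyS n : greedy n.+1 =
   if prime n.+1 then
      if gsum (greedy n) + n.+1%:R^-1 <= ln 2
      then GState (gidx (greedy n)) (gsum (greedy n) + n.+1%:R^-1) (gfst (greedy n))
      else GState (gidx (greedy n)).+1 n.+1%:R^-1 n.+1
    else greedy n.
Proof. by []. Qed.

Lemma blk_mono : {homo blk : m n / (m <= n)%N}.
Proof.
apply: homo_leq => [n|y x z|n]; [exact: leqnn|exact: leq_trans|].
by rewrite /blk greedyS; case: ifP => // _; case: ifP.
Qed.

Lemma gsum_bounds n : 0 <= gsum (greedy n) <= ln 2.
Proof.
elim: n => [|n /andP[h1 h2]]; first by rewrite /= lexx; have := @ln2_gt R; lra.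
rewrite greedyS; case: ifP => pn; last by rewrite h1.
have i0 : 0 <= n.+1%:R^-1 :> R by [].
case: ifP => /= h; first by rewrite addr_ge0.
by have := invr_prime_le pn; have := @ln2_gt R; move: i0; move: (n.+1%:R^-1) => u; lra.
Qed.

(** Each prime of the current block adds at most [1 / gfst], so a reciprocal sum [s] forces
    [n + 1 >= (1 + s) gfst]. A block closes only when [s > ln 2 - 1/3 > 1/6]; hence the opening
    primes grow at least like [(7/6)^i]. *)
Lemma gfst_bounds n (g := greedy n) :
  [/\ (0 < gfst g)%N, (gfst g <= n.+1)%N, (7 / 6) ^+ gidx g <= (gfst g)%:R :> R,
      (0 < n)%N -> (gfst g <= n)%N &
      gsum g * (gfst g)%:R <= n.+1%:R - (gfst g)%:R].
Proof.
rewrite /g {g}; elim: n => [|n [h1 h2 h3 h3' h4]].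
  by split=> //=; rewrite mul0r subrr.
have hn : (0 < n)%N || (n == 0)%N by case: (n).
rewrite greedyS; case: ifP => pn; last first.
  by split => //; [exact: leqW|apply: le_trans h4 _; rewrite lerD2r ler_nat].
have n0 : 0 < n.+1%:R :> R by rewrite ltr0n.
have f0 : 0 < (gfst (greedy n))%:R :> R by rewrite ltr0n.
case: ifP => /= h; split => //.
- exact: leqW.
- rewrite mulrDl -[n.+2%:R]natr1.
  rewrite addrAC lerD//.
  by rewrite ler_pdivrMl// mulr1 ler_nat.
- have n3 : 3 <= n.+1%:R :> R.
    rewrite ler_nat; case: n pn h {n0 f0 hn h4 h3' h3 h2 h1} => [|[|n]]//= _.
    by rewrite add0r; have := @ln2_gt R; rewrite -div1r; lra.
  have : 1 / 6 < gsum (greedy n).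
    have : n.+1%:R^-1 <= 1 / 3 :> R by clear h3; rewrite -[leLHS]div1r ler_pdivrMr//; lra.
    clear h3; by have := @ln2_gt R; move/negbT: h; rewrite -ltNge; move: (n.+1%:R^-1) => u; lra.
  move=> gs; rewrite exprS; apply: le_trans (ler_wpM2l _ h3) _; first by clear h3; lra.
  by clear h3; nra.
- by clear h3; rewrite mulVf ?gt_eqF// -[n.+2%:R]natr1; lra.
Qed.

Lemma blk_prime_ge p : prime p -> (7 / 6) ^+ blk p <= p%:R :> R.
Proof.
move=> pp; have [_ _ h1 h2 _] := gfst_bounds p.
by apply: le_trans h1 _; rewrite ler_nat h2// prime_gt0.
Qed.

Definition blksum n i : R := \sum_(0 <= p < n.+1 | prime p && (blk p == i)) p%:R^-1.

Lemma blksumS n i : blksum n.+1 i = blksum n i +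
  (if prime n.+1 && (blk n.+1 == i) then n.+1%:R^-1 else 0).
Proof. by rewrite /blksum big_mkcond big_nat_recr//= -big_mkcond. Qed.

Lemma blksum_gt n i : (blk n < i)%N -> blksum n i = 0.
Proof.
move=> h; rewrite /blksum big_nat_cond big1// => p /andP[/andP[_ pn] /andP[_ /eqP e]].
by have := blk_mono (pn : (p <= n)%N); rewrite e => /(leq_trans h); rewrite ltnn.
Qed.

Lemma blksum_cur n : blksum n (blk n) = gsum (greedy n).
Proof.
elim: n => [|n IH]; first by rewrite /blksum big_mkcond big_nat1.
rewrite blksumS eqxx andbT {1}/blk greedyS.
case: ifP => pn /=; last by rewrite addr0 -IH.
case: ifP => h /=; first by rewrite -IH.
by rewrite blksum_gt ?add0r// /blk.
Qed.

Lemma blksum_le n i : blksum n i <= ln 2.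
Proof.
elim: n => [|n IH].
  by rewrite /blksum big_mkcond big_nat1//=; have := @ln2_gt R; lra.
have /andP[_ h] := gsum_bounds n.+1; rewrite -blksum_cur in h.
rewrite blksumS; case: ifP => [/andP[pn /eqP e]|_]; last by rewrite addr0.
by move: h pn; rewrite blksumS e eqxx andbT => + pn; rewrite pn.
Qed.

(** A block closes because the next prime no longer fits, and that prime is at least
    [(7/6)^(i+1)]. *)
Lemma blksum_ge n i : (i < blk n)%N -> ln 2 - (6 / 7) ^+ i.+1 <= blksum n i.
Proof.
elim: n => // n IH.
have [/IH h _|ni ni1] := ltnP i (blk n).
  by apply: le_trans h _; rewrite blksumS lerDl; case: ifP.
have : blk n.+1 = (blk n).+1 /\ ln 2 < gsum (greedy n) + n.+1%:R^-1 /\ prime n.+1.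
  move: ni1 ni; rewrite /blk greedyS; case: ifP => [pn|_]; last by move=> h1 /(leq_trans h1); rewrite ltnn.
  case: ifP => /= [_ h1 /(leq_trans h1)|h]; first by rewrite ltnn.
  by move/negbT: h; rewrite -ltNge.
move=> [e1 [h pn]]; have -> : i = blk n by apply/eqP; rewrite eqn_leq ni andbT -ltnS -e1.
rewrite blksumS e1 (gtn_eqF (ltnSn _)) andbF addr0 blksum_cur.
have := blk_prime_ge pn; rewrite e1 => h2.
have n0 : 0 < n.+1%:R :> R by rewrite ltr0n.
have : n.+1%:R^-1 <= (6 / 7) ^+ (blk n).+1 :> R.
  rewrite -[6 / 7]invrK exprVn lef_pV2 ?posrE// ?exprn_gt0 ?invr_gt0//.
  by apply: le_trans h2; rewrite le_eqVlt; apply/orP; left; apply/eqP; congr (_ ^+ _); field.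
by rewrite lerBlDr => h3; apply: le_trans (ltW h) _; rewrite lerD2l.
Qed.

(** The deficits of all closed blocks add up to at most the sum of [(6/7)^i] over [i >= 1], which is
    6. *)
Lemma primeH_blk n : (blk n)%:R * ln 2 - 6 <= (primeH n : R) <= (blk n).+1%:R * ln 2.
Proof.
have eS m : m.+1%:R * ln 2 = m%:R * ln 2 + ln 2 :> R by rewrite -natr1 mulrDl mul1r.
suff : (blk n)%:R * ln 2 + gsum (greedy n) - 6 * (1 - (6 / 7) ^+ blk n) <= (primeH n : R)
       <= (blk n)%:R * ln 2 + gsum (greedy n).
  have /andP[g0 g1] := gsum_bounds n.
  have : 0 <= (6 / 7) ^+ blk n :> R by rewrite exprn_ge0.
  rewrite eS; move: ((6 / 7 : R) ^+ blk n) => t t0 /andP[h1 h2].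
  move: g0 g1 h1 h2; move: (gsum _) (ln 2) ((blk n)%:R * _) (primeH n) => a b c d *.
  by apply/andP; split; lra.
elim: n => [|n /andP[h1 h2]].
  by rewrite /primeH big_mkcond big_nat1 /blk /= mul0r expr0; apply/andP; split; lra.
have /andP[g0 g1] := gsum_bounds n.
rewrite primeH_recr /blk greedyS -/(blk n); case: ifP => pn; last by rewrite addr0 h1.
case: ifP => /= h.
  move: h1 h2; move: ((blk n)%:R * ln 2) (gsum _) (n.+1%:R^-1) (6 * _) (primeH n) => a g u c H h1 h2.
  clear -h1 h2; by apply/andP; split; lra.
rewrite -/(blk n).
have : n.+1%:R^-1 <= (6 / 7) ^+ (blk n).+1 :> R.
  have n0 : 0 < n.+1%:R :> R by rewrite ltr0n.
  rewrite -[6 / 7]invrK exprVn lef_pV2 ?posrE// ?exprn_gt0 ?invr_gt0//.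
  have := blk_prime_ge pn; rewrite {1}/blk greedyS pn h /= => h3.
  by apply: le_trans h3; rewrite le_eqVlt; apply/orP; left; apply/eqP; congr (_ ^+ _); field.
move/negbT: h; rewrite -ltNge exprS eS.
move: ((6 / 7 : R) ^+ blk n) (n.+1%:R^-1) h1 h2 g0 g1 => t u.
move: (gsum _) (ln 2) ((blk n)%:R * _) (primeH n) => a b c d *; clear pn.
by apply/andP; split; lra.
Qed.

Lemma ln_blk : exists c : R * R, [/\ 0 < c.1, 0 < c.2 &
  forall n, (1 < n)%N -> c.1 * 2 ^+ blk n <= ln n%:R <= c.2 * 2 ^+ blk n].
Proof.
have [C C0 HC] := @mertens2 R.
exists (expR (- 6 - C), expR (C + ln 2)); rewrite /= !expR_gt0; split => // n n1.
have := HC n n1; rewrite ler_norml => /andP[h1 h2].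
have /andP[h3 h4] := primeH_blk n.
have l0 : 0 < ln n%:R :> R by rewrite ln_gt0// ltr1n.
have -> : 2 ^+ blk n = expR ((blk n)%:R * ln 2) :> R by rewrite expRM_natl lnK ?posrE.
rewrite -!expRD -[ln n%:R]lnK ?posrE// !ler_expR.
move: h4; rewrite -natr1 mulrDl mul1r => h4.
by apply/andP; split; lra.
Qed.

Lemma blk_unbounded i : exists n, (i <= blk n)%N.
Proof.
have [[c1 c2] [/= c10 c20 H]] := ln_blk.
pose x : R := expR (c2 * 2 ^+ i).
exists (Num.truncn x).+2.
have /andP[_ h1] : (Num.truncn x)%:R <= x < (Num.truncn x).+1%:R.
  by apply: truncn_itv; rewrite ltW// expR_gt0.
have /andP[_ h] := H (Num.truncn x).+2 isT.
have h2 : c2 * 2 ^+ i < ln (Num.truncn x).+2%:R.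
  rewrite -ltr_expR lnK ?posrE ?ltr0n//; apply: lt_trans h1 _.
  by rewrite ltr_nat.
have := lt_le_trans h2 h; rewrite ltr_pM2l// -!natrX ltr_nat ltn_exp2l//.
exact: ltnW.
Qed.

End GreedyBlocks.

(** * First passage weights *)

Section FirstPassage.
Context {R : realType}.

(* Sum of [prod 1 / n_i!] over the sequences [n_1, ..., n_n] for which the walk
   with steps [n_i - 1] first reaches [- r] at time [n]. *)
Fixpoint fpw (n r : nat) : R :=
  if n is m.+1 then
    if r is s.+1 then \sum_(0 <= k < n) (k`!%:R)^-1 * fpw m (s + k) else 0
  else (r == 0)%:R.

Lemma fpwS n r : fpw n.+1 r.+1 = \sum_(0 <= k < n.+1) (k`!%:R)^-1 * fpw n (r + k).
Proof. by []. Qed.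

Lemma fpw_ge0 n r : 0 <= fpw n r.
Proof.
elim: n r => [|n IH] [|r] //=.
by rewrite sumr_ge0// => k _; rewrite mulr_ge0// invr_ge0.
Qed.

Lemma fpw_gt n r : (n < r)%N -> fpw n r = 0.
Proof.
elim: n r => [|n IH] [|r] //; rewrite ltnS => nr.
by rewrite fpwS big1// => k _; rewrite IH ?mulr0// (leq_trans nr)// leq_addr.
Qed.

Lemma fpw11 : fpw 1 1 = 1.
Proof. by rewrite fpwS big_nat1 /= fact0 invr1 mul1r. Qed.

Lemma fpw22 : fpw 2 2 = 1.
Proof.
rewrite fpwS big_nat_recr// big_nat1 fpw11.
rewrite [fpw 1 (1 + 1)]fpw_gt// mulr0; apply: (etrans (addr0 _)).
by rewrite invr1 mul1r.
Qed.

(** The inductive step of the hitting time formula: the binomial theorem, and for the part weighted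
    by [k] the same theorem one degree lower. *)
Lemma sum_bin_weighted n m (r : R) :
  (0 < m)%N -> \sum_(0 <= k < m.+1) (r + k%:R) * (n%:R ^+ (m - k) *+ 'C(m, k)) =
  r * n.+1%:R ^+ m + m%:R * n.+1%:R ^+ m.-1.
Proof.
move=> m0.
have e k : (n.+1%:R : R) ^+ k = \sum_(0 <= i < k.+1) n%:R ^+ (k - i) *+ 'C(k, i).
  rewrite -natr1 exprDn big_mkord; apply: eq_bigr => i _.
  by rewrite expr1n mulr1.
under eq_bigr do rewrite mulrDl.
rewrite big_split /= -mulr_sumr -e; congr (_ + _).
rewrite big_nat_recl// mul0r add0r -{1 3 4}(prednK m0) [in RHS]e mulr_sumr.
rewrite prednK//; rewrite big_nat [RHS]big_nat; apply: eq_bigr => k /andP[_ km].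
rewrite -[n%:R ^+ _ *+ 'C(m, _)]mulr_natr -[n%:R ^+ _ *+ 'C(_, _)]mulr_natr.
have -> : (m - k.+1 = m.-1 - k)%N by move: km m0; clear; lia.
rewrite mulrCA [RHS]mulrCA; congr (_ * _).
by rewrite -!natrM (mul_bin_diag m).
Qed.

(* Otter-Dwass (hitting time) formula. *)
Lemma fpw_closed n r : (0 < n)%N -> (r <= n)%N ->
  fpw n r = r%:R / n%:R * (n%:R ^+ (n - r) / (n - r)`!%:R).
Proof.
elim: n r => // n IH [|r] _; first by rewrite /= !mul0r.
rewrite ltnS => rn; rewrite subSS.
have n1 : n.+1%:R != 0 :> R by rewrite pnatr_eq0.
have [n0|n0] := posnP n.
  move: rn; rewrite n0 leqn0 => /eqP->; rewrite fpw11 subnn expr0 fact0.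
  by rewrite !divr1 mul1r.
have nn0 : n%:R != 0 :> R by rewrite pnatr_eq0 -lt0n.
set m := (n - r)%N; have mE : (r + m = n)%N by rewrite subnKC.
have fm : m`!%:R != 0 :> R by rewrite pnatr_eq0 -lt0n fact_gt0.
rewrite fpwS (@big_cat_nat _ _ _ m.+1)//=; last by rewrite ltnS leq_subr.
rewrite [X in _ + X]big_nat [X in _ + X]big1 ?addr0; last first.
  by move=> k /andP[mk _]; rewrite fpw_gt ?mulr0// -[in ltnLHS]mE ltn_add2l.
transitivity ((n%:R * m`!%:R)^-1 * \sum_(0 <= k < m.+1) (r%:R + k%:R) * (n%:R ^+ (m - k) *+ 'C(m, k)) : R).
  rewrite mulr_sumr big_nat [RHS]big_nat; apply: eq_bigr => k /andP[_ km].
  rewrite IH//; last by rewrite -[leqRHS]mE leq_add2l -ltnS.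
  have -> : (n - (r + k) = m - k)%N by rewrite subnDA.
  rewrite -natrD -mulr_natr.
  have /(congr1 (fun z => z%:R : R)) := @bin_fact m k km; rewrite !natrM => <-.
  have [h1 h2] : k`!%:R != 0 :> R /\ (m - k)`!%:R != 0 :> R.
    by rewrite !pnatr_eq0 -!lt0n !fact_gt0.
  have h3 : 'C(m, k)%:R != 0 :> R by rewrite pnatr_eq0 -lt0n bin_gt0 -ltnS.
  by field; rewrite nn0 h1 h2 h3.
have [m0|m0] := posnP m.
  rewrite m0 big_nat1 addr0 subnn expr0 bin0 mulr1n.
  have -> : r = n by rewrite -[RHS]mE m0 addn0.
  by rewrite !mulr1 mulVf// expr0 divr1 mulr1 divff.
rewrite sum_bin_weighted//.
have rE : r%:R = n%:R - m%:R :> R by rewrite -mE natrD addrK.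
have -> : n.+1%:R ^+ m = n.+1%:R * n.+1%:R ^+ m.-1 :> R by rewrite -exprS prednK.
have -> : r.+1%:R = n%:R - m%:R + 1 :> R by rewrite -natr1 rE.
move: (n.+1%:R ^+ m.-1 : R) => e; rewrite rE; move: n1; rewrite -natr1 => n1.
by field; rewrite nn0 fm n1.
Qed.

Lemma ffact_le_expn n m : (n ^_ m <= n ^ m)%N.
Proof.
elim: m n => [|m IH] [|n]; rewrite ?ffactn0 ?ffact0n// ffactSS expnS leq_mul2l/=.
apply: leq_trans (IH n) _; case: m {IH} => // m; by rewrite leq_exp2r.
Qed.

(** The decay [(a + 1)^(-3/2)] of critical first passage probabilities. *)
Definition dec (a : nat) : R := (a.+1%:R * Num.sqrt a.+1%:R)^-1.

Lemma dec_gt0 a : 0 < dec a.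
Proof. by rewrite invr_gt0 mulr_gt0 ?sqrtr_gt0. Qed.

Lemma expn_fact_le n : (0 < n)%N -> n%:R ^+ n / n`!%:R <= expR 1 ^+ n / Num.sqrt n%:R :> R.
Proof.
move=> n0; have m0 : 0 < n%:R :> R by rewrite ltr0n.
have s0 : 0 < Num.sqrt n%:R :> R by rewrite sqrtr_gt0.
have e0 : 0 < expR 1 ^+ n :> R by rewrite exprn_gt0// expR_gt0.
have f0 : 0 < n`!%:R :> R by rewrite ltr0n fact_gt0.
have /andP[h _] := @stir_bounds R n n0.
rewrite ler_pdivrMr// mulrAC ler_pdivlMr// (expR_stirling n0).
have h1 : 1 <= expR (stir n) :> R by rewrite -[leLHS]expR0 ler_expR; lra.
rewrite mulrCA divff ?gt_eqF// mulr1 mulrC -[leLHS]mul1r.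
by apply: ler_wpM2r => //; rewrite mulr_ge0 ?exprn_ge0// ltW.
Qed.

(** In the closed form, [n! / (n - r)! <= n^r] replaces the last factor by [n^n / n!], which
    Stirling's formula bounds. *)
Lemma fpw_le n r : (0 < n)%N -> fpw n r <= r%:R / n%:R * (expR 1 ^+ n / Num.sqrt n%:R).
Proof.
move=> n0; have m0 : 0 < n%:R :> R by rewrite ltr0n.
have [rn|nr] := leqP r n; last first.
  by rewrite fpw_gt//; apply: mulr_ge0; rewrite ?divr_ge0// ?exprn_ge0 ?expR_ge0// sqrtr_ge0.
rewrite fpw_closed//; apply: ler_wpM2l; first by rewrite divr_ge0.
apply: le_trans (expn_fact_le n0).
rewrite ler_pdivrMr ?ltr0n ?fact_gt0// mulrAC ler_pdivlMr ?ltr0n ?fact_gt0//.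
rewrite -!natrX -!natrM ler_nat -(ffact_fact rn) mulnA leq_mul2r; apply/orP; right.
rewrite -[in leqRHS](subnK rn) expnD (subnK rn) leq_mul2l; apply/orP; right.
exact: ffact_le_expn.
Qed.

Lemma fpw_le_dec a b r : (0 < r)%N -> fpw (a + b) r <= 4 * r%:R * expR 1 ^+ (a + b) * dec a.
Proof.
move=> r0; have e0 k : 0 < expR 1 ^+ k :> R by rewrite exprn_gt0// expR_gt0.
have [ab0|ab0] := posnP (a + b).
  have d0 := ltW (dec_gt0 a); rewrite ab0 expr0 mulr1; case: r r0 => // r _.
  by rewrite /= mulr_ge0// mulr_ge0.
apply: le_trans (fpw_le _ ab0) _.
set n := (a + b)%N in ab0 *; have m0 : 0 < n%:R :> R by rewrite ltr0n.
have s0 : 0 < Num.sqrt n%:R :> R by rewrite sqrtr_gt0.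
suff : (n%:R * Num.sqrt n%:R)^-1 <= 4 * dec a.
  move=> h; rewrite -mulrA mulrCA [leRHS](_ : _ = r%:R * (expR 1 ^+ n * (4 * dec a))); last by ring.
  rewrite -[leLHS]mulrCA ler_wpM2l// [leLHS]mulrCA ler_wpM2l ?(ltW (e0 _))//.
  by rewrite -invfM.
rewrite /dec -[4]invrK -invfM lef_pV2 ?posrE ?mulr_gt0 ?invr_gt0 ?sqrtr_gt0//.
have an : a.+1%:R <= 2 * n%:R :> R by rewrite -natrM ler_nat; move: ab0; rewrite /n; clear; lia.
have sn : Num.sqrt a.+1%:R <= 2 * Num.sqrt n%:R :> R.
  rewrite -[2]ger0_norm// -sqrtr_sqr -sqrtrM ?exprn_ge0// ler_wsqrtr// expr2.
  by move: (a.+1%:R : R) (n%:R : R) an m0 => u v; lra.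
rewrite mulrC ler_pdivrMr//; have := @sqrtr_ge0 R a.+1%:R.
have : 0 < a.+1%:R :> R by [].
move=> h1 h2; apply: (@le_trans _ _ ((2 * n%:R) * (2 * Num.sqrt n%:R))).
  by apply: ler_pM => //; exact: ltW.
by rewrite mulrACA mulrC -natrM.
Qed.

Lemma fpw1_ge n : (0 < n)%N ->
  expR 1 ^+ n / expR 1 / (n%:R * Num.sqrt n%:R) <= fpw n 1.
Proof.
move=> n0; have m0 : 0 < n%:R :> R by rewrite ltr0n.
have s0 : 0 < Num.sqrt n%:R :> R by rewrite sqrtr_gt0.
have e0 : 0 < expR 1 ^+ n :> R by rewrite exprn_gt0// expR_gt0.
have f0 : 0 < n`!%:R :> R by rewrite ltr0n fact_gt0.
have e1 := @expR_gt0 R 1.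
rewrite fpw_closed//.
have -> : 1 / n%:R * (n%:R ^+ (n - 1) / (n - 1)`!%:R) = n%:R ^+ n / n`!%:R / n%:R :> R.
  case: n n0 m0 {s0 e0 f0} => // n _ n1; rewrite subSS subn0 factS natrM exprS.
  have fn : n`!%:R != 0 :> R by rewrite pnatr_eq0 -lt0n fact_gt0.
  have a0 : n.+1%:R != 0 :> R by rewrite gt_eqF.
  by move: (n.+1%:R : R) a0 => a a0; field; rewrite fn a0.
rewrite [leLHS](_ : _ = expR 1 ^+ n / Num.sqrt n%:R / expR 1 / n%:R); last first.
  by field; rewrite !gt_eqF.
rewrite ler_pM2r ?invr_gt0//.
rewrite (expR_stirling n0).
have /andP[_ h] := @stir_bounds R n n0.
have st : 0 < expR (stir n) :> R by rewrite expR_gt0.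
have -> : n%:R ^+ n / (expR (stir n) * (n%:R ^+ n * Num.sqrt n%:R) / expR 1 ^+ n)
  = expR 1 ^+ n / Num.sqrt n%:R / expR (stir n) :> R.
  by field; rewrite !gt_eqF//= exprn_gt0.
by rewrite ler_pM2l ?divr_gt0// lef_pV2 ?posrE// ler_expR.
Qed.

Lemma fpw2_le n : (0 < n)%N -> fpw n 2 <= 2 * fpw n 1.
Proof.
case: n => [|[|n]]// _; first by rewrite fpw_gt// mulr_ge0// fpw_ge0.
rewrite !fpw_closed// !subSS !subn0 -!mulrA; apply: ler_wpM2l => //.
rewrite mul1r; apply: ler_wpM2l => //.
rewrite exprS factS natrM invfM mulrACA ler_peMl//.
by rewrite ler_pdivlMr// mul1r ler_nat.
Qed.

(** At the single time [n = 2 r] the normalised passage weight is about [(2 / e)^r / r]. Since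
    [2 / e > ln 2], this one term already beats [(ln 2)^r] by an exponential factor. *)
Lemma fpw_double_ge r : (0 < r)%N ->
  (2 / expR 1) ^+ r / (2 * expR 1 * r%:R) <= (expR 1)^-1 ^+ (2 * r) * fpw (2 * r) r.
Proof.
move=> r0; have m0 : 0 < r%:R :> R by rewrite ltr0n.
have e1 := @expR_gt0 R 1.
have s0 : 0 < Num.sqrt r%:R :> R by rewrite sqrtr_gt0.
rewrite fpw_closed ?muln_gt0//; last by rewrite leq_pmull.
have -> : (2 * r - r = r)%N by rewrite mul2n -addnn addnK.
have f0 : r`!%:R != 0 :> R by rewrite pnatr_eq0 -lt0n fact_gt0.
have -> : r%:R / (2 * r)%:R = 2^-1 :> R by rewrite natrM invfM mulrCA divff ?gt_eqF// mulr1.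
rewrite natrM (expR_stirling r0) exprM exprVn expr2.
have st : 0 < expR (stir r) :> R by rewrite expR_gt0.
have /andP[_ h] := @stir_bounds R r r0.
set E := expR 1 in e1 *.
have -> : (E * E)^-1 ^+ r * (2^-1 * ((2 * r%:R) ^+ r / (expR (stir r) * (r%:R ^+ r * Num.sqrt r%:R) / E ^+ r)))
   = (2 / E) ^+ r / (2 * (expR (stir r) * Num.sqrt r%:R)).
  rewrite exprVn !exprMn exprVn; field.
  by rewrite !gt_eqF//= exprn_gt0.
rewrite ler_pM2l ?exprn_gt0 ?divr_gt0// lef_pV2 ?posrE ?mulr_gt0//.
rewrite -mulrA ler_pM2l//; apply: ler_pM; rewrite ?expR_ge0 ?sqrtr_ge0// ?ler_expR//.
rewrite -[leRHS]ger0_norm// -sqrtr_sqr ler_wsqrtr// expr2 ler_peMr//.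
by rewrite ler1n.
Qed.

Lemma fpw_step m h N : \sum_(0 <= n < N | (0 < h + n)%N) (n`!%:R)^-1 * fpw m (h + n) <= fpw m.+1 h.+1.
Proof.
rewrite fpwS.
rewrite (@big_nat_widen _ _ _ 0 N (N + m.+1)) ?leq_addr//.
rewrite [leRHS](@big_nat_widen _ _ _ 0 m.+1 (N + m.+1)) ?leq_addl//.
rewrite big_mkcond [leRHS]big_mkcond ler_sum// => n _ /=.
have t0 : 0 <= n`!%:R^-1 * fpw m (h + n) by rewrite mulr_ge0 ?fpw_ge0// invr_ge0.
have [nM|Mn] := ltnP n m.+1; first by case: ifP.
by rewrite fpw_gt ?mulr0 ?if_same// (leq_trans Mn)// leq_addl.
Qed.

(* Potential for walks that must stay above a barrier for [a] steps, starting
   at height [h]: the remaining [b] steps are summed with damping factor [x < 1],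
   which makes it finite while keeping it comparable to [ln 2 ^ h] at [a = 0]. *)
Definition pot (x : R) (B a h : nat) : R :=
  \sum_(0 <= b < B) (x / expR 1) ^+ b * fpw (a + b) h.+1.

Lemma pot_ge0 x B a h : 0 <= x -> 0 <= pot x B a h.
Proof.
move=> x0; rewrite sumr_ge0// => b _.
by rewrite mulr_ge0 ?fpw_ge0// exprn_ge0// divr_ge0 ?expR_ge0.
Qed.

Lemma pot_step (x : R) B a h N : 0 <= x ->
  \sum_(0 <= n < N | (0 < h + n)%N) (n`!%:R)^-1 * pot x B a (h + n).-1 <= pot x B a.+1 h.
Proof.
move=> x0; rewrite /pot.
under eq_bigr do rewrite mulr_sumr.
rewrite exchange_big /=; apply: ler_sum => b _.
apply: (@le_trans _ _ (\sum_(0 <= n < N | (0 < h + n)%N) (x / expR 1) ^+ b * ((n`!%:R)^-1 * fpw (a + b) (h + n)))).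
  by apply: ler_sum => n hn; rewrite prednK// mulrCA.
rewrite -mulr_sumr; apply: ler_wpM2l; last exact: fpw_step.
by rewrite exprn_ge0// divr_ge0 ?expR_ge0.
Qed.

Lemma sum_geo_le (x : R) B : 0 <= x -> x < 1 -> \sum_(0 <= b < B) x ^+ b <= (1 - x)^-1.
Proof.
move=> x0 x1; have x10 : 0 < 1 - x by lra.
rewrite -[leRHS]mul1r ler_pdivlMr// mulrC big_mkord -opprB mulNr -subrX1 opprB.
by rewrite lerBlDr lerDl exprn_ge0.
Qed.

Lemma pot_le (x : R) B a h : 0 <= x -> x < 1 ->
  pot x B a h <= 4 * (1 - x)^-1 * h.+1%:R * expR 1 ^+ a * dec a.
Proof.
move=> x0 x1; have e1 := @expR_gt0 R 1.
apply: (@le_trans _ _ (\sum_(0 <= b < B) x ^+ b * (4 * h.+1%:R * expR 1 ^+ a * dec a))).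
  rewrite ler_sum// => b _.
  apply: (le_trans (ler_wpM2l _ (fpw_le_dec a b (ltn0Sn h)))).
    by rewrite exprn_ge0// divr_ge0// ltW.
  rewrite expr_div_n exprD; set E := expR 1 in e1 *.
  rewrite [leLHS](_ : _ = x ^+ b * (4 * h.+1%:R * E ^+ a * dec a)) //.
  by field; rewrite expf_neq0// gt_eqF.
rewrite -mulr_suml mulrC.
rewrite [leRHS](_ : _ = 4 * h.+1%:R * expR 1 ^+ a * dec a * (1 - x)^-1); last by ring.
apply: ler_wpM2l; last exact: sum_geo_le.
by rewrite !mulr_ge0 ?exprn_ge0// ltW ?dec_gt0.
Qed.

Definition pot_const (x c : R) := [/\ 0 < x, x < 1, 0 < c &
  forall B h, (2 * h.+1 < B)%N -> c * ln 2 ^+ h <= pot x B 0 h].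

Lemma pot_base : exists xc : R * R, pot_const xc.1 xc.2.
Proof.
have e1 := @expR_gt0 R 1; have e2 := @expR1_gt2 R.
have l2 := @ln2_gt R; have l2' := @ln2_lt R.
(* [k < 1] is [ln2_lt]. With [s = sqrt k] and damping [x = sqrt s], the term [b = 2 r] of [pot] is
   at least a constant times [(ln 2)^r s^-r / r], and Bernoulli's inequality absorbs the division by
   [r]. *)
pose k : R := ln 2 * expR 1 / 2.
have k0 : 0 < k by rewrite divr_gt0// mulr_gt0//; lra.
have k1 : k < 1 by rewrite ltr_pdivrMr// mul1r -ltr_pdivlMr.
pose s := Num.sqrt k; pose x := Num.sqrt s.
have s0 : 0 < s by rewrite sqrtr_gt0.
have x0 : 0 < x by rewrite sqrtr_gt0.
have ss : s ^+ 2 = k by rewrite sqr_sqrtr// ltW.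
have xx : x ^+ 2 = s by rewrite sqr_sqrtr// ltW.
have s1 : s < 1 by move: ss; rewrite expr2; nra.
have x1 : x < 1 by move: xx; rewrite expr2; nra.
pose d := s^-1 - 1.
have d0 : 0 < d by rewrite subr_gt0 -invr1 ltf_pV2 ?posrE.
exists (x, d * ln 2 / (2 * expR 1)); split => //=.
  by rewrite divr_gt0 ?mulr_gt0//; lra.
move=> B h hB; set r := h.+1 in hB *.
have m0 : 0 < r%:R :> R by rewrite ltr0n.
have -> : d * ln 2 / (2 * expR 1) * ln 2 ^+ h = d * ln 2 ^+ r / (2 * expR 1).
  by rewrite exprS; ring.
apply: (@le_trans _ _ ((x / expR 1) ^+ (2 * r) * fpw (0 + 2 * r) r)); last first.
  rewrite /pot (bigD1_seq (2 * r)%N) ?iota_uniq ?mem_index_iota//= lerDl sumr_ge0//.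
  by move=> b _; rewrite mulr_ge0 ?fpw_ge0// exprn_ge0// divr_ge0 ?ltW.
rewrite add0n exprMn -[leRHS]mulrA.
apply: le_trans (ler_wpM2l _ (fpw_double_ge (ltn0Sn h))); last by rewrite exprn_ge0// ltW.
rewrite exprM xx -/r mulrA.
have -> : (2 / expR 1) ^+ r = ln 2 ^+ r * (s^-1 ^+ r) * (s^-1 ^+ r).
  rewrite -!exprMn -mulrA -expr2 exprVn ss /k; congr (_ ^+ _).
  by field; rewrite !gt_eqF//; lra.
have sr : s ^+ r != 0 by rewrite expf_neq0// gt_eqF.
rewrite [leRHS](_ : _ = (s^-1 ^+ r / r%:R) * (ln 2 ^+ r / (2 * expR 1))); last first.
  by rewrite exprVn; field; rewrite sr -natr1 in m0 *; rewrite natr1 !gt_eqF.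
rewrite -mulrA ler_wpM2r//.
  by rewrite divr_ge0 ?exprn_ge0 ?mulr_ge0 ?ltW//; lra.
rewrite ler_pdivlMr//.
have B1 : forall n : nat, n%:R * d + 1 <= s^-1 ^+ n.
  elim=> [|n IH]; first by rewrite mul0r add0r expr0.
  have -> : s^-1 = 1 + d by rewrite /d; ring.
  rewrite exprS -natr1; have := IH; have -> : s^-1 = 1 + d by rewrite /d; ring.
  have : 0 <= n%:R * d * d by rewrite !mulr_ge0// ltW.
  by move: (_ ^+ n) (n%:R : R) => u v; nra.
by have := B1 r; lra.
Qed.

Lemma sum_dec_le n : \sum_(0 <= j < n) dec j <= 3.
Proof.
case: n => [|n]; first by rewrite big_geq.
suff : \sum_(0 <= j < n.+1) dec j <= 3 - 2 / Num.sqrt n.+1%:R.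
  have : 0 <= 2 / Num.sqrt (n.+1%:R : R) by rewrite divr_ge0// sqrtr_ge0.
  by move: (_ / _) (\sum_(_ <= _ < _) _) => u v; lra.
elim: n => [|n IH]; first by rewrite big_nat1 /dec sqrtr1 mulr1 invr1; lra.
rewrite big_nat_recr//=.
set u := Num.sqrt (n.+1%:R : R) in IH *; set v := Num.sqrt (n.+2%:R : R).
have u0 : 0 < u by rewrite sqrtr_gt0.
have v0 : 0 < v by rewrite sqrtr_gt0.
have u2 : u * u = n.+1%:R by rewrite -expr2 sqr_sqrtr.
have v2 : v * v = n.+2%:R by rewrite -expr2 sqr_sqrtr.
have uv : u <= v by rewrite ler_wsqrtr// ler_nat.
suff : dec n.+1 <= 2 / u - 2 / v.
  by move: IH; move: (\sum_(_ <= _ < _) _) (2 / u) (2 / v) (dec _) => a b c d; lra.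
rewrite /dec -/v -v2.
have -> : 2 / u - 2 / v = 2 * (v - u) / (u * v) by field; rewrite !gt_eqF.
have -> : v - u = (v + u)^-1.
  apply: (@mulIf _ (v + u)); first by rewrite gt_eqF// addr_gt0.
  rewrite mulVf ?gt_eqF ?addr_gt0//.
  rewrite (_ : (v - u) * (v + u) = v * v - u * u); last by ring.
  by rewrite u2 v2 -[n.+2%:R]natr1; ring.
have -> : 2 / (v + u) / (u * v) = 2 / ((v + u) * (u * v)).
  by field; rewrite !gt_eqF//= addr_gt0.
rewrite ler_pdivlMr ?mulr_gt0 ?addr_gt0// mulrC ler_pdivrMr ?mulr_gt0//.
have h1 : u * v <= v * v by rewrite ler_pM2r.
have h2 : v + u <= 2 * v by lra.
have : (v + u) * (u * v) <= (2 * v) * (v * v).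
  by apply: ler_pM => //; rewrite ?mulr_ge0 ?addr_ge0 ?ltW.
by move=> h; apply: le_trans h _; rewrite le_eqVlt; apply/orP; left; apply/eqP; ring.
Qed.

Lemma dec_half a b : (b <= 2 * a.+1)%N -> dec a <= 8 * dec b.
Proof.
move=> ba; rewrite /dec -[8]invrK -invfM lef_pV2 ?posrE ?mulr_gt0 ?invr_gt0 ?sqrtr_gt0//.
rewrite mulrC ler_pdivrMr//.
have h1 : b.+1%:R <= 3 * a.+1%:R :> R by rewrite -natrM ler_nat; move: ba; clear; lia.
have h2 : Num.sqrt b.+1%:R <= 2 * Num.sqrt a.+1%:R :> R.
  rewrite -[2]ger0_norm// -sqrtr_sqr -sqrtrM ?exprn_ge0// ler_wsqrtr// expr2.
  by move: (a.+1%:R : R) (b.+1%:R : R) h1 (ler0n R b.+1) => u v; lra.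
apply: (@le_trans _ _ ((3 * a.+1%:R) * (2 * Num.sqrt a.+1%:R))).
  by apply: ler_pM => //; rewrite sqrtr_ge0.
rewrite mulrACA mulrC ler_wpM2l ?mulr_ge0 ?sqrtr_ge0//.
by rewrite -natrM ler_nat.
Qed.

Lemma sum_dec_conv J : \sum_(0 <= j < J.+1) dec j * dec (J - j) <= 48 * dec J.
Proof.
have d0 a : 0 <= dec a by exact/ltW/dec_gt0.
apply: (@le_trans _ _ (\sum_(0 <= j < J.+1) (8 * dec J * dec j + 8 * dec J * dec (J - j)))).
  rewrite big_nat [leRHS]big_nat ler_sum// => j /andP[_]; rewrite ltnS => jJ.
  have [h|h] := leqP J (2 * j).
    have h1 : dec j <= 8 * dec J by apply: dec_half; rewrite mulnS (leq_trans h)// leqW// leqW.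
    apply: (@le_trans _ _ (8 * dec J * dec (J - j))); first by rewrite ler_wpM2r.
    by rewrite lerDr !mulr_ge0.
  have h1 : dec (J - j) <= 8 * dec J by apply: dec_half; move: h jJ; clear; lia.
  apply: (@le_trans _ _ (8 * dec J * dec j)); first by rewrite mulrC ler_wpM2r.
  by rewrite lerDl !mulr_ge0.
rewrite big_split /= -!mulr_sumr.
have e : \sum_(0 <= j < J.+1) dec (J - j) = \sum_(0 <= j < J.+1) dec j.
  rewrite [LHS]big_nat_rev /= add0n big_nat [RHS]big_nat; apply: eq_bigr => j /andP[_ jJ].
  by congr dec; move: jJ; clear; lia.
have := sum_dec_le J.+1; rewrite e; move: (\sum_(_ <= _ < _) _) (dec J) (d0 J) => u v; nra.
Qed.

End FirstPassage.

Arguments fpw : simpl never.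

(** * Weighted sums over finite sets *)

Section SubsetSums.
(* [all_classical] shadows several lemmas on finite sets. *)
Import mathcomp.boot.fintype mathcomp.boot.finset.
Context {R : realType} {T : finType}.
Implicit Types (A B U V : {set T}) (x : T -> R).

Definition wt x U : R := \prod_(t in U) x t.

Lemma wt_ge0 x U : (forall t, 0 <= x t) -> 0 <= wt x U.
Proof. by move=> x0; rewrite /wt prodr_ge0. Qed.

Lemma wt0 x : wt x set0 = 1.
Proof. by rewrite /wt big_set0. Qed.

Lemma wtU x U V : [disjoint U & V] -> wt x (U :|: V) = wt x U * wt x V.
Proof. by move=> dUV; rewrite /wt -bigU//; apply: eq_bigl => t; rewrite !inE. Qed.

Lemma wtU1 x r U : r \notin U -> wt x (r |: U) = x r * wt x U.
Proof. by move=> rU; rewrite /wt big_setU1. Qed.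

(* Mecke formula: summing over an element of a weighted random set amounts to
   inserting an independent new element. *)
Lemma mecke x B (F : T -> {set T} -> R) :
  \sum_(U : {set T} | U \subset B) wt x U * (\sum_(r in U) F r (U :\ r)) =
  \sum_(r in B) x r * (\sum_(U : {set T} | U \subset B :\ r) wt x U * F r U).
Proof.
under eq_bigr do rewrite mulr_sumr.
rewrite (exchange_big_dep (mem B))/=; last first.
  by move=> U r UB rU; apply: (subsetP UB).
apply: eq_bigr => r rB; rewrite mulr_sumr.
rewrite (reindex_onto (fun U => r |: U) (fun U => U :\ r)); last first.
  by move=> U /andP[_ rU]; rewrite setD1K.
apply: eq_big => [U|U].
  rewrite setU11 andbT subUset sub1set rB /=.
  apply/andP/idP => [[UB /eqP e]|UB].
    by rewrite -e setSD// subUset sub1set rB.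
  split; first by apply: subset_trans UB _; exact: subD1set.
  rewrite setU1K//; apply/negP => rU; have := subsetP UB _ rU.
  by rewrite !inE eqxx.
move=> /andP[/andP[_ _] /eqP e].
have rU : r \notin U by rewrite -e !inE eqxx.
by rewrite wtU1// e mulrA.
Qed.

Lemma sum_subset_split A B (F : {set T} -> R) : [disjoint A & B] ->
  \sum_(U : {set T} | U \subset A :|: B) F U =
  \sum_(V : {set T} | V \subset B) \sum_(U : {set T} | U \subset A) F (U :|: V).
Proof.
move=> dAB; rewrite pair_big_dep/=.
rewrite (reindex_onto (fun p : {set T} * {set T} => p.2 :|: p.1) (fun U => (U :&: B, U :&: A))) /=; last first.
  by move=> U UAB; rewrite -setIUr; apply/setIidPl.
apply: eq_bigl => -[V U] /=.
apply/andP/andP => [[UV /eqP[e1 e2]]|[VB UA]].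
  by rewrite -e1 -e2; split; exact: subsetIr.
split; first by rewrite setUSS.
have h1 : U :&: B = set0.
  by apply/eqP; rewrite setI_eq0; apply: disjointWl dAB.
have h2 : V :&: A = set0.
  by apply/eqP; rewrite setI_eq0 disjoint_sym; apply: disjointWr dAB.
by rewrite !setIUl h1 h2 setU0 set0U (setIidPl VB) (setIidPl UA).
Qed.

Definition elsym x B n : R := \sum_(U : {set T} | (U \subset B) && (#|U| == n)) wt x U.

Lemma elsym_ge0 x B n : (forall t, 0 <= x t) -> 0 <= elsym x B n.
Proof. by move=> x0; rewrite sumr_ge0// => U _; exact: wt_ge0. Qed.

Lemma elsym0 x B : elsym x B 0 = 1.
Proof.
rewrite /elsym (big_pred1 set0) ?wt0// => U /=.
by rewrite cards_eq0; case: eqVneq => [->|_]; rewrite ?sub0set ?andbF.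
Qed.

(** The Mecke formula for the indicator of [#|U :\ r| = n]: a set of size [n + 1] is counted once
    for each of its elements. *)
Lemma elsymS x B n : n.+1%:R * elsym x B n.+1 =
  \sum_(r in B) x r * (\sum_(U : {set T} | (U \subset B :\ r) && (#|U| == n)) wt x U).
Proof.
have := @mecke x B (fun _ U => (#|U| == n)%:R).
set r1 := \sum_(r in B) _; set r2 := \sum_(r in B) _.
have -> : r1 = r2.
  apply: eq_bigr => r _; congr (_ * _); rewrite [RHS]big_mkcondr.
  by apply: eq_bigr => U _; case: ifP => _; rewrite ?mulr1 ?mulr0.
move=> <-; rewrite /elsym mulr_sumr big_mkcondr; apply: eq_bigr => U _.
have -> : \sum_(r in U) (#|U :\ r| == n)%:R = \sum_(r in U) (#|U| == n.+1)%:R :> R.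
  by apply: eq_bigr => r rU; rewrite [in RHS](cardsD1 r) rU.
rewrite sumr_const; case: ifP => [/eqP e|_]; last by rewrite mul0rn mulr0.
by rewrite e mulrC.
Qed.

Lemma elsym_le x B n : (forall t, 0 <= x t) ->
  elsym x B n <= (\sum_(t in B) x t) ^+ n / n`!%:R.
Proof.
move=> x0; elim: n => [|n IH]; first by rewrite elsym0 expr0 fact0 divr1.
have n1 : 0 < n.+1%:R :> R by rewrite ltr0n.
rewrite -(ler_pM2l n1) elsymS.
apply: (@le_trans _ _ ((\sum_(t in B) x t) * elsym x B n)).
  rewrite mulr_suml ler_sum// => r rB; rewrite ler_wpM2l// /elsym.
  rewrite [leRHS]big_mkcond [leLHS]big_mkcond ler_sum// => U _.
  case: ifP => [/andP[UB ->]|_]; last by case: ifP => // _; exact: wt_ge0.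
  by rewrite andbT (subset_trans UB)// subD1set.
have s0 : 0 <= \sum_(t in B) x t by rewrite sumr_ge0.
apply: le_trans (ler_wpM2l s0 IH) _.
have fn : n`!%:R != 0 :> R by rewrite pnatr_eq0 -lt0n fact_gt0.
rewrite factS natrM exprS; have : n.+1%:R != 0 :> R by rewrite gt_eqF.
rewrite le_eqVlt; move: (n.+1%:R : R) (\sum_(_ in _) _) => u S u0.
by apply/orP; left; apply/eqP; field; rewrite fn u0.
Qed.

(** At each of the [n] choices the elements already taken have removed at most [d] apiece, so the
    available mass never falls below [l]. *)
Lemma elsym_ge x B n (d l : R) : (forall t, 0 <= x t) -> (forall t, t \in B -> x t <= d) ->
  0 <= l -> 0 <= d -> l + n%:R * d <= \sum_(t in B) x t -> l ^+ n / n`!%:R <= elsym x B n.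
Proof.
move=> x0 xd l0 d0; elim: n => [|n IH] h; first by rewrite elsym0 expr0 fact0 divr1.
have n1 : 0 < n.+1%:R :> R by rewrite ltr0n.
rewrite -(ler_pM2l n1) elsymS.
have h' : l + n%:R * d <= \sum_(t in B) x t.
  by apply: le_trans h; rewrite lerD2l ler_wpM2r// ler_nat.
have -> : n.+1%:R * (l ^+ n.+1 / n.+1`!%:R) = l * (l ^+ n / n`!%:R).
  have fn : n`!%:R != 0 :> R by rewrite pnatr_eq0 -lt0n fact_gt0.
  rewrite factS natrM exprS; have : n.+1%:R != 0 :> R by rewrite gt_eqF.
  by move: (n.+1%:R : R) => u u0; field; rewrite fn u0.
apply: le_trans (ler_wpM2l l0 (IH h')) _.
have -> : \sum_(r in B) x r * (\sum_(U : {set T} | (U \subset B :\ r) && (#|U| == n)) wt x U) =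
  \sum_(U : {set T} | (U \subset B) && (#|U| == n)) wt x U * (\sum_(r in B :\: U) x r).
  under eq_bigr do rewrite mulr_sumr.
  under [RHS]eq_bigr do rewrite mulr_sumr.
  rewrite (exchange_big_dep (fun U : {set T} => (U \subset B) && (#|U| == n)))/=; last first.
    by move=> r U rB /andP[UB ->]; rewrite andbT (subset_trans UB)// subD1set.
  apply: eq_bigr => U /andP[UB Un]; apply: eq_big => [r|r _]; last by rewrite mulrC.
  by rewrite !inE Un andbT subsetD1 UB /= andbC.
rewrite /elsym mulr_sumr ler_sum// => U /andP[UB /eqP Un]; rewrite mulrC ler_wpM2l ?wt_ge0//.
have := h'; rewrite (big_setID U)/= (setIidPr UB).
have : \sum_(t in U) x t <= n%:R * d.
  rewrite -Un mulr_natl -sumr_const ler_sum// => t tU; apply: xd; exact: (subsetP UB).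
move=> h1 h2; have := le_trans h2 (lerD h1 (lexx _)).
by rewrite addrC lerD2l.
Qed.

Lemma sum_by_card x B (f : nat -> R) N : (#|B| < N)%N ->
  \sum_(V : {set T} | V \subset B) wt x V * f #|V| = \sum_(0 <= n < N) elsym x B n * f n.
Proof.
case: N => // N BN; rewrite big_mkord.
rewrite (partition_big (fun V : {set T} => inord #|V| : 'I_N.+1) xpredT)//=.
apply: eq_bigr => n _.
rewrite /elsym mulr_suml; apply: eq_big => [V|V /andP[VB /eqP e]].
  case VB : (V \subset B) => //=; rewrite -val_eqE /= inordK//.
  by rewrite (leq_ltn_trans (subset_leq_card VB)).
by rewrite -e inordK// (leq_ltn_trans (subset_leq_card VB)).
Qed.

Lemma sum_by_card_le x B (f : nat -> R) (l : R) : (forall t, 0 <= x t) ->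
  (forall n, 0 <= f n) -> \sum_(t in B) x t <= l ->
  \sum_(V : {set T} | V \subset B) wt x V * f #|V| <=
  \sum_(0 <= n < #|B|.+1) l ^+ n / n`!%:R * f n.
Proof.
move=> x0 f0 Bl; rewrite (@sum_by_card _ _ _ #|B|.+1)// ler_sum// => n _.
rewrite ler_wpM2r//; apply: le_trans (elsym_le _ _ x0) _.
by rewrite ler_wpM2r ?invr_ge0// lerXn2r ?nnegrE ?sumr_ge0// (le_trans _ Bl)// sumr_ge0.
Qed.

Lemma sum_by_card_ge x B (f e : nat -> R) N : (forall t, 0 <= x t) ->
  (forall n, 0 <= f n) -> (forall n, (n < N)%N -> e n <= elsym x B n) ->
  \sum_(0 <= n < N) e n * f n <=
  \sum_(V : {set T} | V \subset B) wt x V * f #|V|.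
Proof.
move=> x0 f0 eN; rewrite (@sum_by_card _ _ _ (N + #|B|.+1)) ?leq_addl//.
rewrite [leRHS](@big_cat_nat _ _ _ N)//=; last by rewrite leq_addr.
apply: (@le_trans _ _ (\sum_(0 <= n < N) elsym x B n * f n)); last first.
  by rewrite lerDl sumr_ge0// => n _; rewrite mulr_ge0// elsym_ge0.
by rewrite big_nat [leRHS]big_nat ler_sum// => n /andP[_ nN]; rewrite ler_wpM2r// eN.
Qed.

End SubsetSums.

(** * Finite sets as walks *)

Section LevelWalk.
Import mathcomp.boot.fintype mathcomp.boot.finset.
Context {R : realType} {T : finType} (x : T -> R) (lev : T -> nat).
Implicit Types (U V : {set T}) (g Psi : nat -> nat -> R).

Definition below l := [set t : T | (lev t < l)%N].
Definition level l := [set t : T | lev t == l].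
Definition cnt U l := #|U :&: below l|.

Lemma belowS l : below l.+1 = below l :|: level l.
Proof. by apply/setP => t; rewrite !inE ltnS leq_eqVlt orbC. Qed.

Lemma below0 : below 0 = set0.
Proof. by apply/setP => t; rewrite !inE. Qed.

Lemma disj_below_level l : [disjoint below l & level l].
Proof.
rewrite -setI_eq0; apply/eqP/setP => t; rewrite !inE.
by case: ltngtP.
Qed.

Lemma cnt0 U : cnt U 0 = 0%N.
Proof. by rewrite /cnt below0 setI0 cards0. Qed.

Lemma cntS U l : cnt U l.+1 = (cnt U l + #|U :&: level l|)%N.
Proof.
rewrite /cnt belowS setIUr cardsU; set I := _ :&: _ :&: _.
have -> : I = set0; last by rewrite cards0 subn0.
apply/eqP; rewrite -subset0; apply/subsetP => t; rewrite !inE.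
by case: ltngtP; rewrite ?andbF.
Qed.

Lemma cnt_sub U l : U \subset below l -> cnt U l = #|U|.
Proof. by move=> /setIidPl Ul; rewrite /cnt Ul. Qed.

Lemma cnt_mono U l m : (l <= m)%N -> (cnt U l <= cnt U m)%N.
Proof.
move=> lm; apply/subset_leq_card/setIS/subsetP => t; rewrite !inE => h.
exact: leq_trans lm.
Qed.

Lemma cntU1 U r l : r \notin U -> cnt (r |: U) l = (cnt U l + (lev r < l))%N.
Proof.
move=> rU; rewrite /cnt setIUl cardsU (_ : [set r] :&: below l :&: (U :&: below l) = set0); last first.
  apply/setP => t; rewrite !inE; case: eqVneq => //= ->; rewrite (negbTE rU) /=.
  by rewrite andbF.
rewrite cards0 subn0 addnC; congr (_ + _)%N.
case: ltnP => h; last by apply/eqP; rewrite cards_eq0; apply/eqP/setP => t; rewrite !inE;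
  case: eqVneq => //= ->; rewrite ltnNge h.
by rewrite (setIidPl _) ?cards1// sub1set inE.
Qed.

(* Product of the factors [g l h_l] along the walk of heights read from the top
   level down; a level with [n] elements moves the height by [n - 1], and the value
   is [0] as soon as the height becomes negative. *)
Fixpoint walkval g U l h : R :=
  if l is k.+1 then
    g l h * (if (h + #|U :&: level k|)%N is m.+1 then walkval g U k m else 0)
  else g 0%N h.

Lemma walkval_ext g U V l h :
  (forall k, (k < l)%N -> U :&: level k = V :&: level k) -> walkval g U l h = walkval g V l h.
Proof.
elim: l h => //= l IH h H; rewrite H//; congr (_ * _).
case: (h + _)%N => // m; apply: IH => k kl; apply: H; exact: ltnW.
Qed.

Lemma walkval_ge0 g U l h : (forall k m, 0 <= g k m) -> 0 <= walkval g U l h.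
Proof.
move=> g0; elim: l h => //= l IH h; rewrite mulr_ge0//.
by case: (h + _)%N.
Qed.

Lemma walkval_path g U l (H : nat -> nat) :
  (forall k, (k < l)%N -> (H k.+1 + #|U :&: level k|)%N = (H k).+1) ->
  walkval g U l (H l) = \prod_(0 <= k < l.+1) g k (H k).
Proof.
elim: l => [|l IH] HH; first by rewrite big_nat1.
rewrite big_nat_recr//= HH// IH 1?mulrC// => k kl; apply: HH; exact: ltnW.
Qed.

Lemma walkval_split g l h V : V \subset level l ->
  forall U, U \subset below l ->
  walkval g (U :|: V) l.+1 h =
  g l.+1 h * (if (h + #|V|)%N is m.+1 then walkval g U l m else 0).
Proof.
move=> Vl U Ul /=; congr (_ * _).
have -> : (U :|: V) :&: level l = V.
  apply/setP => t; rewrite !inE; have := subsetP Ul t; have := subsetP Vl t.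
  rewrite !inE; case: (t \in V) => [/(_ isT) ->|_]; first by rewrite orbT.
  by rewrite orbF; case: (t \in U) => // /(_ isT); case: ltngtP.
case: (h + _)%N => // m; apply: walkval_ext => k kl.
apply/setP => t; rewrite !inE; have := subsetP Vl t; rewrite !inE.
case: (t \in V) => [/(_ isT) /eqP ->|_]; last by rewrite orbF.
by rewrite (gtn_eqF kl) !andbF.
Qed.

Lemma sum_walk_step g l h :
  \sum_(U : {set T} | U \subset below l.+1) wt x U * walkval g U l.+1 h =
  g l.+1 h * \sum_(V : {set T} | V \subset level l) wt x V *
    (if (h + #|V|)%N is m.+1 then
       \sum_(U : {set T} | U \subset below l) wt x U * walkval g U l m else 0).
Proof.
rewrite belowS sum_subset_split ?disj_below_level// mulr_sumr.
apply: eq_bigr => V Vl.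
transitivity (\sum_(U : {set T} | U \subset below l) wt x U * wt x V *
   (g l.+1 h * (if (h + #|V|)%N is m.+1 then walkval g U l m else 0))).
  apply: eq_bigr => U Ul; rewrite walkval_split// wtU//.
  by apply: disjointWl Ul _; apply: disjointWr Vl _; exact: disj_below_level.
case: (h + _)%N => [|m]; first by rewrite !mulr0 big1// => U _; rewrite !mulr0.
rewrite mulrCA mulr_sumr mulr_sumr; apply: eq_bigr => U _; ring.
Qed.

(** Supersolution principle: [Psi] dominates at level 0, and one step of the recursion over levels,
    with [th^n / n!] in place of the elementary symmetric sums, stays below [Psi] at the next level.
    Arbitrary [N] leaves the size of a level free. *)
Lemma kernel_upper g Psi L (th : R) : (forall t, 0 <= x t) -> (forall l h, 0 <= g l h) ->
  (forall l, (l < L)%N -> \sum_(t in level l) x t <= th) ->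
  (forall l h, 0 <= Psi l h) -> (forall h, g 0%N h <= Psi 0%N h) ->
  (forall l h N, (l < L)%N -> g l.+1 h * \sum_(0 <= n < N | (0 < h + n)%N)
      th ^+ n / n`!%:R * Psi l (h + n).-1 <= Psi l.+1 h) ->
  forall l h, (l <= L)%N ->
  \sum_(U : {set T} | U \subset below l) wt x U * walkval g U l h <= Psi l h.
Proof.
move=> x0 g0 Hth P0 base step; elim=> [|l IH] h lL.
  rewrite below0 (big_pred1 set0) ?wt0 ?mul1r//= => U.
  by rewrite subset0.
rewrite sum_walk_step; apply: le_trans (step l h #|level l|.+1 lL); apply: ler_wpM2l => //.
pose f n := if (0 < h + n)%N then Psi l (h + n).-1 else 0.
apply: (@le_trans _ _ (\sum_(V : {set T} | V \subset level l) wt x V * f #|V|)).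
  apply: ler_sum => V _; rewrite ler_wpM2l ?wt_ge0// /f.
  by case: (h + _)%N => //= m; apply: IH; exact: ltnW.
have f0 n : 0 <= f n by rewrite /f; case: ifP.
apply: le_trans (sum_by_card_le x0 f0 (Hth l lL)) _.
rewrite [leRHS]big_mkcond ler_sum// => n _; rewrite /f.
by case: ifP => _; rewrite ?mulr0.
Qed.

(** The matching subsolution principle. Counts are cut at [N l] because symmetric sums of a finite
    level are comparable to Poisson weights only for small [n]. *)
Lemma kernel_lower g Psi L (e : nat -> nat -> R) (N : nat -> nat) :
  (forall t, 0 <= x t) -> (forall l h, 0 <= g l h) ->
  (forall l n, (l < L)%N -> (n < N l)%N -> 0 <= e l n <= elsym x (level l) n) ->
  (forall h, Psi 0%N h <= g 0%N h) ->
  (forall l h, (l < L)%N -> Psi l.+1 h <= g l.+1 h * \sum_(0 <= n < N l | (0 < h + n)%N)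
      e l n * Psi l (h + n).-1) ->
  forall l h, (l <= L)%N ->
  Psi l h <= \sum_(U : {set T} | U \subset below l) wt x U * walkval g U l h.
Proof.
move=> x0 g0 He base step; elim=> [|l IH] h lL.
  rewrite below0 (big_pred1 set0) ?wt0 ?mul1r//= => U.
  by rewrite subset0.
rewrite sum_walk_step; apply: le_trans (step l h lL) _; apply: ler_wpM2l => //.
pose S m := \sum_(U : {set T} | U \subset below l) wt x U * walkval g U l m.
pose f n := if (0 < h + n)%N then S (h + n).-1 else 0.
have S0 m : 0 <= S m by rewrite sumr_ge0// => U _; rewrite mulr_ge0 ?wt_ge0 ?walkval_ge0.
have f0 n : 0 <= f n by rewrite /f; case: ifP.
apply: (@le_trans _ _ (\sum_(V : {set T} | V \subset level l) wt x V * f #|V|)); last first.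
  by apply: ler_sum => V _; rewrite ler_wpM2l ?wt_ge0// /f; case: (h + _)%N.
apply: le_trans (sum_by_card_ge x0 f0 (e := e l) (N := N l) _); last first.
  by move=> n nN; have /andP[] := He l n lL nN.
rewrite big_mkcond big_nat [leRHS]big_nat ler_sum// => n /andP[_ nN]; rewrite /f.
have /andP[e0 _] := He l n lL nN.
by case: ifP => _; rewrite ?mulr0// ler_wpM2l// IH// ltnW.
Qed.

End LevelWalk.

(** * Weighted counts of walks near a linear barrier *)

Section WalkSums.
Import mathcomp.boot.fintype mathcomp.boot.finset.
Context {R : realType}.

Let th : R := ln 2.
Let th0 : 0 < th.
Proof. by have := @ln2_gt R; rewrite /th; lra. Qed.

Lemma sum_arith_geo (y : R) n : 0 <= y -> y < 1 ->
  \sum_(0 <= q < n) q.+1%:R * y ^+ q <= (1 - y) ^- 2.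
Proof.
move=> y0 y1; have h : 0 < 1 - y by lra.
rewrite -[leRHS]mul1r ler_pdivlMr ?exprn_gt0//.
have -> : (\sum_(0 <= q < n) q.+1%:R * y ^+ q) * (1 - y) ^+ 2 = 1 - n.+1%:R * y ^+ n + n%:R * y ^+ n.+1.
  elim: n => [|n IH]; first by rewrite big_geq// expr0; ring.
  rewrite big_nat_recr//= mulrDl IH -[n.+2%:R]natr1 -[n.+1%:R]natr1 !exprS; ring.
rewrite exprS -natr1; have : 0 <= y ^+ n by rewrite exprn_ge0.
have : 0 <= n%:R :> R by [].
move: (y ^+ n) (n%:R : R) => u v v0 u0.
have : 0 <= v * u * (1 - y) by have f0 := @fpw_ge0 R; nng.
lra.
Qed.

(** The ratio of the series in which height [q] carries both [2^-q] and the tilt [th^-q]; it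
    converges because [ln 2 > 1/2]. *)
Let y : R := (2 * th)^-1.
Let y01 : 0 <= y /\ y < 1.
Proof.
have h : 1 < 2 * th by have := @ln2_gt R; rewrite /th; lra.
by rewrite /y invr_ge0 invf_lt1 ?h ?(ltW (lt_trans ltr01 h))// (lt_trans ltr01 h).
Qed.

(** Change of measure: with [th^-h] attached to height [h], the step from [h] to [h + n - 1] trades
    the weight [th^n / n!] for [1 / n!] and one factor [th], independent of [n]. *)
Lemma tilt_term n h (X : R) : (0 < h + n)%N ->
  th ^+ n * (th ^- (h + n).-1 * X) = th * (th ^- h * X).
Proof.
move=> hn; rewrite !mulrA; congr (_ * _).
have e : th ^+ n * th = th * th ^+ n by rewrite mulrC.
apply: (@mulIf _ (th ^+ h * th ^+ (h + n).-1)).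
  by rewrite mulf_neq0// expf_neq0// gt_eqF.
rewrite -[in RHS]mulrA (mulrA (th ^- h)) mulVf ?expf_neq0 ?gt_eqF// mul1r.
rewrite -[in LHS]mulrA [th ^- _ * _]mulrCA mulVf ?expf_neq0 ?gt_eqF// mulr1.
by rewrite -exprS prednK// addnC exprD.
Qed.

(** The heights [cnt U j + l + 1 - cnt U l - j] form a nonnegative walk equal to 1 at level [j]. Cut
    there: above [j] it is a first passage of length about [J - j], below [j] a walk with free end,
    controlled by [pot]. This gives the two factors [dec]. The power of 2 is [2^(J + 1 - q)], where
    [q] is the height at level [J]. *)
Lemma paths_upper : exists2 C : R, 0 < C & forall (T : finType) (x : T -> R) (lev : T -> nat) J j,
  (forall t, 0 <= x t) -> (forall l, (l < J)%N -> \sum_(t in level lev l) x t <= th) ->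
  (j <= J)%N ->
  \sum_(U : {set T} | (U \subset below lev J) &&
      [forall l : 'I_J.+1, (cnt lev U l + j <= cnt lev U j + l.+1)%N])
      wt x U * 2 ^+ (cnt lev U J - cnt lev U j + j)
  <= C * (2 * expR 1 * th) ^+ J * (dec j * dec (J - j)).
Proof.
have [[X c] [/= X0 X1 c0 Hc]] := @pot_base R.
have e1 := @expR_gt0 R 1.
pose D : R := 4 * (1 - X)^-1 * 2.
have D0 : 0 <= D by rewrite mulr_ge0// mulr_ge0// invr_ge0; lra.
have [y0 y1] := y01.
exists (1 + 2 * (c^-1 * D) * (4 * expR 1 ^+ 2) * (1 - y) ^- 2).
  rewrite ltr_pwDl// !mulr_ge0 ?exprn_ge0 ?invr_ge0 ?exprn_ge0 ?(ltW c0) ?(ltW e1)//; lra.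
move=> T x lev J j x0 Hx jJ.
(* The height at level 0 is at most [#|T| + 1]; capping it there makes one finite [B] sufficient for
   the base bound on [pot]. *)
pose Hm := #|T|.+1; pose B := (2 * Hm.+1).+1.
have HB h : (h <= Hm)%N -> c * th ^+ h <= pot X B 0 h.
  by move=> hH; apply: Hc; rewrite ltnS leq_mul2l.
pose g k m : R := if ((k == j) ==> (m == 1%N)) && ((k == 0%N) ==> (m <= Hm)%N) then 1 else 0.
have g0 k m : 0 <= g k m by rewrite /g; case: ifP.
pose A : R := c^-1 * th ^+ j * th^-1 * pot X B j 1.
have pot0 l h : 0 <= pot X B l h by apply/pot_ge0/ltW.
have A0 : 0 <= A by rewrite /A; nng.
(* At level [j] only height 1 survives. There [fpw 2 2 = 1], accounting for two forced downward
   steps from 1 to -1, and [A] is chosen so that the two branches agree. *)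
pose Psi l h : R := if (l < j)%N then c^-1 * th ^+ l * (th ^- h * pot X B l h)
   else A * th ^+ (l - j).+1 * (th ^- h * fpw (l - j).+2 h.+1).
have Psi0 l h : 0 <= Psi l h.
  have f0 := @fpw_ge0 R; by rewrite /Psi; case: ifP => _; nng.
have ker q : \sum_(U : {set T} | U \subset below lev J) wt x U * walkval lev g U J q <= Psi J q.
  apply: (@kernel_upper _ _ x lev g Psi J th) => //.
  - move=> h; rewrite /g /Psi; case: posnP => [j0|j0].
      rewrite j0 eqxx /= subnn; case: eqVneq => [->|_] /=; last first.
        by have f0 := @fpw_ge0 R; nng.
      rewrite fpw22 !expr1 mulr1 mulfK ?gt_eqF// /A j0 expr0 mulr1 -mulrA ler_pdivlMl// mulr1.
      by rewrite mulrC ler_pdivlMr//; have := HB 1%N isT; rewrite expr1.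
    rewrite (ltn_eqF j0) /=; case: leqP => hH; last first.
      by have f0 := @fpw_ge0 R; nng.
    rewrite expr0 mulr1 ler_pdivlMl// mulr1 ler_pdivlMl ?exprn_gt0// mulrC; exact: HB.
  - move=> l h N lJ; rewrite /Psi.
    have gb : 0 <= g l.+1 h <= 1 by rewrite g0 /g; case: ifP => _; rewrite ?lexx ?ler01.
    have [lj|jl] := ltnP l j; last first.
      rewrite ltnNge (leqW jl)/= subSn//.
      apply: (@le_trans _ _ (\sum_(0 <= n < N | (0 < h + n)%N) A * th ^+ (l - j).+2 * th ^- h * ((n`!%:R)^-1 * fpw (l - j).+2 (h + n)))).
        rewrite -[leRHS]mul1r; apply: ler_pM => //.
        - by apply: sumr_ge0 => n _; have f0 := @fpw_ge0 R; nng.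
        - by case/andP: gb.
        - apply: ler_sum => n hn; rewrite prednK//.
          rewrite [leLHS](_ : _ = n`!%:R^-1 * (A * th ^+ (l - j).+1) * (th ^+ n * (th ^- (h + n).-1 * fpw (l - j).+2 (h + n)))); last by ring.
          by rewrite tilt_term// le_eqVlt; apply/orP; left; apply/eqP; rewrite [th ^+ (l - j).+2]exprS; ring.
      rewrite -mulr_sumr [leRHS]mulrA; apply: ler_wpM2l; last exact: fpw_step.
      by nng.
    have key : \sum_(0 <= n < N | (0 < h + n)%N) th ^+ n / n`!%:R * (c^-1 * th ^+ l * (th ^- (h + n).-1 * pot X B l (h + n).-1))
       <= c^-1 * th ^+ l.+1 * (th ^- h * pot X B l.+1 h).
      apply: (@le_trans _ _ (\sum_(0 <= n < N | (0 < h + n)%N) c^-1 * th ^+ l.+1 * th ^- h * ((n`!%:R)^-1 * pot X B l (h + n).-1))).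
        apply: ler_sum => n hn.
        rewrite [leLHS](_ : _ = n`!%:R^-1 * (c^-1 * th ^+ l) * (th ^+ n * (th ^- (h + n).-1 * pot X B l (h + n).-1))); last by ring.
        by rewrite tilt_term// le_eqVlt; apply/orP; left; apply/eqP; rewrite [th ^+ l.+1]exprS; ring.
      rewrite -mulr_sumr -mulrA; apply: ler_wpM2l; first by have f0 := @fpw_ge0 R; nng.
      by apply: ler_wpM2l; [nng|exact/pot_step/ltW].
    have s0 : 0 <= \sum_(0 <= n < N | (0 < h + n)%N) th ^+ n / n`!%:R * (c^-1 * th ^+ l * (th ^- (h + n).-1 * pot X B l (h + n).-1)).
      by apply: sumr_ge0 => n _; have f0 := @fpw_ge0 R; nng.
    have [lj1|] := ltnP l.+1 j.
      apply: le_trans key; rewrite -[leRHS]mul1r; apply: ler_wpM2r => //.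
      by case/andP: gb.
    move=> jl1; have je : j = l.+1 by apply/eqP; rewrite eqn_leq jl1 lj.
    rewrite je subnn /g je eqxx /=.
    case: eqVneq => [h1|_] /=; last first.
      by rewrite mul0r !mulr_ge0 ?invr_ge0 ?exprn_ge0 ?fpw_ge0// ltW.
    rewrite mul1r h1 in key *; apply: le_trans key _.
    by rewrite fpw22 /A je !expr1 mulr1 mulfK ?gt_eqF// mulrA.
apply: (@le_trans _ _ (\sum_(0 <= q < J.+2) 2 ^+ (J.+1 - q) * Psi J q)).
  apply: (@le_trans _ _ (\sum_(0 <= q < J.+2) 2 ^+ (J.+1 - q) *
      (\sum_(U : {set T} | U \subset below lev J) wt x U * walkval lev g U J q))); last first.
    by apply: ler_sum => q _; apply: ler_wpM2l; rewrite ?exprn_ge0.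
  under [leRHS]eq_bigr do rewrite mulr_sumr.
  rewrite exchange_big /= big_mkcondr /=; apply: ler_sum => U UJ.
  have w0 := wt_ge0 U x0.
  case: ifP => [/forallP HU|_]; last first.
    by apply: sumr_ge0 => q _; rewrite !mulr_ge0 ?exprn_ge0 ?walkval_ge0.
  have HU' l : (l <= J)%N -> (cnt lev U l + j <= cnt lev U j + l.+1)%N.
    by move=> lJ; have := HU (Ordinal (lJ : (l < J.+1)%N)).
  pose H l := ((cnt lev U j + l.+1) - (cnt lev U l + j))%N.
  have cm := cnt_mono lev U jJ.
  have HJ : (H J < J.+2)%N by rewrite /H; move: cm; clear; lia.
  rewrite (bigD1_seq (H J)) ?iota_uniq ?mem_index_iota//=.
  rewrite walkval_path; last first.
    move=> k kJ; rewrite /H; have := HU' k.+1 kJ; have := HU' k (ltnW kJ); rewrite cntS.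
    by clear; lia.
  rewrite big_nat big1 ?mulr1; last first.
    move=> k _; rewrite /g; case: eqVneq => [->|_] /=.
      rewrite /H; have -> : (cnt lev U j + j.+1 - (cnt lev U j + j) = 1)%N by clear; lia.
      rewrite eqxx /=; case: eqVneq => // _.
    case: eqVneq => [->|_]//=; rewrite /H cnt0 add0n addn1.
    suff : (cnt lev U j <= #|T|)%N by rewrite /Hm => h; case: leqP => //; move: h; clear; lia.
    by rewrite /cnt max_card.
  have -> : (J.+1 - H J = cnt lev U J - cnt lev U j + j)%N.
    by have := HU' J (leqnn J); rewrite /H; move: cm; clear; lia.
  rewrite mulrC lerDl sumr_ge0// => q _.
  by rewrite !mulr_ge0 ?exprn_ge0 ?walkval_ge0.
have Abound : A <= c^-1 * D * th ^+ j * th^-1 * expR 1 ^+ j * dec j.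
  rewrite /A [leRHS](_ : _ = c^-1 * th ^+ j * th^-1 * (4 * (1 - X)^-1 * 2%:R * expR 1 ^+ j * dec j)); last first.
    by rewrite /D; ring.
  by apply: ler_wpM2l; [nng|exact: (pot_le _ _ _ (ltW X0) X1)].
set b := (J - j)%N.
have Jb : J = (j + b)%N by rewrite subnKC.
apply: (@le_trans _ _ (\sum_(0 <= q < J.+2) (2 * (c^-1 * D) * (4 * expR 1 ^+ 2) * (2 * expR 1 * th) ^+ J * (dec j * dec b)) * (q.+1%:R * y ^+ q))).
  rewrite big_nat [leRHS]big_nat; apply: ler_sum => q /andP[_ qJ].
  rewrite /Psi ltnNge jJ /= -/b.
  apply: (@le_trans _ _ (2 ^+ (J.+1 - q) * (c^-1 * D * th ^+ j * th^-1 * expR 1 ^+ j * dec j * th ^+ b.+1 * (th ^- q * (4 * q.+1%:R * expR 1 ^+ b.+2 * dec b))))).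
    apply: ler_wpM2l; rewrite ?exprn_ge0//; apply: ler_pM.
    - by have f0 := @fpw_ge0 R; nng.
    - by have f0 := @fpw_ge0 R; nng.
    - by apply: ler_wpM2r => //; rewrite exprn_ge0// ltW.
    - apply: ler_wpM2l; first by nng.
      by have := @fpw_le_dec R b 2 q.+1 isT; rewrite addn2.
  have -> : 2 ^+ (J.+1 - q) = 2 * 2 ^+ J * (2 ^- q) :> R.
    rewrite -exprS; apply: (@mulIf _ (2 ^+ q)); first by rewrite expf_neq0.
    by rewrite -exprD subnK// mulfVK// expf_neq0.
  have -> : y ^+ q = 2 ^- q * th ^- q by rewrite /y exprVn exprMn invfM.
  rewrite Jb !exprMn !exprD !exprS.
  have eb : expR 1 ^+ b.+2 = expR 1 * (expR 1 * expR 1 ^+ b) :> R by rewrite !exprS.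
  rewrite le_eqVlt; apply/orP; left; apply/eqP; field.
  by rewrite !gt_eqF//= exprn_gt0.
rewrite -mulr_sumr.
have d0 a : 0 <= @dec R a by exact/ltW/dec_gt0.
apply: le_trans (ler_wpM2l _ (sum_arith_geo _ y0 y1)) _.
  by have f0 := @fpw_ge0 R; nng.
set u := (1 - y) ^- 2; set v := (2 * expR 1 * th) ^+ J; set w := dec j * dec b.
rewrite [leLHS](_ : _ = 2 * (c^-1 * D) * (4 * expR 1 ^+ 2) * u * v * w); last by ring.
have w0 : 0 <= w by rewrite mulr_ge0.
have v0 : 0 <= v by rewrite /v; nng.
by do 2 apply: ler_wpM2r => //; rewrite lerDr.
Qed.

(* Since [cnt U J - cnt U j] counts the elements of level at least [j], the
   bound on [f] with [j] maximizing [cnt U j - j] is the one that matters. *)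
Lemma walk_min_upper : exists2 C : R, 0 < C &
  forall (T : finType) (x : T -> R) (lev : T -> nat) J (w : T -> R) (f : {set T} -> R),
  (forall t, 0 <= x t) -> (forall l, (l < J)%N -> \sum_(t in level lev l) x t <= th) ->
  (forall t, 0 <= w t <= 2 ^+ lev t) -> (forall U, 0 <= f U) ->
  (forall U j, (j <= J)%N -> f U <= 2 ^+ (cnt lev U J - cnt lev U j) *
      (1 + \sum_(r in U | (lev r < j)%N) w r)) ->
  \sum_(U : {set T} | U \subset below lev J) wt x U * f U
   <= C * (2 * expR 1 * th) ^+ J * dec J.
Proof.
have [C C0 HC] := paths_upper; exists (C * 96); first by rewrite mulr_gt0.
move=> T x lev J w f x0 Hx Hw f0 Hf.
have e1 := @expR_gt0 R 1.
have d0 a : 0 <= @dec R a by exact/ltW/dec_gt0.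
pose good1 j (U : {set T}) := [forall l : 'I_J.+1, (cnt lev U l + j <= cnt lev U j + l.+1)%N].
pose good0 j (U : {set T}) := [forall l : 'I_J.+1, (cnt lev U l + j <= cnt lev U j + l)%N].
pose S j := \sum_(U : {set T} | (U \subset below lev J) && good1 j U)
      wt x U * 2 ^+ (cnt lev U J - cnt lev U j + j).
have good01 j U : good0 j U -> good1 j U.
  by move=> /forallP h; apply/forallP => l; apply: leq_trans (h l) _; rewrite leq_add2l.
suff main : \sum_(U : {set T} | U \subset below lev J) wt x U * f U <=
    \sum_(0 <= j < J.+1) 2 * S j.
  apply: le_trans main _.
  apply: (@le_trans _ _ (\sum_(0 <= j < J.+1) 2 * C * (2 * expR 1 * th) ^+ J * (dec j * dec (J - j)))).
    rewrite big_nat [leRHS]big_nat; apply: ler_sum => j /andP[_ jJ].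
    rewrite [leRHS](_ : _ = 2 * (C * (2 * expR 1 * th) ^+ J * (dec j * dec (J - j)))); last by ring.
    by apply: ler_wpM2l => //; exact: HC.
  rewrite -mulr_sumr.
  apply: le_trans (ler_wpM2l _ (sum_dec_conv J)) _; first by nng.
  by rewrite le_eqVlt; apply/orP; left; apply/eqP; ring.
have step1 (U : {set T}) : U \subset below lev J -> f U <= \sum_(0 <= j < J.+1)
    (if good0 j U then 2 ^+ (cnt lev U J - cnt lev U j) *
      (2 ^+ j + \sum_(r in U | (lev r < j)%N) w r) else 0).
  move=> UJ.
  (* [cnt U l + (J - l)] stands for [cnt U l - l], to stay in [nat]. *)
  case: (@arg_maxnP _ (@ord0 J) xpredT (fun l : 'I_J.+1 => (cnt lev U l + (J - l))%N)) => //= j _ jmax.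
  have gj : good0 j U.
    apply/forallP => l; have := jmax l isT; have := ltn_ord l; have := ltn_ord j.
    by rewrite !ltnS; clear; lia.
  rewrite (bigD1_seq (val j)) ?iota_uniq ?mem_index_iota//= gj.
  apply: (@le_trans _ _ (2 ^+ (cnt lev U J - cnt lev U j) *
      (2 ^+ j + \sum_(r in U | (lev r < j)%N) w r))).
    apply: le_trans (Hf U j (ltn_ord j)) _; apply: ler_wpM2l; first by nng.
    by rewrite lerD2r exprn_ege1// ler1n.
  rewrite lerDl sumr_ge0// => i _; case: ifP => // _.
  apply: mulr_ge0; [nng|apply: addr_ge0; [nng|]].
  by apply: sumr_ge0 => r _; have /andP[] := Hw r.
apply: (@le_trans _ _ (\sum_(U : {set T} | U \subset below lev J) wt x U *
   \sum_(0 <= j < J.+1) (if good0 j U then 2 ^+ (cnt lev U J - cnt lev U j) *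
      (2 ^+ j + \sum_(r in U | (lev r < j)%N) w r) else 0))).
  by apply: ler_sum => U UJ; apply: ler_wpM2l; [exact: wt_ge0|exact: step1].
under eq_bigr do rewrite mulr_sumr.
rewrite exchange_big /=; rewrite big_nat [leRHS]big_nat; apply: ler_sum => j /andP[_ jJ].
rewrite [2 * S j](_ : _ = S j + S j); last by ring.
(* The sum of the [w r] goes through the Mecke formula. Deleting [r] with [lev r < j] lowers
   [cnt U j] by one, so the barrier [l] of [good0] relaxes to the [l + 1] of [good1]. *)
apply: (@le_trans _ _ (S j + \sum_(U : {set T} | U \subset below lev J) wt x U *
   \sum_(r in U) (if (lev r < j)%N && good1 j (U :\ r) then w r * 2 ^+ (cnt lev (U :\ r) J - cnt lev (U :\ r) j) else 0))).
  rewrite /S big_mkcondr -big_split /=; apply: ler_sum => U UJ.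
  have w0 := wt_ge0 U x0.
  case: ifP => g0; last first.
    rewrite mulr0 addr_ge0//; first by case: ifP => _ //; nng.
    apply: mulr_ge0 => //; apply: sumr_ge0 => r _; case: ifP => // _.
    by apply: mulr_ge0; [have /andP[] := Hw r|nng].
  rewrite good01// exprD mulrDr mulrDr mulrA lerD2l; apply: ler_wpM2l => //.
  rewrite mulr_sumr big_mkcondr /=; apply: ler_sum => r rU; case: ifP => // rj.
  have rUr : r \notin U :\ r by rewrite !inE eqxx.
  have e l : cnt lev U l = (cnt lev (U :\ r) l + (lev r < l))%N.
    by rewrite -cntU1// setD1K.
  have -> : good1 j (U :\ r) => /=.
    apply/forallP => l; move/forallP: g0 => /(_ l); rewrite !e rj.
    by case: (lev r < l)%N => /=; clear; lia.
  by rewrite mulrC !e rj (leq_trans rj) ?subnDr.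
rewrite lerD2l.
rewrite (mecke x _ (fun r U => if (lev r < j)%N && good1 j U then w r * 2 ^+ (cnt lev U J - cnt lev U j) else 0)).
pose S' := \sum_(U : {set T} | (U \subset below lev J) && good1 j U) wt x U * 2 ^+ (cnt lev U J - cnt lev U j).
have S'0 : 0 <= S' by apply: sumr_ge0 => U _; have := wt_ge0 U x0 => ?; nng.
apply: (@le_trans _ _ (\sum_(r in below lev J | (lev r < j)%N) x r * w r * S')).
  rewrite [leRHS]big_mkcondr; apply: ler_sum => r rB; case: ifP => rj /=; last first.
    by rewrite big1 ?mulr0// => U _; rewrite mulr0.
  rewrite -mulrA; apply: ler_wpM2l => //; rewrite /S' mulr_sumr.
  rewrite [leLHS]big_mkcond [leRHS]big_mkcond; apply: ler_sum => U _.
  have /andP[wr _] := Hw r; have w0 := wt_ge0 U x0.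
  case: ifP => UB; last by case: ifP => // _; nng.
  rewrite (subset_trans UB) ?subD1set//=; case: ifP => _; last by rewrite mulr0.
  by rewrite mulrCA.
rewrite -mulr_suml.
have -> : S j = 2 ^+ j * S'.
  by rewrite /S /S' mulr_sumr; apply: eq_bigr => U _; rewrite exprD; ring.
apply: ler_wpM2r => //.
(* Since a level has mass below 1 and [w <= 2^lev], the inserted element costs at most [2^j], the
   factor already present in [S j]. *)
apply: (@le_trans _ _ (\sum_(0 <= l < j) 2 ^+ l)); last first.
  elim: (j) => [|k IHk]; first by rewrite big_geq// expr0.
  rewrite big_nat_recr//= exprS; move: IHk; move: (\sum_(_ <= _ < _) _) (2 ^+ k) => a b; lra.
apply: (@le_trans _ _ (\sum_(0 <= l < j) \sum_(r in level lev l) x r * 2 ^+ l)).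
  rewrite big_mkord (partition_big (fun r => inord (lev r) : 'I_j.-1.+1) xpredT)//=.
  have [j0|j0] := posnP j.
    rewrite [leLHS]big1; first by rewrite sumr_ge0// => l _; rewrite sumr_ge0// => r _; have := x0 r => ?; nng.
    by move=> l _; rewrite big1// => r /andP[/andP[_]]; rewrite {1}j0.
  rewrite -(big_mkord xpredT (fun l => \sum_(r in level lev l) x r * 2 ^+ l)) -[in leRHS](prednK j0) big_mkord.
  apply: ler_sum => l _; rewrite [leLHS]big_mkcond [leRHS]big_mkcond; apply: ler_sum => r _.
  have := x0 r => xr; have /andP[w1 w2] := Hw r.
  rewrite !inE; case: ifP => [/andP[/andP[rJ rj] /eqP e]|_]; last by case: ifP => // _; nng.
  have -> : (lev r == l)%N by rewrite -e inordK ?prednK.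
  by apply: ler_wpM2l => //; rewrite -e inordK ?prednK.
rewrite big_nat [leRHS]big_nat; apply: ler_sum => l /andP[_ lj].
rewrite -mulr_suml -[leRHS]mul1r; apply: ler_wpM2r; first by nng.
by apply: le_trans (Hx l _) _; [exact: leq_trans lj jJ|exact/ltW/ln2_lt1].
Qed.

Definition ballot (T : finType) (lev : T -> nat) J (U : {set T}) :=
  [forall l : 'I_J.+1, (cnt lev U l <= l)%N].

Lemma ballotP (T : finType) (lev : T -> nat) J (U : {set T}) :
  reflect (forall l, (l <= J)%N -> (cnt lev U l <= l)%N) (ballot lev J U).
Proof.
apply: (iffP forallP) => [H l lJ|H l]; first by have := H (Ordinal (lJ : (l < J.+1)%N)).
by apply: H; rewrite -ltnS.
Qed.

(** With heights [l - cnt U l], such a set is a nonnegative walk from 1 at level [J] to 0 at level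
    0; one more downward step completes a first passage, hence [fpw J.+1 2]. *)
Lemma ballot_upper (T : finType) (x : T -> R) (lev : T -> nat) J :
  (forall t, 0 <= x t) -> (forall l, (l < J)%N -> \sum_(t in level lev l) x t <= th) ->
  \sum_(U : {set T} | [&& U \subset below lev J, ballot lev J U & (cnt lev U J).+1 == J]) wt x U
  <= th ^+ J * th^-1 * fpw J.+1 2.
Proof.
move=> x0 Hx.
pose g k m : R := if (k == 0%N) ==> (m == 0%N) then 1 else 0.
have g0 k m : 0 <= g k m by rewrite /g; case: ifP.
pose Psi l h : R := th ^+ l * (th ^- h * fpw l.+1 h.+1).
have f0 := @fpw_ge0 R.
have Psi0 l h : 0 <= Psi l h by rewrite /Psi; nng.
have ker : \sum_(U : {set T} | U \subset below lev J) wt x U * walkval lev g U J 1 <= Psi J 1%N.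
apply: (@kernel_upper _ _ x lev g Psi J th x0 g0 Hx Psi0 _ _ J 1%N (leqnn J)) => [h|l h N lJ].
- rewrite /g /Psi expr0 mul1r /=; case: eqVneq => [->|_] /=; last by nng.
  by rewrite fpw11 expr0 invr1 mulr1.
- rewrite /g /= mul1r /Psi.
  apply: (@le_trans _ _ (\sum_(0 <= n < N | (0 < h + n)%N) th ^+ l.+1 * th ^- h * ((n`!%:R)^-1 * fpw l.+1 (h + n)))).
    apply: ler_sum => n hn; rewrite prednK//.
    rewrite [leLHS](_ : _ = n`!%:R^-1 * th ^+ l * (th ^+ n * (th ^- (h + n).-1 * fpw l.+1 (h + n)))); last by ring.
    by rewrite tilt_term// le_eqVlt; apply/orP; left; apply/eqP; rewrite [th ^+ l.+1]exprS; ring.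
  by rewrite -mulr_sumr [leRHS]mulrA; apply: ler_wpM2l; [nng|exact: fpw_step].
move: ker; rewrite /Psi expr1 mulrA; apply: le_trans; rewrite [leLHS]big_mkcondr; apply: ler_sum => U UJ.
have w0 := wt_ge0 U x0.
case: ifP => [/andP[/ballotP HU /eqP cJ]|_]; last by rewrite mulr_ge0 ?walkval_ge0.
pose H l := (l - cnt lev U l)%N.
have -> : 1%N = H J by rewrite /H; move: cJ; clear; lia.
rewrite walkval_path; last first.
  by move=> k kJ; rewrite /H; have := HU k.+1 kJ; have := HU k (ltnW kJ); rewrite cntS; clear; lia.
by rewrite big1 ?mulr1// => k _; rewrite /g /H; case: eqVneq => //= ->; rewrite sub0n.
Qed.

(** The factor charges [2^-h] for height [h] at level [j]. As [1/2 < ln 2], this beats the tilt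
    [th^-h], so the walk is in effect tied to the barrier at level [j] and splits into passages of
    lengths [j] and [J - j]. *)
Lemma ballot_weighted_upper : exists2 C : R, 0 < C &
  forall (T : finType) (x : T -> R) (lev : T -> nat) J j,
  (forall t, 0 <= x t) -> (forall l, (l < J)%N -> \sum_(t in level lev l) x t <= th) ->
  (j <= J)%N ->
  \sum_(U : {set T} | [&& U \subset below lev J, ballot lev J U & (cnt lev U J).+1 == J])
     wt x U * 2 ^- (j - cnt lev U j)
  <= C * (expR 1 * th) ^+ J * (dec j * dec (J - j)).
Proof.
have [[X c] [/= X0 X1 c0 Hc]] := @pot_base R.
have e1 := @expR_gt0 R 1.
pose D : R := 4 * (1 - X)^-1 * 2.
have X10 : 0 < 1 - X by lra.
have D0 : 0 <= D by rewrite /D; nng.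
have [y0 y1] := y01.
have y10 : 0 < 1 - y by lra.
pose E : R := 4 * expR 1 * (1 - y) ^- 2 * c^-1.
have E0 : 0 <= E by rewrite /E; nng.
exists (1 + E * th^-1 * D); first by rewrite ltr_pwDl//; nng.
move=> T x lev J j x0 Hx jJ.
pose B := (2 * j.+1).+1.
have HB h : (h <= j)%N -> c * th ^+ h <= pot X B 0 h.
  by move=> hH; apply: Hc; rewrite ltnS leq_mul2l.
pose g k m : R := (if (k == 0%N) ==> (m == 0%N) then 1 else 0) *
   (if k == j then (if (m <= j)%N then 2 ^- m else 0) else 1).
have g0 k m : 0 <= g k m by rewrite /g; apply: mulr_ge0; do ?case: ifP => // _; nng.
have dj0 : 0 <= dec j :> R by exact/ltW/dec_gt0.
pose A : R := E * expR 1 ^+ j * dec j.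
have A0 : 0 <= A by rewrite /A; nng.
have pot0 l h : 0 <= pot X B l h by apply/pot_ge0/ltW.
have f0 := @fpw_ge0 R.
pose Psi l h : R := if (l < j)%N then th ^+ l * (th ^- h * fpw l.+1 h.+1)
   else A * th ^+ l * (th ^- h * pot X B (l - j) h).
have Psi0 l h : 0 <= Psi l h by rewrite /Psi; case: ifP => _; nng.
(* Gluing at level [j]: [fpw] grows by a factor [h + 1], [(h + 1) y^h] is bounded, and the remaining
   [th^h] is dominated by [pot] at [a = 0]. *)
have key h : (h <= j)%N -> 2 ^- h * fpw j.+1 h.+1 <= A * pot X B 0 h.
  move=> hj; apply: (@le_trans _ _ (A * (c * th ^+ h))); last by apply: ler_wpM2l => //; exact: HB.
  have := @fpw_le_dec R j 1 h.+1 isT; rewrite addn1 => h1.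
  apply: (@le_trans _ _ (2 ^- h * (4 * h.+1%:R * expR 1 ^+ j.+1 * dec j))).
    by apply: ler_wpM2l => //; nng.
  have h2 : h.+1%:R * y ^+ h <= (1 - y) ^- 2.
    apply: le_trans (sum_arith_geo h.+1 y0 y1); rewrite big_nat_recr//= lerDr.
    by apply: sumr_ge0 => i _; nng.
  rewrite [leLHS](_ : _ = 4 * expR 1 * expR 1 ^+ j * dec j * th ^+ h * (h.+1%:R * y ^+ h)); last first.
    rewrite /y exprVn exprMn invfM exprS; field.
    by rewrite !gt_eqF// exprn_gt0.
  rewrite [leRHS](_ : _ = 4 * expR 1 * expR 1 ^+ j * dec j * th ^+ h * (1 - y) ^- 2); last first.
    rewrite /A /E; field; rewrite gt_eqF//=; first by rewrite gt_eqF.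
  by apply: ler_wpM2l => //; nng.
have ker : \sum_(U : {set T} | U \subset below lev J) wt x U * walkval lev g U J 1 <= Psi J 1%N.
apply: (@kernel_upper _ _ x lev g Psi J th x0 g0 Hx Psi0 _ _ J 1%N (leqnn J)) => [h|l h N lJ].
- rewrite /g /Psi; case: posnP => [j0|j0].
    rewrite j0 eqxx /= expr0 mulr1 subnn leqn0.
    case: eqVneq => [->|_] /=; last by rewrite mul0r; nng.
    rewrite !expr0 !invr1 !mul1r.
    by have := key 0%N isT; rewrite j0 expr0 invr1 mul1r fpw11.
  rewrite (ltn_eqF j0) mulr1 expr0 mul1r eqxx /=; case: eqVneq => [->|_] /=; last by nng.
  by rewrite fpw11 expr0 invr1 mulr1.
- have stepf : \sum_(0 <= n < N | (0 < h + n)%N) th ^+ n / n`!%:R * (th ^+ l * (th ^- (h + n).-1 * fpw l.+1 (h + n).-1.+1))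
     <= th ^+ l.+1 * th ^- h * fpw l.+2 h.+1.
    apply: (@le_trans _ _ (\sum_(0 <= n < N | (0 < h + n)%N) th ^+ l.+1 * th ^- h * ((n`!%:R)^-1 * fpw l.+1 (h + n)))).
      apply: ler_sum => n hn; rewrite prednK//.
      rewrite [leLHS](_ : _ = n`!%:R^-1 * th ^+ l * (th ^+ n * (th ^- (h + n).-1 * fpw l.+1 (h + n)))); last by ring.
      by rewrite tilt_term// le_eqVlt; apply/orP; left; apply/eqP; rewrite [th ^+ l.+1]exprS; ring.
    by rewrite -mulr_sumr; apply: ler_wpM2l; [nng|exact: fpw_step].
  rewrite {1}/Psi; have [lj|jl] := ltnP l j; last first.
    have -> : g l.+1 h = 1 by rewrite /g /= (gtn_eqF (jl : (j < l.+1)%N)) mulr1.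
    rewrite /Psi ltnNge (leqW jl)/= subSn// mul1r.
    apply: (@le_trans _ _ (\sum_(0 <= n < N | (0 < h + n)%N) A * th ^+ l.+1 * th ^- h * ((n`!%:R)^-1 * pot X B (l - j) (h + n).-1))).
      apply: ler_sum => n hn.
      rewrite [leLHS](_ : _ = n`!%:R^-1 * (A * th ^+ l) * (th ^+ n * (th ^- (h + n).-1 * pot X B (l - j) (h + n).-1))); last by ring.
      by rewrite tilt_term// le_eqVlt; apply/orP; left; apply/eqP; rewrite [th ^+ l.+1]exprS; ring.
    by rewrite -mulr_sumr [leRHS]mulrA; apply: ler_wpM2l; [nng|exact/pot_step/ltW].
  rewrite /Psi; have [lj1|jl1] := ltnP l.+1 j.
    by rewrite /g /= (ltn_eqF lj1) mulr1 mul1r mulrA.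
  have je : j = l.+1 by apply/eqP; rewrite eqn_leq jl1 lj.
  rewrite /g -je eqxx subnn (_ : (j == 0%N) = false) ?je//= -je mul1r.
  case: leqP => hj; last by rewrite mul0r; nng.
  rewrite -je in stepf; apply: le_trans (ler_wpM2l _ stepf) _; first by nng.
  rewrite [leLHS](_ : _ = th ^+ j * th ^- h * (2 ^- h * fpw j.+1 h.+1)); last by ring.
  rewrite [leRHS](_ : _ = th ^+ j * th ^- h * (A * pot X B 0 h)); last by ring.
  by apply: ler_wpM2l; [nng|exact: key].
move: ker; rewrite /Psi ltnNge jJ /= => h; apply: (@le_trans _ _ (A * th ^+ J * (th ^- 1 * pot X B (J - j) 1))).
  apply: le_trans h; rewrite [leLHS]big_mkcondr; apply: ler_sum => U UJ.
  have w0 := wt_ge0 U x0.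
  case: ifP => [/andP[/ballotP HU /eqP cJ]|_]; last by rewrite mulr_ge0 ?walkval_ge0.
  pose H l := (l - cnt lev U l)%N.
  have e1H : 1%N = H J by rewrite /H; move: cJ; clear; lia.
  have -> : walkval lev g U J 1 = \prod_(0 <= k < J.+1) g k (H k).
    rewrite e1H walkval_path//.
    by move=> k kJ; rewrite /H; have := HU k.+1 kJ; have := HU k (ltnW kJ); rewrite cntS; clear; lia.
  suff -> : \prod_(0 <= k < J.+1) g k (H k) = 2 ^- (j - cnt lev U j) by [].
  rewrite (bigD1_seq j) ?iota_uniq ?mem_index_iota//= big1.
    rewrite mulr1 /g eqxx /H leq_subr.
    by case: (eqVneq j 0%N) => [->|_] /=; rewrite ?sub0n ?mul1r.
  by move=> k kj; rewrite /g /H (negbTE kj); case: eqVneq => [->|_] /=; rewrite mulr1.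
have hp := @pot_le R X B (J - j) 1 (ltW X0) X1.
apply: (@le_trans _ _ (A * th ^+ J * (th ^- 1 * (4 / (1 - X) * 2%:R * expR 1 ^+ (J - j) * dec (J - j))))).
  by apply: ler_wpM2l; [nng|apply: ler_wpM2l; [nng|]].
have dJj0 : 0 <= dec (J - j) :> R by exact/ltW/dec_gt0.
rewrite [leLHS](_ : _ = E * th^-1 * D * (expR 1 * th) ^+ J * (dec j * dec (J - j))); last first.
  rewrite /A /D exprMn -[in RHS](subnKC jJ) [expR 1 ^+ (j + _)]exprD (subnKC jJ) expr1; ring.
by do 2 (apply: ler_wpM2r; first by nng); rewrite lerDr.
Qed.

Lemma walkval_ballot (T : finType) (lev : T -> nat) (U : {set T}) l h
   (g := fun k m : nat => if (k == 0%N) ==> (m == 0%N) then 1 else 0 : R) :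
  walkval lev g U l h <= (if ballot lev l U && (h + cnt lev U l == l)%N then 1 else 0).
Proof.
elim: l h => [|l IH] h.
  rewrite /= /g /= cnt0 addn0; case: eqVneq => //= _.
    by rewrite (_ : ballot _ _ _) //; apply/ballotP => l; rewrite leqn0 => /eqP->; rewrite cnt0.
  by rewrite andbF.
rewrite [walkval _ _ _ _ _]/= /g /= mul1r -/g.
case E : (h + _)%N => [|m]; first by case: ifP.
apply: le_trans (IH m) _; case: ifP => [/andP[/ballotP HU /eqP e]|_]; last by case: ifP.
have e2 : (h + cnt lev U l.+1 = l.+1)%N by rewrite cntS addnCA E addnC addSn e.
rewrite e2 eqxx andbT (_ : ballot _ _ _)//; apply/ballotP => k.
rewrite leq_eqVlt => /predU1P[->|kl]; last exact: HU.
by rewrite -[leqRHS]e2 leq_addl.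
Qed.

Lemma prod_1sub_ge (eta : nat -> R) n : (forall k, (k < n)%N -> 0 <= eta k <= 1) ->
  1 - \sum_(0 <= k < n) eta k <= \prod_(0 <= k < n) (1 - eta k) <= 1.
Proof.
elim: n => [|n IH] H; first by rewrite !big_geq// subr0 lexx.
have /andP[h1 h2] := IH (fun k kn => H k (ltnW kn)).
have /andP[e0 e1] := H n (ltnSn n).
have S0 : 0 <= \sum_(0 <= k < n) eta k.
  by rewrite big_nat; apply: sumr_ge0 => k /andP[_ kn]; have /andP[] := H k (ltnW kn).
have p0 : 0 <= \prod_(0 <= k < n) (1 - eta k).
  by rewrite big_nat; apply: prodr_ge0 => k /andP[_ kn]; have /andP[] := H k (ltnW kn); rewrite subr_ge0.
rewrite !big_nat_recr//=; move: S0 p0 h1 h2.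
move: (\sum_(_ <= _ < _) _) (\prod_(_ <= _ < _) _) (eta n) e0 e1 => s p e e0 e1 s0 p0 h1 h2.
by apply/andP; split; nra.
Qed.

(** A ballot set has at most [l + 1] elements on level [l], so symmetric sums must match [th^n / n!]
    only in that range; the relative losses multiply to at least [1 - sum eta >= 1/2]. *)
Lemma ballot_lower (T : finType) (x : T -> R) (lev : T -> nat) J (eta : nat -> R) :
  (forall t, 0 <= x t) -> (forall l, (l < J)%N -> 0 <= eta l <= 1) ->
  \sum_(0 <= l < J) eta l <= 1 / 2 ->
  (forall l n, (l < J)%N -> (n <= l.+1)%N ->
     (1 - eta l) * (th ^+ n / n`!%:R) <= elsym x (level lev l) n) ->
  1 / 2 * th ^+ J * fpw J.+1 1 <=
  \sum_(U : {set T} | [&& U \subset below lev J, ballot lev J U & cnt lev U J == J]) wt x U.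
Proof.
move=> x0 Heta Hsum He.
pose g k m : R := if (k == 0%N) ==> (m == 0%N) then 1 else 0.
have g0 k m : 0 <= g k m by rewrite /g; case: ifP.
pose P l := \prod_(0 <= k < l) (1 - eta k).
pose Psi l h : R := P l * th ^+ l * (th ^- h * fpw l.+1 h.+1).
have f0 := @fpw_ge0 R.
have ker : Psi J 0%N <= \sum_(U : {set T} | U \subset below lev J) wt x U * walkval lev g U J 0.
apply: (@kernel_lower _ _ x lev g Psi J (fun l n => (1 - eta l) * (th ^+ n / n`!%:R)) (fun l => l.+2) x0 g0
   _ _ _ J 0%N (leqnn J)) => [l n lJ nl|h|l h lJ].
- rewrite He// andbT; have /andP[_ e1] := Heta l lJ.
  by apply: mulr_ge0; [rewrite subr_ge0|nng].
- rewrite /Psi /P big_geq// expr0 !mul1r /g /=; case: eqVneq => [->|h0].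
    by rewrite fpw11 expr0 invr1 mul1r.
  by rewrite [fpw _ _]fpw_gt ?mulr0// ltnS lt0n.
- rewrite /g /= mul1r /Psi fpwS !mulr_sumr [leRHS]big_mkcond.
  apply: ler_sum => n _; case: ifP => hn; last first.
    by move: hn; case: (h + n)%N => // _; rewrite /fpw /= !mulr0.
  rewrite prednK// /P big_nat_recr//= -/(P l).
  rewrite [leRHS](_ : _ = n`!%:R^-1 * (P l * (1 - eta l)) * th ^+ l * (th ^+ n * (th ^- (h + n).-1 * fpw l.+1 (h + n)))); last by ring.
  by rewrite tilt_term// le_eqVlt; apply/orP; left; apply/eqP; rewrite [th ^+ l.+1]exprS; ring.
move: ker; rewrite /Psi expr0 invr1 mul1r => h.
have /andP[hP _] := prod_1sub_ge Heta.
apply: (@le_trans _ _ (P J * th ^+ J * fpw J.+1 1)).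
  by do 2 (apply: ler_wpM2r; first by nng); rewrite /P; lra.
apply: le_trans h _; rewrite [leRHS]big_mkcondr; apply: ler_sum => U UJ.
have := walkval_ballot lev U J 0; rewrite add0n => h.
have w0 := wt_ge0 U x0.
apply: le_trans (ler_wpM2l w0 h) _.
by case: ifP => _; rewrite ?mulr1 ?mulr0.
Qed.

End WalkSums.

(** * Products of two bounded integers *)

Section PrimeSets.
Import mathcomp.boot.fintype mathcomp.boot.finset.
Context {R : realType}.

Definition pr (X : nat) (U : {set 'I_X}) : nat := (\prod_(t in U) (t : nat))%N.
Definition primeset X := [set t : 'I_X | prime t].
(** Zero off the primes, so that weighted sums over all subsets of ['I_X] see only squarefree
    integers. *)
Definition xinv (X : nat) (t : 'I_X) : R := if prime t then (t : nat)%:R^-1 else 0.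

Lemma xinv_ge0 X (t : 'I_X) : 0 <= xinv t.
Proof. by rewrite /xinv; case: ifP => // _; rewrite invr_ge0. Qed.

Lemma pr_gt0 X (U : {set 'I_X}) : U \subset primeset X -> (0 < pr U)%N.
Proof.
move=> /subsetP UP; rewrite /pr; apply: prodn_cond_gt0 => t tU.
by have := UP t tU; rewrite inE => /prime_gt0.
Qed.

Lemma prU X (U V : {set 'I_X}) : [disjoint U & V] -> pr (U :|: V) = (pr U * pr V)%N.
Proof. by move=> dUV; rewrite /pr -bigU//; apply: eq_bigl => t; rewrite !inE. Qed.

Lemma prU1 X (p : 'I_X) (U : {set 'I_X}) : p \notin U -> pr (p |: U) = (p * pr U)%N.
Proof. by move=> pU; rewrite /pr big_setU1. Qed.

Lemma pr0 X : pr (set0 : {set 'I_X}) = 1%N.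
Proof. by rewrite /pr big_set0. Qed.

Lemma prD X (U V : {set 'I_X}) : V \subset U -> pr U = (pr V * pr (U :\: V))%N.
Proof.
move=> VU; rewrite -prU; last first.
  by rewrite -setI_eq0; apply/eqP/setP => t; rewrite !inE; case: (t \in V).
by rewrite setDE setUIr setUCr setIT (setUidPr VU).
Qed.

Lemma wt_pr X (U : {set 'I_X}) : U \subset primeset X -> wt (@xinv X) U = (pr U)%:R^-1.
Proof.
move=> /subsetP UP; rewrite /wt /pr natr_prod -prodfV; apply: eq_bigr => t tU.
by have := UP t tU; rewrite inE /xinv => ->.
Qed.

Lemma square_part X A : (0 < A)%N -> (A < X)%N ->
  exists al (S : {set 'I_X}), S \subset primeset X /\ A = (al ^ 2 * pr S)%N.
Proof.
have [n] := ubnP A; elim: n A => // n IH A An A0 AX.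
have [A1|A1] := leqP A 1.
  exists 1%N, set0; split; first exact: sub0set.
  by rewrite pr0; apply/eqP; rewrite eqn_leq A1.
have pp := pdiv_prime A1; set p := pdiv A in pp.
have pA : (A %/ p * p = A)%N by rewrite divnK// pdiv_dvd.
set A' := (A %/ p)%N in pA.
have A'0 : (0 < A')%N by rewrite lt0n; apply/eqP => h; move: pA; rewrite h; lia.
have A'A : (A' < A)%N by rewrite -pA ltn_Pmulr// prime_gt1.
have [al [S [SP e]]] := IH A' (leq_trans A'A An) A'0 (ltn_trans A'A AX).
have pX : (p < X)%N by apply: leq_ltn_trans AX; rewrite dvdn_leq// pdiv_dvd.
pose p' := Ordinal pX.
have [pS|pS] := boolP (p' \in S).
  exists (al * p)%N, (S :\ p'); split; first by apply: subset_trans SP; exact: subD1set.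
  by rewrite -pA e -{1}(setD1K pS) prU1 ?setD11//= expnMn; ring.
exists al, (p' |: S); split; first by rewrite subUset sub1set SP andbT inE.
by rewrite prU1//= -pA e; ring.
Qed.

Definition isprod N z := [exists A : 'I_N.+1, exists B : 'I_N.+1,
  [&& (0 < A)%N, (0 < B)%N & z == (A * B)%N]].

(* [U] splits as [D] and its complement with [a * pr D] and [b * pr (U :\: D)] both
   at most [N]; here [a = al^2 g] and [b = be^2 g] collect the non-squarefree parts. *)
Definition hasdiv X (a b N : nat) (U : {set 'I_X}) :=
  [exists D : {set 'I_X}, [&& D \subset U, (a * pr D <= N)%N & (b * pr (U :\: D) <= N)%N]].

(** Write the factors as [al^2 pr S] and [be^2 pr S'], and let [G] be the intersection of [S] and
    [S'], [g = pr G]. Up to the square, [z] is the product over the symmetric difference, whose part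
    in [S] is the [D] of [hasdiv]. *)
Lemma isprod_tuple X N z : (0 < N)%N -> (N < X)%N -> isprod N z ->
  exists al be g (U : {set 'I_X}),
  [/\ (0 < al <= N)%N, (0 < be <= N)%N, (0 < g <= N)%N, U \subset primeset X &
   hasdiv (al ^ 2 * g) (be ^ 2 * g) N U /\ z = ((al * be * g) ^ 2 * pr U)%N].
Proof.
move=> N0 NX /existsP[A /existsP[B /and3P[A0 B0 /eqP ->]]].
have AN := ltn_ord A; have BN := ltn_ord B; rewrite !ltnS in AN BN.
have [al [S [SP eA]]] := square_part A0 (leq_ltn_trans AN NX).
have [be [S' [SP' eB]]] := square_part B0 (leq_ltn_trans BN NX).
pose G := S :&: S'; pose D := S :\: G; pose D' := S' :\: G.
have GP : G \subset primeset X by apply: subset_trans SP; exact: subsetIl.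
have eS : pr S = (pr G * pr D)%N by rewrite -prD// subsetIl.
have eS' : pr S' = (pr G * pr D')%N by rewrite -prD// subsetIr.
have dDD : [disjoint D & D'].
  rewrite -setI_eq0; apply/eqP/setP => t; rewrite !inE.
  by case: (t \in S); case: (t \in S').
have DP : D \subset primeset X by apply: subset_trans SP; exact: subsetDl.
have DP' : D' \subset primeset X by apply: subset_trans SP'; exact: subsetDl.
have [g0 d0 d0'] := And3 (pr_gt0 GP) (pr_gt0 DP) (pr_gt0 DP').
have al0 : (0 < al)%N by rewrite lt0n; apply/eqP => h; move: A0; rewrite eA h.
have be0 : (0 < be)%N by rewrite lt0n; apply/eqP => h; move: B0; rewrite eB h.
have aleA : (al ^ 2 * pr G * pr D = A)%N by rewrite eA eS mulnA.
have beB : (be ^ 2 * pr G * pr D' = B)%N by rewrite eB eS' mulnA.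
have le1 (m k l : nat) : (0 < k)%N -> (0 < l)%N -> (m <= m * k * l)%N.
  by move=> k0 l0; rewrite -mulnA leq_pmulr// muln_gt0 k0.
exists al, be, (pr G), (D :|: D'); split.
- rewrite al0/=; apply: leq_trans AN; rewrite -aleA.
  apply: leq_trans (le1 _ _ _ g0 d0); by rewrite -mulnn leq_pmull.
- rewrite be0/=; apply: leq_trans BN; rewrite -beB.
  apply: leq_trans (le1 _ _ _ g0 d0'); by rewrite -mulnn leq_pmull.
- rewrite g0/=; apply: leq_trans AN; rewrite -aleA mulnAC leq_pmull// muln_gt0 expn_gt0 al0//.
- by rewrite subUset DP.
split; last by rewrite prU// -aleA -beB !expnMn; ring.
apply/existsP; exists D; rewrite subsetUl aleA AN /=.
have -> : (D :|: D') :\: D = D'.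
  apply/setP => t; rewrite !inE; move/setP: (disjoint_setI0 dDD) => /(_ t); rewrite !inE.
  by case: (t \in S); case: (t \in S').
by rewrite beB BN.
Qed.

Lemma isprod_count X Y N : (0 < N)%N -> (N < Y)%N -> (N * N < X)%N ->
  #|[set z : 'I_X | isprod N z]|%:R <=
  \sum_(al : 'I_Y | (0 < al)%N) \sum_(be : 'I_Y | (0 < be)%N) \sum_(g : 'I_Y | (0 < g)%N)
   \sum_(U : {set 'I_X} | U \subset primeset X)
     (if hasdiv (al ^ 2 * g) (be ^ 2 * g) N U then 1 else 0) :> R.
Proof.
move=> N0 NY NX.
have X0 : (0 < X)%N by apply: leq_trans NX.
have NX' : (N < X)%N by apply: leq_ltn_trans NX; rewrite leq_pmulr.
pose f (t : 'I_Y * 'I_Y * 'I_Y * {set 'I_X}) : 'I_X :=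
  insubd (Ordinal X0) ((t.1.1.1 * t.1.1.2 * t.1.2) ^ 2 * pr t.2)%N.
pose P (t : 'I_Y * 'I_Y * 'I_Y * {set 'I_X}) :=
  [&& (0 < t.1.1.1)%N, (0 < t.1.1.2)%N, (0 < t.1.2)%N, t.2 \subset primeset X &
   hasdiv (t.1.1.1 ^ 2 * t.1.2) (t.1.1.2 ^ 2 * t.1.2) N t.2].
have sub : [set z : 'I_X | isprod N z] \subset f @: [set t | P t].
  apply/subsetP => z; rewrite inE => /(isprod_tuple N0 NX')[al [be [g [U [/andP[a0 aN] /andP[b0 bN] /andP[g0 gN] UP [hd e]]]]]].
  apply/imsetP; exists (Ordinal (leq_ltn_trans aN NY), Ordinal (leq_ltn_trans bN NY), Ordinal (leq_ltn_trans gN NY), U).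
    by rewrite inE /P /= a0 b0 g0 UP hd.
  by apply/val_inj; rewrite /f /= val_insubd /= -e ltn_ord.
apply: (@le_trans _ _ #|[set t | P t]|%:R).
  by rewrite ler_nat; apply: leq_trans (subset_leq_card sub) (leq_imset_card _ _).
rewrite -sum1_card natr_sum.
rewrite pair_big/= pair_big/= pair_big/= big_mkcond [leRHS]big_mkcond /=.
apply: ler_sum => -[[[al be] g] U] _ /=; rewrite inE /P /=.
by case: (0 < al)%N; case: (0 < be)%N; case: (0 < g)%N; case: (U \subset _) => //=; case: ifP.
Qed.

(* Splits off the largest prime, whose position is then constrained by [hasdiv]. *)
Lemma sum_extract_max X (F : {set 'I_X} -> R) : (forall U, 0 <= F U) ->
  \sum_(U : {set 'I_X} | U \subset primeset X) F U <=
  F set0 + \sum_(V : {set 'I_X} | V \subset primeset X)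
     \sum_(p : 'I_X | prime p && [forall v in V, (v < p)%N]) F (p |: V).
Proof.
move=> F0; rewrite (bigD1 set0) ?sub0set//= lerD2l.
rewrite pair_big_dep /=.
have [X0|X0] := posnP X.
  rewrite big1 ?sumr_ge0// => U /andP[_ /set0Pn[t]].
  by have := ltn_ord t; rewrite {2}X0.
pose mx (U : {set 'I_X}) : 'I_X := [arg max_(t > Ordinal X0 in U) (t : nat)].
pose h (U : {set 'I_X}) := (U :\ mx U, mx U).
have mxP (U : {set 'I_X}) : U != set0 -> mx U \in U /\ forall t, t \in U -> (t <= mx U)%N.
  case/set0Pn => u uU; rewrite /mx.
  have [w wU] : exists2 w, w \in U & [arg max_(t > Ordinal X0 in U) (t : nat)] = [arg max_(t > w in U) (t : nat)].
    exists u => //; rewrite /arg_max /extremum /=.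
    case: pickP => [//|/(_ [arg max_(t > u in U) (t : nat)])].
    case: arg_maxnP => //= i iU imax /negP[]; rewrite iU /=.
    by apply/forallP => j; apply/implyP => jU; apply: imax.
  by move=> ->; case: arg_maxnP => // i iU imax; split => // t tU; exact: imax.
pose P1 := [set U : {set 'I_X} | (U \subset primeset X) && (U != set0)].
have hinj : {in P1 &, injective h}.
  move=> U V; rewrite !inE => /andP[_ U0] /andP[_ V0] [e1 e2].
  have [m1 _] := mxP U U0; have [m2 _] := mxP V V0.
  by rewrite -(setD1K m1) -(setD1K m2) e1 e2.
rewrite (eq_bigl (mem P1)); last by move=> U; rewrite !inE.
rewrite (eq_bigr (fun U => F ((h U).2 |: (h U).1))); last first.
  move=> U U1; have : U \in P1 by [].
  by rewrite inE => /andP[_ U0] /=; have [m1 _] := mxP U U0; rewrite setD1K.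
rewrite -(big_imset (fun t : {set 'I_X} * 'I_X => F (t.2 |: t.1)) hinj) /=.
rewrite big_mkcond [leRHS]big_mkcond; apply: ler_sum => -[V p] _ /=.
case: ifP => [/imsetP[U]|_]; last by case: ifP.
rewrite inE => /andP[UP U0] [-> ->]; have [m1 m2] := mxP U U0.
rewrite (subset_trans (subD1set _ _) UP) /=.
have := subsetP UP _ m1; rewrite inE => -> /=.
rewrite (_ : [forall v in _, _])//.
apply/forallP => v; apply/implyP; rewrite !inE => /andP[vm vU].
by rewrite ltn_neqAle vm m2.
Qed.

(** For the least admissible [k] the tail is at most [(4/3) 4^-k], and admissibility gives
    [4^-k <= 4 s]; [16/3 <= 6]. *)
Lemma geom4_sum (cond : pred nat) n (s : R) :
  (forall k, cond k -> 1 <= 4 ^+ k.+1 * s) -> 0 <= s ->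
  \sum_(0 <= k < n) (if cond k then 4 ^- k else 0) <= 6 * s.
Proof.
move=> H s0.
have [/existsP[i ci]|/existsPn none] := boolP [exists i : 'I_n, cond i]; last first.
  rewrite big_mkord big1; first by nng.
  by move=> i _; rewrite (negbTE (none i)).
have [k0 c0 kmin] := ex_minnP (ex_intro (fun k => cond k) (nat_of_ord i) ci).
apply: (@le_trans _ _ (4 / 3 * 4 ^- k0)); last first.
  have := H k0 c0; rewrite exprS => h1.
  have p0 : 0 < 4 ^+ k0 :> R by rewrite exprn_gt0.
  rewrite ler_pdivrMr//; move: h1; move: (4 ^+ k0) p0 => u u0 h1; nra.
apply: (@le_trans _ _ (\sum_(0 <= k < n) (if (k0 <= k)%N then 4 ^- k else 0))).
  apply: ler_sum => k _; case: ifP => [/kmin ->//|_]; case: ifP => // _; nng.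
suff : \sum_(0 <= k < n) (if (k0 <= k)%N then 4 ^- k else 0) <= 4 / 3 * 4 ^- k0 - (if (k0 < n)%N then 4 / 3 * 4 ^- n else 0) :> R.
  move=> h; apply: le_trans h _; rewrite lerBlDr lerDl; case: ifP => // _; nng.
elim: n {i ci} => [|n IH]; first by rewrite big_geq// ltn0 subr0; nng.
rewrite big_nat_recr//=.
have e : 4 ^- n = 4 * 4 ^- n.+1 :> R.
  by rewrite exprS invfM mulrA mulfV ?mul1r// pnatr_eq0.
case: ltngtP IH => [h|h|h] IH.
- rewrite ltnS (ltnW h); move: IH; rewrite e.
  move: (\sum_(_ <= _ < _) _) (4 ^- n.+1) (4 ^- k0) => a b c; lra.
- rewrite ltnS leqNgt h /= !addr0; by move: IH; rewrite ?subr0.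
- rewrite h ltnS leqnn; move: IH; rewrite subr0 -h => IH.
  have -> : \sum_(0 <= i < k0) (if (k0 <= i)%N then 4 ^- i else 0) = 0 :> R.
    by rewrite big_nat big1// => i /andP[_ ik]; rewrite leqNgt ik.
  rewrite add0r h e; move: (4 ^- n.+1) => b; lra.
Qed.

(** The choice of [D] inside [W] is given up: it moves the two products by a factor at most [pr W].
    So only [2^#|V :\: W|] choices are enumerated, and [pr W] becomes the width of the kernel of
    [sum_primes_kernel], centred at [gb / ga]. The freedom of [W] later yields one bound per
    level. *)
Lemma kernel_primes : exists2 C : R, 0 < C & forall X n (a b : nat) (V : {set 'I_X}) (W : {set 'I_X}) (L : R),
  (0 < a)%N -> (0 < b)%N -> V \subset primeset X -> W \subset V -> 0 < L ->
  (forall p, prime p -> [forall v in V, (v < p)%N] -> L <= ln p%:R) ->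
  \sum_(p : 'I_X | prime p && [forall v in V, (v < p)%N])
    \sum_(0 <= k < n) (if hasdiv (a * p) b (2 ^ k.+1) V then 4 ^- k else 0)
  <= C * 2 ^+ #|V :\: W| * (1 + ln (pr W)%:R) / L / (a * b * pr V)%:R.
Proof.
have [C C0 HC] := @sum_primes_kernel R.
exists (6 * C); first by rewrite mulr_gt0.
move=> X n a b V W L a0 b0 VP WV L0 HL.
have WP := subset_trans WV VP.
have HWP : V :\: W \subset primeset X by apply: subset_trans VP; exact: subsetDl.
have v0 : 0 < (pr V)%:R :> R by rewrite ltr0n pr_gt0.
have w0 : 0 < (pr W)%:R :> R by rewrite ltr0n pr_gt0.
have w1 : 1 <= (pr W)%:R :> R by rewrite ler1n pr_gt0.
have a0' : 0 < a%:R :> R by rewrite ltr0n.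
have b0' : 0 < b%:R :> R by rewrite ltr0n.
pose ga (D : {set 'I_X}) : R := a%:R * (pr D)%:R.
pose gb (D : {set 'I_X}) : R := b%:R * (pr (V :\: W :\: D))%:R.
have gg (D : {set 'I_X}) : D \subset V :\: W -> [/\ 0 < ga D, 0 < gb D & ga D * gb D * (pr W)%:R = (a * b * pr V)%:R].
  move=> DV; split.
  - by rewrite mulr_gt0// ltr0n pr_gt0// (subset_trans DV).
  - by rewrite mulr_gt0// ltr0n pr_gt0//; apply: subset_trans HWP; exact: subsetDl.
  - by rewrite (prD WV) (prD DV) !natrM /ga /gb; ring.
pose w (D : {set 'I_X}) (p : nat) : R := Num.min 1 (Num.min ((pr W)%:R * (gb D / ga D) / p%:R) ((pr W)%:R * p%:R / (gb D / ga D))).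
have step (p : 'I_X) : prime p -> [forall v in V, (v < p)%N] ->
    \sum_(0 <= k < n) (if hasdiv (a * p) b (2 ^ k.+1) V then 4 ^- k else 0) <=
    \sum_(D : {set 'I_X} | D \subset V :\: W) 6 * ((p : nat)%:R^-1 * w D p / (a * b * pr V)%:R).
  move=> pp pV; have p0 : 0 < (p : nat)%:R :> R by rewrite ltr0n prime_gt0.
  (* The three conditions bound [4^-k] in three ways, one for each argument of the minimum in
     [w]. *)
  pose cnd D k := [&& ga D * (p : nat)%:R <= 2 ^+ k.+1, gb D <= 2 ^+ k.+1 & ga D * gb D * (p : nat)%:R * (pr W)%:R <= 4 ^+ k.+1].
  apply: (@le_trans _ _ (\sum_(0 <= k < n) \sum_(D : {set 'I_X} | D \subset V :\: W) (if cnd D k then 4 ^- k else 0))).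
    apply: ler_sum => k _; case: ifP => [/existsP[D /and3P[DV h1 h2]]|_]; last first.
      by apply: sumr_ge0 => D _; case: ifP => // _; nng.
    have DWV : D :\: W \subset V :\: W by rewrite setSD.
    have pD : (0 < pr D)%N by rewrite pr_gt0// (subset_trans DV).
    have dvd1 : (pr (D :\: W) <= pr D)%N.
      rewrite (prD (subsetDl D W)) leq_pmulr// pr_gt0//.
      by apply: subset_trans (subset_trans DV VP); exact: subsetDl.
    have DV' : V :\: W :\: (D :\: W) \subset V :\: D.
      by apply/subsetP => t; rewrite !inE; case: (t \in W); case: (t \in D).
    have dvd2 : (pr (V :\: W :\: (D :\: W)) <= pr (V :\: D))%N.
      rewrite (prD DV') leq_pmulr// pr_gt0//.
      by apply: subset_trans VP; apply: subset_trans (subsetDl _ _) (subsetDl _ _).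
    rewrite (bigD1 (D :\: W))//= (_ : cnd _ _).
      by rewrite lerDl; apply: sumr_ge0 => i _; case: ifP => // _; nng.
    have e2 : 2 ^+ k.+1 = (2 ^ k.+1)%N%:R :> R by rewrite natrX.
    apply/and3P; split.
    - rewrite e2 /ga -!natrM ler_nat; apply: leq_trans h1.
      by rewrite mulnAC leq_mul2l dvd1 orbT.
    - by rewrite e2 /gb -natrM ler_nat; apply: leq_trans h2; rewrite leq_mul2l dvd2 orbT.
    - have [_ _ e3] := gg _ DWV.
      rewrite mulrAC e3 -natrM (prD DV) (_ : 4 = 2 * 2)%R; last by rewrite -natrM.
      rewrite exprMn e2 -natrM ler_nat.
      apply: leq_trans (leq_mul h1 h2).
      by rewrite leq_eqVlt; apply/orP; left; apply/eqP; ring.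
  rewrite exchange_big /=; apply: ler_sum => D DV.
  have [ga0 gb0 gE] := gg D DV.
  have e4 k : 4 ^+ k = 2 ^+ k * 2 ^+ k :> R by rewrite -exprMn; congr (_ ^+ _); ring.
  apply: geom4_sum => [k /and3P[h1 h2 h3]|]; last first.
    rewrite /w; apply: mulr_ge0; last by nng.
    apply: mulr_ge0; first by nng.
    by rewrite !le_min ler01 /=; apply/andP; split; nng.
  have q0 : 0 < (a * b * pr V)%:R :> R by rewrite ltr0n !muln_gt0 a0 b0 pr_gt0.
  rewrite /w.
  have Pmin (s t : R) : (1 <= 4 ^+ k.+1 * ((p : nat)%:R^-1 * s / (a * b * pr V)%:R)) ->
     (1 <= 4 ^+ k.+1 * ((p : nat)%:R^-1 * t / (a * b * pr V)%:R)) ->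
     1 <= 4 ^+ k.+1 * ((p : nat)%:R^-1 * Num.min s t / (a * b * pr V)%:R).
    by case: (leP s t).
  have sq (u v : R) : 0 < u -> u <= v -> 1 <= v * v * (u * u)^-1.
    move=> u0 uv; rewrite ler_pdivlMr ?mulr_gt0// mul1r.
    by apply: ler_pM => //; exact: ltW.
  rewrite -gE; rewrite -gE in Pmin.
  have pga0 : 0 < ga D * (p : nat)%:R by rewrite mulr_gt0.
  apply: (Pmin); last apply: Pmin.
  - have q1 : 0 < (p : nat)%:R * (ga D * gb D * (pr W)%:R) by rewrite mulr_gt0// gE.
    rewrite mulr1 -invfM ler_pdivlMr// mul1r; apply: le_trans h3.
    by rewrite le_eqVlt; apply/orP; left; apply/eqP; ring.
  - have := sq _ _ pga0 h1; rewrite -e4; congr (_ <= _ * _); field.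
    by rewrite !gt_eqF.
  - have := sq _ _ gb0 h2; rewrite -e4; congr (_ <= _ * _); field.
    by rewrite !gt_eqF.
have Q0 : 0 < (a * b * pr V)%:R :> R by rewrite ltr0n !muln_gt0 a0 b0 pr_gt0.
apply: (@le_trans _ _ (\sum_(p : 'I_X | prime p && [forall v in V, (v < p)%N])
   \sum_(D : {set 'I_X} | D \subset V :\: W) 6 * ((p : nat)%:R^-1 * w D p / (a * b * pr V)%:R))).
  by apply: ler_sum => p /andP[pp pV]; exact: step.
rewrite exchange_big /=.
apply: (@le_trans _ _ (\sum_(D : {set 'I_X} | D \subset V :\: W) 6 * (C * (1 + ln (pr W)%:R) / L) / (a * b * pr V)%:R)).
  apply: ler_sum => D DV; have [ga0 gb0 gE] := gg D DV.
  rewrite -mulr_sumr -mulr_suml mulrA; apply: ler_wpM2r; first by nng.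
  apply: ler_wpM2l => //.
  have := HC X (fun p => [forall v in V, (v < p)%N]) L (pr W)%:R (gb D / ga D) L0 w1 (divr_gt0 gb0 ga0) HL.
  by rewrite big_mkord.
rewrite sumr_const.
have -> : #|[pred D : {set 'I_X} | D \subset V :\: W]| = (2 ^ #|V :\: W|)%N.
  by rewrite -card_powerset; apply: eq_card => D; rewrite !inE.
rewrite -[leLHS]mulr_natl natrX le_eqVlt; apply/orP; left; apply/eqP.
by ring.
Qed.

(** The last term dominates. With [rho^-1 = s^2] and [m = n - t], [dec t] exceeds [dec n] by at most
    [(m + 1)^2]; one [(m + 1) s^m] is bounded and the other is summed. *)
Lemma sum_rho_dec (rho : R) : 1 < rho -> exists2 C : R, 0 < C & forall n,
  \sum_(0 <= t < n.+1) rho ^+ t * dec t <= C * (rho ^+ n * dec n).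
Proof.
move=> r1; have r0 : 0 < rho by lra.
pose y := rho^-1; have y0 : 0 < y by rewrite invr_gt0.
have y1 : y < 1 by rewrite invf_lt1.
pose s := Num.sqrt y; have s0 : 0 < s by rewrite sqrtr_gt0.
have ss : s ^+ 2 = y by rewrite sqr_sqrtr// ltW.
have s1 : s < 1 by move: ss; rewrite expr2; nra.
have s10 : 0 < 1 - s by lra.
exists ((1 - s)^-1 * (1 - s) ^- 2); first by rewrite mulr_gt0 ?invr_gt0// exprn_gt0.
move=> n.
have d0 : 0 < dec n :> R by exact: dec_gt0.
have rn0 : 0 < rho ^+ n by rewrite exprn_gt0.
have key t : (t <= n)%N -> rho ^+ t * dec t <= rho ^+ n * dec n * ((1 - s)^-1 * ((n - t).+1%:R * s ^+ (n - t))).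
  move=> tn; set m := (n - t)%N.
  have h1 : dec t <= m.+1%:R ^+ 2 * dec n :> R.
    rewrite /dec -[m.+1%:R ^+ 2]invrK -invfM lef_pV2 ?posrE ?mulr_gt0 ?sqrtr_gt0 ?invr_gt0 ?exprn_gt0//.
    rewrite mulrC ler_pdivrMr ?exprn_gt0// expr2 mulrACA.
    have h2 : n.+1%:R <= t.+1%:R * m.+1%:R :> R.
      by rewrite -natrM ler_nat /m; move: tn; clear; nia.
    apply: ler_pM => //.
    apply: (@le_trans _ _ (Num.sqrt (t.+1%:R * m.+1%:R))); first by rewrite ler_wsqrtr.
    rewrite sqrtrM//; apply: ler_wpM2l; first by rewrite sqrtr_ge0.
    rewrite -[leRHS]ger0_norm// -sqrtr_sqr ler_wsqrtr// expr2 ler_peMr//.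
    by rewrite ler1n.
  have h3 : m.+1%:R * s ^+ m <= (1 - s)^-1.
    apply: le_trans (sum_geo_le m.+1 (ltW s0) s1).
    have -> : m.+1%:R * s ^+ m = \sum_(0 <= b < m.+1) s ^+ m by rewrite sumr_const_nat subn0 mulr_natl.
    rewrite big_nat [leRHS]big_nat; apply: ler_sum => b /andP[_ bm].
    by apply: ler_wiXn2l => //; exact: ltW.
  have e : rho ^+ t = rho ^+ n * (s ^+ m * s ^+ m).
    rewrite -exprMn -expr2 ss /y exprVn -[in RHS](subnKC tn) exprD -/m mulfK//.
    by rewrite expf_neq0// gt_eqF.
  rewrite e.
  apply: (@le_trans _ _ (rho ^+ n * (s ^+ m * s ^+ m) * (m.+1%:R ^+ 2 * dec n))).
    by apply: ler_wpM2l => //; nng.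
  rewrite [leLHS](_ : _ = rho ^+ n * dec n * ((m.+1%:R * s ^+ m) * (m.+1%:R * s ^+ m))); last by ring.
  apply: ler_wpM2l; first by nng.
  by apply: ler_wpM2r => //; nng.
apply: (@le_trans _ _ (\sum_(0 <= t < n.+1) rho ^+ n * dec n * ((1 - s)^-1 * ((n - t).+1%:R * s ^+ (n - t))))).
  by rewrite big_nat [leRHS]big_nat; apply: ler_sum => t /andP[_ tn]; exact: key.
rewrite -mulr_sumr mulrC; apply: ler_wpM2r; first by nng.
rewrite -mulr_sumr; apply: ler_wpM2l; first by nng.
rewrite big_nat_rev /= add0n big_nat.
apply: le_trans (sum_arith_geo n.+1 (ltW s0) s1).
rewrite [leRHS]big_nat; apply: ler_sum => t /andP[_ tn].
have -> : (n - (n.+1 - t.+1) = t)%N by move: tn; clear; lia.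
exact: lexx.
Qed.

Lemma sum_inv_sq Y : \sum_(a : 'I_Y | (0 < a)%N) ((a : nat)%:R ^+ 2)^-1 <= 2 :> R.
Proof.
have -> : \sum_(a : 'I_Y | (0 < a)%N) ((a : nat)%:R ^+ 2)^-1 = \sum_(0 <= a < Y | (0 < a)%N) (a%:R ^+ 2)^-1 :> R.
  by rewrite big_mkord.
case: Y => [|[|Y]]; first by rewrite big_geq.
  by rewrite big_mkcond big_nat1.
rewrite big_ltn_cond//=.
suff : \sum_(1 <= i < Y.+2 | (0 < i)%N) (i%:R ^+ 2)^-1 <= 2 - Y.+1%:R^-1 :> R.
  have : 0 <= Y.+1%:R^-1 :> R by [].
  by move: (Y.+1%:R^-1) (\sum_(_ <= _ < _ | _) _) => u v; lra.
elim: Y => [|Y IH]; first by rewrite big_mkcond big_nat1/= expr1n invr1; lra.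
rewrite big_mkcond big_nat_recr//= -big_mkcond.
suff : (Y.+2%:R ^+ 2)^-1 <= Y.+1%:R^-1 - Y.+2%:R^-1 :> R.
  move: IH; set a := bigop.body _ _ _; move: a (Y.+2%:R ^- 2) (Y.+2%:R^-1) (Y.+1%:R^-1) => a w u v; lra.
have -> : Y.+1%:R^-1 - Y.+2%:R^-1 = (Y.+1%:R * Y.+2%:R)^-1 :> R.
  rewrite -(natr1 Y.+1); field.
  by have := ler0n R Y; move: (Y%:R) => y y0; rewrite !gt_eqF//; lra.
by rewrite lef_pV2 ?posrE ?mulr_gt0 ?exprn_gt0// expr2 ler_pM2r// ler_nat.
Qed.

End PrimeSets.

(** * Averaged upper bound for the multiplication table *)

Section ProductCount.
Import mathcomp.boot.fintype mathcomp.boot.finset.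
Context {R : realType}.
Notation rho := (expR 1 * ln 2 : R).

Definition blev (X : nat) (t : 'I_X) : nat := @blk R t.

Lemma rho_gt1 : 1 < rho.
Proof.
have h1 := @expR1_gt2 R; have h2 := @ln2_gt R.
by move: (expR 1) (ln 2) h1 h2 => u v h1 h2; nra.
Qed.

Lemma level_xinv_le X l : \sum_(t in level (@blev X) l) xinv t <= ln 2 :> R.
Proof.
have [X0|X0] := posnP X.
  rewrite big1; first by have := @ln2_gt R; lra.
  by move=> t; have := ltn_ord t; rewrite {2}X0.
apply: le_trans (@blksum_le R X.-1 l); rewrite /blksum prednK// big_mkord.
rewrite big_mkcond [leRHS]big_mkcond; apply: ler_sum => t _ /=.
by rewrite inE /blev /xinv; case: (blk t == l); case: (prime t).
Qed.

Lemma ln_pr X (U : {set 'I_X}) : U \subset primeset X ->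
  ln (pr U)%:R = \sum_(r in U) ln (r : nat)%:R :> R.
Proof.
move=> /subsetP UP; rewrite /pr natr_prod.
have : forall r, r \in U -> 0 < (r : nat)%:R :> R.
  by move=> r /UP; rewrite inE ltr0n => /prime_gt0.
rewrite -2!big_enum /=.
have : forall r, r \in enum U -> r \in U by move=> r; rewrite mem_enum.
elim: (enum U) => [|a s IH] su u0; first by rewrite !big_nil ln1.
rewrite !big_cons lnM ?posrE ?IH//.
- by move=> r rs; apply: su; rewrite inE rs orbT.
- by apply: u0; apply: su; rewrite inE eqxx.
- rewrite big_seq; apply: prodr_gt0 => r rs; apply: u0; apply: su; rewrite inE rs orbT//.
Qed.

Lemma sum_by_top X (G : {set 'I_X} -> R) B : (forall t : 'I_X, (blev t <= B)%N) ->
  \sum_(V : {set 'I_X} | V \subset primeset X) G V =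
  \sum_(0 <= t < B.+1) \sum_(V : {set 'I_X} | (V \subset primeset X) && (\max_(v in V) blev v == t)%N) G V.
Proof.
move=> HB; rewrite big_mkord (partition_big (fun V : {set 'I_X} => inord (\max_(v in V) blev v) : 'I_B.+1) predT)//=.
apply: eq_bigr => t _; apply: eq_bigl => V; case: (_ \subset _) => //=.
rewrite -val_eqE /= inordK// ltnS; apply/bigmax_leqP => v _; exact: HB.
Qed.

Lemma hasdiv_sym X a b N (V : {set 'I_X}) : hasdiv a b N V = hasdiv b a N V.
Proof.
by apply/existsP/existsP => -[D /and3P[DV h1 h2]]; exists (V :\: D);
  rewrite subsetDl h2 /= setDDr setDv set0U (setIidPr DV) h1.
Qed.

Lemma hasdiv_setU1 X a b N (p : 'I_X) (V : {set 'I_X}) : p \notin V ->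
  hasdiv a b N (p |: V) -> hasdiv (a * p) b N V || hasdiv (b * p) a N V.
Proof.
move=> pV /existsP[D /and3P[DV h1 h2]].
have [pD|pD] := boolP (p \in D).
  apply/orP; left; apply/existsP; exists (D :\ p); apply/and3P; split.
  - by rewrite subDset.
  - by rewrite -mulnA -prU1 ?setD11// setD1K.
  - rewrite (_ : V :\: (D :\ p) = (p |: V) :\: D)//.
    apply/setP => t; rewrite !inE; case: eqP => [->|] /=; last by case: (t \in D).
    by rewrite pD (negbTE pV).
rewrite [X in _ || X]hasdiv_sym; apply/orP; right; apply/existsP; exists D; apply/and3P; split => //.
- apply/subsetP => t tD; have := subsetP DV t tD; rewrite !inE; case: eqP => // tp.
  by rewrite -tp tD in pD.
- rewrite -mulnA -prU1; last by rewrite inE (negbTE pV) andbF.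
  rewrite (_ : p |: V :\: D = (p |: V) :\: D)//.
  by apply/setP => t; rewrite !inE; case: eqP => [->|] //=; rewrite pD.
Qed.

(** Split off the largest prime [p] and group the rest [V] by its top block [t], so that
    [ln p >= c1 2^t]. Taking for [W] the part of [V] below level [j], [kernel_primes] supplies
    exactly the family of bounds that [walk_min_upper] minimises over [j]. *)
Lemma hasdiv_sum_le : exists2 C : R, 0 < C & forall X n (a b B : nat),
  (0 < a)%N -> (0 < b)%N -> (forall t : 'I_X, (blev t <= B)%N) ->
  \sum_(U : {set 'I_X} | U \subset primeset X)
    \sum_(0 <= k < n) (if hasdiv a b (2 ^ k.+1) U then 4 ^- k else 0) <=
  C * (a * b)%:R^-1 * \sum_(0 <= t < B.+1) rho ^+ t * dec t.
Proof.
have [K K0 HK] := @kernel_primes R.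
have [W W0 HW] := @walk_min_upper R.
have [[c1 c2]] := @ln_blk R; rewrite /= => -[c10 c20 Hc].
have rho1 := rho_gt1; have rho0 : 0 < rho by lra.
exists (6 + 4 * K * (1 + c2) / c1 * W * rho).
  by apply: ltr_wpDr => //; nng.
move=> X n a b B a0 b0 HB.
have ab0 : 0 < (a * b)%:R :> R by rewrite ltr0n muln_gt0 a0.
have d0 t : 0 < dec t :> R by exact: dec_gt0.
have empty : \sum_(0 <= k < n) (if hasdiv a b (2 ^ k.+1) (set0 : {set 'I_X}) then 4 ^- k else 0) <= 6 * (a * b)%:R^-1 :> R.
  apply: geom4_sum => [k /existsP[D /and3P[]]|]; last by nng.
  rewrite subset0 => /eqP ->; rewrite set0D pr0 !muln1 => h1 h2.
  rewrite ler_pdivlMr// mul1r natrM (_ : 4 = 2 * 2)%R; last by rewrite -natrM.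
  by rewrite exprMn; apply: ler_pM => //; rewrite -natrX ler_nat.
have block t : (t <= B)%N ->
   \sum_(V : {set 'I_X} | (V \subset primeset X) && (\max_(v in V) blev v == t)%N)
     \sum_(p : 'I_X | prime p && [forall v in V, (v < p)%N])
      \sum_(0 <= k < n) (if hasdiv a b (2 ^ k.+1) (p |: V) then 4 ^- k else 0)
   <= 4 * K * (1 + c2) / c1 * W * rho * (a * b)%:R^-1 * (rho ^+ t * dec t).
  move=> tB.
  pose H a' b' (V : {set 'I_X}) : R := \sum_(p : 'I_X | prime p && [forall v in V, (v < p)%N])
      \sum_(0 <= k < n) (if hasdiv (a' * p) b' (2 ^ k.+1) V then 4 ^- k else 0).
  have H0 a' b' V : 0 <= H a' b' V.
    by apply: sumr_ge0 => p _; apply: sumr_ge0 => k _; case: ifP => // _; nng.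
  have HH (V : {set 'I_X}) : \sum_(p : 'I_X | prime p && [forall v in V, (v < p)%N])
      \sum_(0 <= k < n) (if hasdiv a b (2 ^ k.+1) (p |: V) then 4 ^- k else 0) <= H a b V + H b a V.
    rewrite -big_split; apply: ler_sum => p /andP[pp /forallP pV].
    have pnV : p \notin V by apply/negP => h; have := pV p; rewrite h ltnn.
    rewrite -big_split; apply: ler_sum => k _ /=.
    have k4 : 0 <= 4 ^- k :> R by nng.
    case: ifP => [/(hasdiv_setU1 pnV)/orP[->|->]|_]; first by rewrite lerDl; case: ifP.
      by rewrite lerDr; case: ifP.
    by apply: addr_ge0; case: ifP.
  (* The [2^-t] in [Z], due to [1 / ln p], will cancel the power of 2 in the bound of
     [walk_min_upper], leaving [rho^t]. *)
  pose Z : R := 2 * K * (1 + c2) / (c1 * 2 ^+ t) / (a * b)%:R.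
  have Z0 : 0 < Z by rewrite /Z; nng; rewrite !mulr_gt0 ?invr_gt0 ?mulr_gt0 ?exprn_gt0//; lra.
  pose f (V : {set 'I_X}) := if (V \subset primeset X) && (\max_(v in V) blev v == t)%N
      then (H a b V + H b a V) * (pr V)%:R / Z else 0.
  pose w (r : 'I_X) : R := if prime r then ln (r : nat)%:R / c2 else 0.
  have f0 V : 0 <= f V.
    rewrite /f; case: ifP => // _; apply: mulr_ge0; last by nng.
    by apply: mulr_ge0 => //; apply: addr_ge0.
  have w0 (r : 'I_X) : 0 <= w r <= 2 ^+ blev r.
    rewrite /w; case: ifP => [/prime_gt1 pr1|_]; last by rewrite lexx exprn_ge0.
    have /andP[h1 h2] := Hc r pr1; rewrite ler_pdivrMr// [_ * c2]mulrC h2 andbT.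
    by apply: divr_ge0; [apply: le_trans h1; nng|exact: ltW].
  have Hf (U : {set 'I_X}) j : (j <= t.+1)%N -> f U <= 2 ^+ (cnt (@blev X) U t.+1 - cnt (@blev X) U j) *
      (1 + \sum_(r in U | (blev r < j)%N) w r).
    move=> jt; have wr r : 0 <= w r by case/andP: (w0 r).
    have sw : 0 <= \sum_(r in U | (blev r < j)%N) w r by apply: sumr_ge0 => r _.
    rewrite /f; case: ifP => [/andP[UP /eqP top]|_]; last first.
      by apply: mulr_ge0; [nng|apply: addr_ge0].
    have Ule : forall v, v \in U -> (blev v <= t)%N.
      by move=> v vU; rewrite -top; apply: leq_bigmax_cond.
    have Ub : U \subset below (@blev X) t.+1 by apply/subsetP => v /Ule; rewrite inE ltnS.
    pose W' := U :&: below (@blev X) j.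
    have WU : W' \subset U by exact: subsetIl.
    have cW : #|U :\: W'| = (cnt (@blev X) U t.+1 - cnt (@blev X) U j)%N.
      by rewrite cardsD (setIidPr WU) (cnt_sub Ub).
    have HL p : prime p -> [forall v in U, (v < p)%N] -> c1 * 2 ^+ t <= ln p%:R.
      move=> pp /forallP pU; have /andP[h _] := Hc p (prime_gt1 pp).
      apply: le_trans h; apply: ler_wpM2l; first by nng.
      apply: ler_weXn2l; first by rewrite ler1n.
      rewrite -top; apply/bigmax_leqP => v vU; apply: blk_mono.
      by have := pU v; rewrite vU => /ltnW.
    have L0 : 0 < c1 * 2 ^+ t by rewrite mulr_gt0// exprn_gt0.
    have h1 := HK X n a b U W' _ a0 b0 UP WU L0 HL.
    have h2 := HK X n b a U W' _ b0 a0 UP WU L0 HL.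
    rewrite -/(H a b U) -/(H b a U) cW in h1 h2.
    have hln : 1 + ln (pr W')%:R <= (1 + c2) * (1 + \sum_(r in U | (blev r < j)%N) w r).
      rewrite ln_pr ?(subset_trans WU)//.
      have -> : \sum_(r in W') ln (r : nat)%:R = c2 * \sum_(r in U | (blev r < j)%N) w r.
        rewrite mulr_sumr; apply: eq_big => [r|r]; first by rewrite !inE.
        rewrite !inE => /andP[/(subsetP UP) + _]; rewrite inE /w => ->.
        by rewrite mulrC divfK// gt_eqF.
      move: (\sum_(r in U | _) _) sw => u u0; clear -c20 u0; nra.
    have p0 : 0 < (pr U)%:R :> R by rewrite ltr0n pr_gt0.
    rewrite ler_pdivrMr// -ler_pdivlMr//.
    set E := 2 ^+ (_ - _) in h1 h2 *.
    have E0 : 0 < E by rewrite exprn_gt0.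
    set w' := 1 + \sum_(r in U | _) _ in hln *.
    pose M := K * E * ((1 + c2) * w') / (c1 * 2 ^+ t) / (a * b * pr U)%:R.
    have hM : K * E * (1 + ln (pr W')%:R) / (c1 * 2 ^+ t) / (a * b * pr U)%:R <= M.
      apply: ler_wpM2r; first by nng.
      apply: ler_wpM2r; first by nng.
      by apply: ler_wpM2l; first by nng.
    rewrite (mulnC b a) in h2.
    apply: le_trans (lerD (le_trans h1 hM) (le_trans h2 hM)) _.
    rewrite /M /Z (natrM _ (a * b)%N) !invfM le_eqVlt; apply/orP; left; apply/eqP; ring.
  have := HW _ (@xinv R X) (@blev X) t.+1 w f (@xinv_ge0 R X) (fun l _ => @level_xinv_le X l) w0 f0 Hf.
  have e : (2 * expR 1 * ln 2) ^+ t.+1 = 2 * 2 ^+ t * rho * rho ^+ t :> R.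
    by rewrite -mulrA exprMn !exprS; ring.
  rewrite e => h.
  apply: (@le_trans _ _ (Z * \sum_(U : {set 'I_X} | U \subset below (@blev X) t.+1) wt (@xinv R X) U * f U)).
    rewrite mulr_sumr big_mkcond [leRHS]big_mkcond; apply: ler_sum => V _ /=.
    case: ifP => [/andP[VP /eqP top]|_]; last first.
      case: ifP => // _; apply: mulr_ge0; first by exact: ltW.
      by apply: mulr_ge0 => //; apply: wt_ge0 => r; exact: xinv_ge0.
    rewrite ifT; last first.
      by apply/subsetP => v vV; rewrite inE ltnS -top; apply: leq_bigmax_cond.
    rewrite /f VP top eqxx /= wt_pr//.
    have p0 : 0 < (pr V)%:R :> R by rewrite ltr0n pr_gt0.
    apply: le_trans (HH V) _.
    rewrite le_eqVlt; apply/orP; left; apply/eqP.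
    field; by rewrite !gt_eqF.
  apply: le_trans (ler_wpM2l (ltW Z0) h) _.
  apply: (@le_trans _ _ (Z * (W * (2 * 2 ^+ t * rho * rho ^+ t) * dec t))).
    apply: ler_wpM2l; first exact: ltW.
    apply: ler_wpM2l; first by nng.
    rewrite /dec lef_pV2 ?posrE ?mulr_gt0 ?sqrtr_gt0//.
    by apply: ler_pM => //; [rewrite ler_nat | rewrite ler_wsqrtr// ler_nat].
  have t0 : 0 < 2 ^+ t :> R by rewrite exprn_gt0.
  rewrite le_eqVlt; apply/orP; left; apply/eqP; rewrite /Z.
  move: (expR 1 * ln 2 : R) (2 ^+ t : R) t0 (dec t) => r2 T T0 dt; move: (r2 ^+ t) ((a * b)%:R : R) ab0 => r3 ab ab0.
  clear -c10 T0 ab0; field; by rewrite !gt_eqF.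
apply: le_trans (sum_extract_max _) _.
  by move=> U; apply: sumr_ge0 => k _; case: ifP => // _; nng.
rewrite (sum_by_top _ HB).
have s1 : 1 <= \sum_(0 <= t < B.+1) rho ^+ t * dec t.
  rewrite big_ltn// expr0 mul1r /dec sqrtr1 mulr1 invr1 lerDl.
  by apply: sumr_ge0 => t _; apply: mulr_ge0; [nng|exact: ltW].
apply: (@le_trans _ _ (6 * (a * b)%:R^-1 + \sum_(0 <= t < B.+1) 4 * K * (1 + c2) / c1 * W * rho * (a * b)%:R^-1 * (rho ^+ t * dec t))).
  apply: lerD => //.
  by rewrite big_nat [leRHS]big_nat; apply: ler_sum => t /andP[_ tB]; exact: block.
rewrite -mulr_sumr [X in _ <= X * _]mulrDl [leRHS]mulrDl.
apply: lerD; last by exact: lexx.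
by rewrite ler_peMr//; nng.
Qed.

(** The coefficients [al^2 g] and [be^2 g] contribute [1 / (al be g)^2], a convergent triple sum, so
    non-squarefree parts cost only a constant. *)
Theorem isprod_sum_le : exists2 C : R, 0 < C & forall J,
  \sum_(0 <= k < 2 ^ J) #|[set z : 'I_(4 ^ 2 ^ J).+1 | isprod (2 ^ k.+1) z]|%:R / 4 ^+ k
  <= C * (rho ^+ J * dec J).
Proof.
have [K K0 HK] := hasdiv_sum_le.
have rho1 := rho_gt1; have rho0 : 0 < rho by lra.
have [D D0 HD] := sum_rho_dec rho1.
have [[c1 c2]] := @ln_blk R; rewrite /= => -[c10 c20 Hc].
have [m Hm] : exists m, forall J, (@blk R (4 ^ 2 ^ J) <= J + m)%N.
  have [|m /andP[_ mP]] := @ex_dyadic R (1 + 2 / c1).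
    by have : 0 < 2 / c1; [rewrite divr_gt0|lra].
  exists m.+1 => J.
  have /andP[h _] : c1 * 2 ^+ @blk R (4 ^ 2 ^ J) <= ln (4 ^ 2 ^ J)%:R <= c2 * 2 ^+ @blk R (4 ^ 2 ^ J).
    by apply: Hc; apply: leq_trans (leq_pexp2l (isT : 0 < 4)%N (expn_gt0 2 J)); rewrite // ltn_exp2l.
  have l4 : ln (4 ^ 2 ^ J)%:R <= 2 ^+ J * 2 :> R.
    rewrite natrX lnXn// -[leLHS]mulr_natl natrX; apply: ler_wpM2l; first by nng.
    rewrite (_ : 4 = 2 * 2)%R; last by rewrite -natrM.
    by rewrite lnM ?posrE//; have := @ln2_lt1 R; clear; lra.
  have {}h := le_trans h l4.
  suff : 2 ^+ @blk R (4 ^ 2 ^ J) < 2 ^+ (J + m.+1) :> R by rewrite ltr_eXn2l ?ltr1n// => /ltnW.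
  rewrite exprD; apply: (@le_lt_trans _ _ (2 ^+ J * (2 / c1))).
    by rewrite mulrA ler_pdivlMr// mulrC.
  by rewrite ltr_pM2l ?exprn_gt0//; move: mP; clear; lra.
exists (8 * K * D * rho ^+ m); first by rewrite !mulr_gt0// exprn_gt0.
move=> J.
set X := (4 ^ 2 ^ J).+1; set n := (2 ^ J)%N; pose Y := (2 ^ n).+1.
have HB (t : 'I_X) : (blev t <= J + m)%N.
  by apply: leq_trans (Hm J); apply: blk_mono; rewrite -ltnS.
set S := \sum_(0 <= t < (J + m).+1) rho ^+ t * dec t.
have S0 : 0 <= S by apply: sumr_ge0 => t _; apply: mulr_ge0; [nng|exact/ltW/dec_gt0].
apply: (@le_trans _ _ (\sum_(0 <= k < n) \sum_(al : 'I_Y | (0 < al)%N) \sum_(be : 'I_Y | (0 < be)%N) \sum_(g : 'I_Y | (0 < g)%N)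
   \sum_(U : {set 'I_X} | U \subset primeset X)
     (if hasdiv (al ^ 2 * g) (be ^ 2 * g) (2 ^ k.+1) U then 4 ^- k else 0))).
  rewrite big_nat [leRHS]big_nat; apply: ler_sum => k /andP[_ kn].
  have N0 : (0 < 2 ^ k.+1)%N by rewrite expn_gt0.
  have NY : (2 ^ k.+1 < Y)%N by rewrite /Y ltnS leq_exp2l.
  have NX : (2 ^ k.+1 * 2 ^ k.+1 < X)%N.
    by rewrite /X ltnS -expnMn leq_exp2l.
  apply: le_trans (ler_wpM2r _ (@isprod_count R X Y _ N0 NY NX)) _; first by nng.
  rewrite mulr_suml; apply: ler_sum => al _; rewrite mulr_suml; apply: ler_sum => be _.
  rewrite mulr_suml; apply: ler_sum => g _; rewrite mulr_suml; apply: ler_sum => U _.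
  by case: ifP => _; rewrite ?mul1r ?mul0r.
rewrite exchange_big /=.
pose s (i : 'I_Y) : R := ((i : nat)%:R ^+ 2)^-1.
have s0 i : 0 <= s i by rewrite /s; nng.
have ss : \sum_(i : 'I_Y | (0 < i)%N) s i <= 2 := sum_inv_sq Y.
have ss0 : 0 <= \sum_(i : 'I_Y | (0 < i)%N) s i by exact: sumr_ge0.
apply: (@le_trans _ _ (\sum_(al : 'I_Y | (0 < al)%N) \sum_(be : 'I_Y | (0 < be)%N) \sum_(g : 'I_Y | (0 < g)%N) K * S * (s al * (s be * s g)))).
  apply: ler_sum => al al0; rewrite exchange_big; apply: ler_sum => be be0.
  rewrite exchange_big; apply: ler_sum => g g0; rewrite exchange_big /=.
  have a0 : (0 < al ^ 2 * g)%N by rewrite muln_gt0 expn_gt0 al0.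
  have b0 : (0 < be ^ 2 * g)%N by rewrite muln_gt0 expn_gt0 be0.
  apply: le_trans (HK X n _ _ _ a0 b0 HB) _; rewrite -/S.
  rewrite le_eqVlt; apply/orP; left; apply/eqP.
  rewrite /s !natrM !expr2; field.
  by rewrite !pnatr_eq0 -!lt0n al0 be0 g0.
have -> : \sum_(al : 'I_Y | (0 < al)%N) \sum_(be : 'I_Y | (0 < be)%N) \sum_(g : 'I_Y | (0 < g)%N) K * S * (s al * (s be * s g))
  = K * S * ((\sum_(i : 'I_Y | (0 < i)%N) s i) * ((\sum_(i : 'I_Y | (0 < i)%N) s i) * (\sum_(i : 'I_Y | (0 < i)%N) s i))).
  rewrite mulr_suml mulr_sumr; apply: eq_bigr => al _.
  rewrite mulr_suml !mulr_sumr; apply: eq_bigr => be _.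
  by rewrite !mulr_sumr.
move: ss ss0; set q := \sum_(i | _) s i => q2 q0.
have q8 : q * (q * q) <= 8 by clear -q2 q0; nra.
have HS := HD (J + m)%N; rewrite -/S in HS.
have HS' : S <= D * rho ^+ m * (rho ^+ J * dec J).
  apply: le_trans HS _; rewrite exprD.
  rewrite [leRHS](_ : _ = D * (rho ^+ J * rho ^+ m * dec J)); last by ring.
  apply: ler_wpM2l; first by nng.
  apply: ler_wpM2l; first by nng.
  rewrite /dec lef_pV2 ?posrE ?mulr_gt0 ?sqrtr_gt0//.
  by apply: ler_pM => //; [rewrite ler_nat ltnS leq_addr| rewrite ler_wsqrtr// ler_nat ltnS leq_addr].
apply: (@le_trans _ _ (K * S * 8)).
  by apply: ler_wpM2l => //; nng.
rewrite [leRHS](_ : _ = K * (D * rho ^+ m * (rho ^+ J * dec J)) * 8); last by ring.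
apply: ler_wpM2r; first by nng.
by apply: ler_wpM2l => //; nng.
Qed.

End ProductCount.

(** * Integers with two close complementary divisors *)

Section BallotSets.
Import mathcomp.boot.fintype mathcomp.boot.finset.
Context {R : realType}.
Notation rho := (expR 1 * ln 2 : R).

(** Blocks miss the mass [ln 2] by a geometrically small amount; starting at block [i0] keeps the
    accumulated relative loss below 1/2. The ratio [13/14] serves because its square exceeds [6/7],
    and [i0 = 80] because [(6/7)^5 <= 1/2]. *)
Lemma block_offset : exists i0, forall n,
  \sum_(0 <= l < n) 2 * l.+1%:R * l.+2%:R * (6 / 7) ^+ (i0 + l) <= 1 / 2 :> R.
Proof.
pose s : R := 13 / 14.
have s0 : 0 <= s by rewrite /s; lra.
have s1 : s < 1 by rewrite /s; lra.
have key l : l.+2%:R * (6 / 7) ^+ l <= 28 * s ^+ l :> R.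
  have h : l.+1%:R * s ^+ l <= (1 - s)^-1.
    apply: le_trans (sum_geo_le l.+1 s0 s1).
    have -> : l.+1%:R * s ^+ l = \sum_(0 <= b < l.+1) s ^+ l by rewrite sumr_const_nat subn0 mulr_natl.
    rewrite big_nat [leRHS]big_nat; apply: ler_sum => b /andP[_ bm].
    by apply: ler_wiXn2l => //; exact: ltW.
  have e : (1 - s)^-1 = 14 by rewrite /s; field.
  rewrite e in h.
  apply: (@le_trans _ _ (2 * (l.+1%:R * s ^+ l) * s ^+ l)).
    rewrite -2!mulrA -exprMn mulrA; apply: ler_pM.
    - by [].
    - by apply: exprn_ge0; lra.
    - by rewrite -natrM ler_nat; lia.
    - by apply: lerXn2r; rewrite ?nnegrE /s; lra.
  apply: ler_wpM2r; first exact: exprn_ge0.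
  by move: h; move: (_ * _) => u; lra.
have [i0 hi0] : exists i0 : nat, (6 / 7) ^+ i0 <= (2 ^+ 16)^-1 :> R.
  exists 80%N; rewrite -exprVn (_ : 80 = 5 * 16)%N// exprM.
  by apply: lerXn2r; rewrite ?nnegrE ?exprn_ge0//; lra.
exists i0 => n.
apply: (@le_trans _ _ (\sum_(0 <= l < n) (6 / 7) ^+ i0 * 56 * (l.+1%:R * s ^+ l))).
  apply: ler_sum => l _; rewrite exprD.
  rewrite [leLHS](_ : _ = (6 / 7) ^+ i0 * (2 * l.+1%:R * (l.+2%:R * (6 / 7) ^+ l))); last by ring.
  rewrite [leRHS](_ : _ = (6 / 7) ^+ i0 * (2 * l.+1%:R * (28 * s ^+ l))); last by ring.
  apply: ler_wpM2l; first by apply: exprn_ge0; lra.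
  by apply: ler_wpM2l => //; nng.
rewrite -mulr_sumr.
have h := sum_arith_geo n s0 s1.
have e : (1 - s) ^- 2 = 196 by rewrite /s; field.
rewrite e in h.
apply: (@le_trans _ _ ((2 ^+ 16)^-1 * 56 * 196)); last first.
  by rewrite -mulrA mulrC ler_pdivrMr ?exprn_gt0//; lra.
apply: ler_pM.
- by apply: mulr_ge0 => //; apply: exprn_ge0; lra.
- by apply: sumr_ge0 => l _; nng.
- by apply: ler_wpM2r.
- exact: h.
Qed.

Definition bx i0 X (t : 'I_X) : R := if (i0 <= @blk R t)%N then xinv t else 0.
(** Truncated subtraction puts primes of the discarded blocks on level 0, where [bx] gives them
    weight 0. *)
Definition bl i0 X (t : 'I_X) : nat := (@blk R t - i0)%N.

Lemma bx_ge0 i0 X (t : 'I_X) : 0 <= bx i0 t.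
Proof. by rewrite /bx; case: ifP => // _; exact: xinv_ge0. Qed.

Lemma level_bx i0 X l : (0 < X)%N -> \sum_(t in level (bl i0 (X:=X)) l) bx i0 t = blksum X.-1 (i0 + l).
Proof.
move=> X0; rewrite /blksum prednK// big_mkord.
rewrite big_mkcond [RHS]big_mkcond; apply: eq_bigr => t _ /=.
rewrite inE /bl /bx /xinv; case: (leqP i0 (blk t)) => h.
  rewrite -(eqn_add2l i0) subnKC//.
  by case: (blk t == _); case: (prime t).
rewrite (_ : (blk t == _) = false) ?andbF; last by apply/eqP => e; move: h; rewrite e; lia.
by case: ifP.
Qed.

Lemma level_bx_le i0 X l : \sum_(t in level (bl i0 (X:=X)) l) bx i0 t <= ln 2.
Proof.
have [X0|X0] := posnP X; last by rewrite level_bx//; exact: blksum_le.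
rewrite big1; first by have := @ln2_gt R; lra.
by move=> t; have := ltn_ord t; rewrite {2}X0.
Qed.

Lemma bx_level_le i0 X l (t : 'I_X) : t \in level (bl i0 (X:=X)) l -> bx i0 t <= (6 / 7) ^+ (i0 + l).
Proof.
have p0 : 0 <= (6 / 7) ^+ (i0 + l) :> R by apply: exprn_ge0; lra.
rewrite inE /bl /bx => /eqP <-; case: ifP => [h|//]; rewrite subnKC// /xinv.

case: ifP => // pt; have := @blk_prime_ge R _ pt.
have -> : 6 / 7 = (7 / 6)^-1 :> R by rewrite invf_div.
rewrite exprVn => h2; rewrite lef_pV2 ?posrE ?ltr0n ?prime_gt0 ?exprn_gt0//; lra.
Qed.

(** A prime of block [i0 + l] weighs at most [d = (6/7)^(i0 + l)], so for [n <= l + 1] the symmetric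
    sum is at least [(ln 2 - (l + 2) d)^n / n!]; Bernoulli's inequality turns this into the factor
    [1 - eta l]. *)
Lemma ballot_mass i0 J X :
  (forall n, \sum_(0 <= l < n) 2 * l.+1%:R * l.+2%:R * (6 / 7) ^+ (i0 + l) <= 1 / 2 :> R) ->
  (0 < X)%N -> (i0 + J <= @blk R X.-1)%N ->
  1 / 2 * ln 2 ^+ J * fpw J.+1 1 <=
  \sum_(U : {set 'I_X} | [&& U \subset below (bl i0 (X:=X)) J, ballot (bl i0 (X:=X)) J U & cnt (bl i0 (X:=X)) U J == J]) wt (bx i0 (X:=X)) U.
Proof.
move=> Hi X0 HJ.
pose eta l : R := 2 * l.+1%:R * l.+2%:R * (6 / 7) ^+ (i0 + l).
have y0 k : 0 <= (6 / 7) ^+ k :> R by apply: exprn_ge0; lra.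
have eta0 l : 0 <= eta l by rewrite /eta; apply: mulr_ge0 => //; nng.
apply: (@ballot_lower _ _ _ _ _ eta); [exact: bx_ge0| |exact: Hi|].
  move=> l lJ; rewrite eta0 /=; have := Hi l.+1; rewrite big_nat_recr//= -/(eta l).
  have : 0 <= \sum_(0 <= l < l) eta l by apply: sumr_ge0.
  by rewrite /eta; move: (\sum_(_ <= _ < _) _) (_ * _ ^+ _) => u v u0; lra.
move=> l n lJ nl.
have l2 := @ln2_gt R.
have [e1|e1] := leP 1 (eta l).
  apply: le_trans (elsym_ge0 _ _ (@bx_ge0 i0 X)).
  rewrite -oppr_ge0 -mulNr opprB; apply: mulr_ge0; first by rewrite subr_ge0.
  by rewrite divr_ge0// exprn_ge0//; lra.
pose d : R := (6 / 7) ^+ (i0 + l).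
have d0 : 0 <= d by exact: y0.
pose L := ln 2 - l.+2%:R * d.
have hd : l.+2%:R * d * n%:R <= eta l * ln 2.
  have h : n%:R <= l.+1%:R :> R by rewrite ler_nat.
  rewrite /eta -/d -[2 * _ * _ * d]mulrA; have : 0 <= l.+2%:R * d by nng.
  move: (l.+2%:R * d) => u u0.
  apply: (@le_trans _ _ (u * l.+1%:R)); first by apply: ler_wpM2l.
  rewrite [leRHS](_ : _ = u * l.+1%:R * (2 * ln 2)); last by ring.
  by apply: ler_peMr; [nng|lra].
have L0 : 0 <= L.
  rewrite /L subr_ge0; have : l.+2%:R * d <= l.+1%:R * (l.+2%:R * d).
    by apply: ler_peMl; [nng|rewrite ler1n].
  have e2 : 2 * (l.+1%:R * (l.+2%:R * d)) < 1.
    by apply: le_lt_trans e1; rewrite /eta -/d le_eqVlt; apply/orP; left; apply/eqP; ring.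
  move: e2 l2; move: (l.+1%:R * (l.+2%:R * d)) (l.+2%:R * d) => u v; lra.
apply: (@le_trans _ _ (L ^+ n / n`!%:R)); last first.
  apply: (elsym_ge (@bx_ge0 i0 X) (@bx_level_le i0 X l) L0 d0).
  rewrite level_bx//; have h : (i0 + l < @blk R X.-1)%N by apply: leq_trans HJ; rewrite ltn_add2l.
  apply: le_trans (blksum_ge h).
  rewrite exprS -/d /L.
  have h2 : n%:R * d <= l.+1%:R * d by apply: ler_wpM2r; rewrite ?ler_nat.
  rewrite -[l.+2%:R]natr1 [X in _ - X + _]mulrDl mul1r.
  by move: (n%:R * d) (l.+1%:R * d) h2 d0 => u v; lra.
rewrite mulrA; apply: ler_wpM2r; first by nng.
have -> : L = ln 2 * (1 - l.+2%:R * d / ln 2) by rewrite /L mulrBr mulr1 [ln 2 * (_ / _)]mulrC divfK// gt_eqF//; lra.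
rewrite exprMn [leLHS]mulrC; apply: ler_wpM2l; first by apply: exprn_ge0; lra.
set v := _ / ln 2.
have v0 : 0 <= v by rewrite /v; apply: divr_ge0; [nng|lra].
have v1 : v <= 1 by rewrite /v ler_pdivrMr ?mul1r; [move: L0; rewrite /L subr_ge0|lra].
have hv : v * n%:R <= eta l by rewrite /v mulrAC ler_pdivrMr//; lra.
apply: (@le_trans _ _ (1 - v * n%:R)); first by rewrite lerB.
have /andP[+ _] := @prod_1sub_ge R (fun=> v) n (fun _ _ => introT andP (conj v0 v1)).
by rewrite sumr_const_nat prodr_const_nat subn0 mulr_natr.
Qed.

Lemma sum_below (T : finType) (lev : T -> nat) J (F : T -> R) :
  \sum_(t in below lev J) F t = \sum_(0 <= l < J) \sum_(t in level lev l) F t.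
Proof.
elim: J => [|J IH]; first by rewrite below0 big_set0 big_geq.
rewrite big_nat_recr//= -IH belowS (bigID (mem (level lev J))) addrC /=; congr (_ + _).
  by apply: eq_bigl => t; rewrite !inE; case: ltngtP.
by apply: eq_bigl => t; rewrite !inE; case: ltngtP.
Qed.

Lemma cnt_subset (T : finType) (lev : T -> nat) (U V : {set T}) l : V \subset U ->
  (cnt lev V l <= cnt lev U l)%N.
Proof. by move=> VU; rewrite /cnt subset_leq_card// setSI. Qed.

Lemma ballot_subset (T : finType) (lev : T -> nat) J (U V : {set T}) : V \subset U ->
  ballot lev J U -> ballot lev J V.
Proof.
move=> VU /ballotP H; apply/ballotP => l lJ; apply: leq_trans (H l lJ); exact: cnt_subset.
Qed.

(* Removing one prime from a ballot set of size [J] leaves a ballot set of size [J - 1]. *)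
Lemma ballot_mecke (T : finType) (x : T -> R) (lev : T -> nat) J (F : T -> {set T} -> R) :
  (forall t, 0 <= x t) -> (forall r V, 0 <= F r V) ->
  \sum_(U : {set T} | [&& U \subset below lev J, ballot lev J U & cnt lev U J == J])
    wt x U * (\sum_(r in U) F r (U :\ r)) <=
  \sum_(V : {set T} | [&& V \subset below lev J, ballot lev J V & (cnt lev V J).+1 == J])
    wt x V * (\sum_(r in below lev J) x r * F r V).
Proof.
move=> x0 F0.
pose G r V := if ballot lev J V && ((cnt lev V J).+1 == J) then F r V else 0.
have G0 r V : 0 <= G r V by rewrite /G; case: ifP.
apply: (@le_trans _ _ (\sum_(U : {set T} | U \subset below lev J) wt x U * (\sum_(r in U) G r (U :\ r)))).
  rewrite big_mkcond [leRHS]big_mkcond; apply: ler_sum => U _.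
  case: ifP => [/and3P[UB bU /eqP cU]|_]; last first.
    by case: ifP => // _; apply: mulr_ge0; [exact: wt_ge0|apply: sumr_ge0].
  rewrite UB; apply: ler_wpM2l; first exact: wt_ge0.
  apply: ler_sum => r rU; rewrite /G (ballot_subset (subD1set _ _) bU) /=.
  rewrite ifT// cnt_sub ?(subset_trans (subD1set _ _))//.
  by rewrite -[X in _ == X]cU (cnt_sub UB) (cardsD1 r U) rU.
rewrite mecke.
apply: (@le_trans _ _ (\sum_(r in below lev J) x r * \sum_(V : {set T} | V \subset below lev J) wt x V * G r V)).
  apply: ler_sum => r rB; apply: ler_wpM2l => //.
  rewrite big_mkcond [leRHS]big_mkcond; apply: ler_sum => U _.
  case: ifP => [h|_]; first by rewrite (subset_trans h (subD1set _ _)).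
  by case: ifP => // _; apply: mulr_ge0; [exact: wt_ge0|].
rewrite le_eqVlt; apply/orP; left; apply/eqP.
under eq_bigr do rewrite mulr_sumr.
rewrite exchange_big /= big_mkcond [RHS]big_mkcond; apply: eq_bigr => V _.
rewrite /G; case: (_ \subset _) => //=; case: ifP => _; last by rewrite big1// => r _; rewrite !mulr0.
by rewrite mulr_sumr; apply: eq_bigr => r _; ring.
Qed.

(** A first moment of [ln (pr U)]. Deleting one prime leaves a ballot set of size [J - 1], of
    comparable total mass, and level [l] carries [ln p / p] mass of order [2^(i0 + l)], a geometric
    sum. *)
Lemma ballot_log_mass : exists2 C : R, 0 < C & forall i0 J X,
  \sum_(U : {set 'I_X} | [&& U \subset below (bl i0 (X:=X)) J, ballot (bl i0 (X:=X)) J U & cnt (bl i0 (X:=X)) U J == J])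
    wt (bx i0 (X:=X)) U * \sum_(r in U) ln (r : nat)%:R <=
  C * 2 ^+ i0 * 2 ^+ J * (ln 2 ^+ J * fpw J.+1 1).
Proof.
have [[c1 c2]] := @ln_blk R; rewrite /= => -[c10 c20 Hc].
have l2 : 0 < ln 2 :> R by have := @ln2_gt R; lra.
exists (c2 * 2); first by rewrite mulr_gt0.
move=> i0 J X.
have := @ballot_mecke _ (bx i0 (X:=X)) (bl i0 (X:=X)) J (fun r _ => ln (r : nat)%:R) (@bx_ge0 i0 X) (fun r _ => prime_lnr_ge0 _).
move=> h; apply: le_trans h _.
rewrite -mulr_suml.
have h1 := ballot_upper (J := J) (@bx_ge0 i0 X) (fun l _ => @level_bx_le i0 X l).
have h2 : \sum_(r in below (bl i0 (X:=X)) J) bx i0 r * ln (r : nat)%:R <= c2 * ln 2 * 2 ^+ i0 * 2 ^+ J :> R.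
  rewrite sum_below.
  apply: (@le_trans _ _ (\sum_(0 <= l < J) c2 * ln 2 * 2 ^+ i0 * 2 ^+ l)).
    apply: ler_sum => l _.
    apply: (@le_trans _ _ (\sum_(t in level (bl i0 (X:=X)) l) bx i0 t * (c2 * 2 ^+ i0 * 2 ^+ l))).
      apply: ler_sum => t; rewrite inE => /eqP tl.
      rewrite /bx; case: (leqP i0 (blk t)) => [it|]; last by rewrite !mul0r.
      rewrite /xinv; case: ifP => [pt|]; last by rewrite !mul0r.
      apply: ler_wpM2l; first by nng.
      have /andP[_ h] := Hc t (prime_gt1 pt); apply: le_trans h _.
      by rewrite -mulrA -exprD -tl /bl subnKC.
    rewrite -mulr_suml; apply: le_trans (ler_wpM2r _ (level_bx_le i0 X l)) _; first by nng.
    by rewrite le_eqVlt; apply/orP; left; apply/eqP; ring.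
  rewrite -mulr_sumr; apply: ler_wpM2l; first by nng.
  elim: J {h1} => [|J IH]; first by rewrite big_geq.
  by rewrite big_nat_recr//= exprS; move: IH; move: (\sum_(_ <= _ < _) _) (2 ^+ J) => u v; lra.
have f0 := @fpw_ge0 R.
apply: le_trans (ler_wpM2l _ h2) _.
  by apply: sumr_ge0 => V _; apply: wt_ge0; exact: bx_ge0.
apply: le_trans (ler_wpM2r _ h1) _; first by nng.
apply: (@le_trans _ _ (ln 2 ^+ J / ln 2 * (2 * fpw J.+1 1) * (c2 * ln 2 * 2 ^+ i0 * 2 ^+ J))).
  apply: ler_wpM2r; first by nng.
  by apply: ler_wpM2l; [nng|exact: fpw2_le].
rewrite le_eqVlt; apply/orP; left; apply/eqP; field.
by rewrite gt_eqF.
Qed.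

(** Markov's inequality: for large [m] the sets with [(pr U)^2 > 2^(m 2^J)] take at most half of the
    guaranteed ballot mass. The implication exempts sets with a nonprime element, whose weight is
    0. *)
Lemma good_mass : exists i0 m, (0 < m)%N /\
  (forall n, \sum_(0 <= l < n) l.+1%:R * (6 / 7) ^+ (i0 + l) <= 1 / 8 :> R) /\
  forall J X, (0 < X)%N -> (i0 + J <= @blk R X.-1)%N ->
  1 / 4 * (rho ^+ J * dec J) <=
  \sum_(U : {set 'I_X} | [&& U \subset below (bl i0 (X:=X)) J, ballot (bl i0 (X:=X)) J U & cnt (bl i0 (X:=X)) U J == J]
     && ((U \subset primeset X) ==> (pr U ^ 2 <= 2 ^ (m * 2 ^ J))%N)) wt (bx i0 (X:=X)) U.
Proof.
have [i0 Hi] := block_offset.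
have [C C0 HC] := ballot_log_mass.
pose t := C * 2 ^+ i0.
have [m Hm] : exists m : nat, 16 * t <= m%:R.
  exists (Num.truncn (16 * t)).+1; apply: ltW.
  have t16 : 0 <= 16 * t by rewrite /t; nng.
  by have /andP[] := truncn_itv t16.
have t0 : 0 < t by rewrite mulr_gt0// exprn_gt0.
have m0 : (0 < m)%N by rewrite lt0n; apply/eqP => e; move: Hm; rewrite e; lra.
exists i0, m; split => //; split.
  move=> n; rewrite -(ler_pM2l (_ : 0 < 4 :> R))//.
  apply: le_trans (le_trans _ (Hi n)) _; last by lra.
  rewrite mulr_sumr; apply: ler_sum => l _.
  rewrite mulrA; apply: ler_wpM2r; first by apply: exprn_ge0; lra.
  rewrite -!natrM ler_nat; lia.
move=> J X X0 HJ.
have l2 : 0 < ln 2 :> R by have := @ln2_gt R; lra.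
have f0 := @fpw_ge0 R.
set M := ln 2 ^+ J * fpw J.+1 1 : R.
have hM : rho ^+ J * dec J <= M.
  have := @fpw1_ge R J.+1 isT; rewrite exprS [expR 1 * _]mulrC mulfK ?gt_eqF ?expR_gt0// => h.
  by rewrite exprMn mulrAC mulrC /M /dec; apply: ler_wpM2l => //; nng.
have h1 := ballot_mass Hi X0 HJ; rewrite -mulrA -/M in h1.
have h2 := HC i0 J X; rewrite -/M -/t in h2.
rewrite (bigID (fun U : {set 'I_X} => (U \subset primeset X) ==> (pr U ^ 2 <= 2 ^ (m * 2 ^ J))%N)) /= in h1.
set A := \sum_(_ | _ && _) _ in h1; set B := \sum_(_ | _ && ~~ _) _ in h1.
rewrite -/A.
suff : B <= 1 / 4 * M by move: h1 hM; clear; move: (rho ^+ J * dec J) => u; lra.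
have T0 : 0 < t * 2 ^+ J by rewrite mulr_gt0// exprn_gt0.
rewrite -(ler_pM2l T0).
have -> : t * 2 ^+ J * (1 / 4 * M) = 1 / 4 * (t * 2 ^+ J * M) by ring.
rewrite -ler_pdivrMl; last by lra.
apply: le_trans h2.
rewrite /B mulr_sumr mulr_sumr [leLHS]big_mkcond [leRHS]big_mkcond; apply: ler_sum => U _ /=.
have lnU : 0 <= \sum_(r in U) ln (r : nat)%:R :> R by apply: sumr_ge0 => r _; exact: prime_lnr_ge0.
have wU := wt_ge0 U (@bx_ge0 i0 X).
case: ifP => [/andP[-> h]|_]; last by case: ifP => // _; nng.
move: h; rewrite negb_imply -ltnNge => /andP[UP h].
have p0 : 0 < (pr U)%:R :> R by rewrite ltr0n pr_gt0.
have {}h : ln (2 ^ (m * 2 ^ J))%:R <= ln (pr U ^ 2)%:R :> R.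
  by rewrite ler_ln ?posrE ?ltr0n ?expn_gt0 ?pr_gt0// ler_nat ltnW.
move: h; rewrite !natrX !lnXn// ln_pr// -[ln 2 *+ _]mulr_natl natrM natrX.
set L := \sum_(r in U) _ => h.
rewrite [leLHS](_ : _ = wt (bx i0 (X:=X)) U * (4 * t * 2 ^+ J)); last by field.
apply: ler_wpM2l => //.
have T1 : 0 < 2 ^+ J :> R by rewrite exprn_gt0.
have h3 : 16 * t * 2 ^+ J <= m%:R * 2 ^+ J by apply: ler_wpM2r => //; exact: ltW.
have h4 : m%:R * 2 ^+ J / 2 <= m%:R * 2 ^+ J * ln 2 :> R.
  by apply: ler_wpM2l; [nng|have := @ln2_gt R; lra].
move: h h3 h4; rewrite -[4 * t * _]mulrA -[16 * t * _]mulrA -[L *+ 2]mulr_natl.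
by move: (t * 2 ^+ J) (m%:R * 2 ^+ J) (m%:R * 2 ^+ J * ln 2) L {lnU} => a b c d; lra.
Qed.

End BallotSets.

(** * Primes in windows and divisors of comparable size *)

Section CloseDivisors.
Import mathcomp.boot.fintype mathcomp.boot.finset.
Context {R : realType}.
Notation rho := (expR 1 * ln 2 : R).

Lemma ler_ln_nat (a b : nat) : (0 < a)%N -> (a <= b)%N -> ln a%:R <= ln b%:R :> R.
Proof. by move=> a0 ab; rewrite ler_ln ?posrE ?ltr0n ?ler_nat// (leq_trans a0). Qed.

Lemma pr_inj X (U V : {set 'I_X}) : U \subset primeset X -> V \subset primeset X ->
  pr U = pr V -> U = V.
Proof.
have key (A : {set 'I_X}) (t : 'I_X) : A \subset primeset X -> prime t -> ((t : nat) %| pr A)%N -> t \in A.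
  move=> /subsetP AP pt; rewrite /pr.
  rewrite Euclid_dvd_prod// big_orE => /exists_inP[s sA].
  have := AP s sA; rewrite inE => ps; rewrite dvdn_prime2// => /eqP/val_inj ->.
  by [].
move=> UP VP e; apply/eqP; rewrite eqEsubset; apply/andP; split; apply/subsetP => t tU.
  have := subsetP UP t tU; rewrite inE => pt; apply: key => //.
  by rewrite -e /pr (bigD1 t)//= dvdn_mulr.
have := subsetP VP t tU; rewrite inE => pt; apply: key => //.
by rewrite e /pr (bigD1 t)//= dvdn_mulr.
Qed.

(** The inequality [prod (1 - 1/r) >= 1 - sum 1/r], removing one prime at a time. *)
Lemma totient_pr X (U : {set 'I_X}) : U \subset primeset X ->
  (pr U)%:R * (1 - \sum_(r in U) (r : nat)%:R^-1) <= (totient (pr U))%:R :> R.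
Proof.
have [n] := ubnP #|U|; elim: n U => // n IH U Un UP.
have [->|[r rU]] := set_0Vmem U; first by rewrite pr0 big_set0 subr0 mulr1.
have rP : prime r by have := subsetP UP r rU; rewrite inE.
have U'P : U :\ r \subset primeset X by apply: subset_trans UP; exact: subD1set.
have Un' : (#|U :\ r| < n)%N by move: Un; rewrite (cardsD1 r U) rU.
have h := IH _ Un' U'P.
have r0 : 0 < (r : nat)%:R :> R by rewrite ltr0n prime_gt0.
have cop : coprime r (pr (U :\ r)).
  rewrite prime_coprime//; apply/negP; rewrite /pr Euclid_dvd_prod// big_orE => /exists_inP[s sU].
  have := subsetP U'P s sU; rewrite inE => ps.
  rewrite dvdn_prime2// => /eqP/val_inj e; by move: sU; rewrite -e setD11.
rewrite -(setD1K rU) prU1 ?setD11// big_setU1 ?setD11//= totient_coprime// totient_prime//.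
rewrite !natrM -subn1 natrB ?prime_gt0//.
have t1 : (totient (pr (U :\ r)))%:R <= (pr (U :\ r))%:R :> R.
  rewrite ler_nat totient_count_coprime; set n' := pr _.
  apply: (@leq_trans (\sum_(0 <= d < n') 1)); first by apply: leq_sum => d _; exact: leq_b1.
  by rewrite sum_nat_const_nat subn0 muln1.
have s0 : 0 <= \sum_(r in U :\ r) (r : nat)%:R^-1 :> R by apply: sumr_ge0.
have p0 : 0 <= (pr (U :\ r))%:R :> R by [].
have r1 : 1 <= (r : nat)%:R :> R by rewrite ler1n prime_gt0.
move: h t1 s0 p0 r1 r0; clear; move: (pr _)%:R (totient _)%:R (\sum_(_ in _) _) (r : nat)%:R => p t s x h tp s0 p0 x1 x0.
have -> : x * p * (1 - (x^-1 + s)) = x * (p * (1 - s)) - p by field; rewrite gt_eqF.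
have : x * (p * (1 - s)) <= x * t by apply: ler_wpM2l => //; exact: ltW.
by move: (p * (1 - s)) => u; lra.
Qed.

Lemma sum_inv_prime_pos X (P : pred 'I_X) (M : R) : 0 < M -> (forall p, P p -> prime p /\ M <= ln (p : nat)%:R) ->
  \sum_(p : 'I_X | P p) (p : nat)%:R^-1 <= (\sum_(p : 'I_X | P p) ln (p : nat)%:R / (p : nat)%:R) / M :> R.
Proof.
move=> M0 H; rewrite mulr_suml; apply: ler_sum => p Pp; have [pp h] := H p Pp.
by rewrite mulrAC ler_peMl// ler_pdivlMr// mul1r.
Qed.

Lemma sum_inv_prime_neg X (P : pred 'I_X) (M : R) : 0 < M -> (forall p, P p -> prime p /\ ln (p : nat)%:R <= M) ->
  (\sum_(p : 'I_X | P p) ln (p : nat)%:R / (p : nat)%:R) / M <= \sum_(p : 'I_X | P p) (p : nat)%:R^-1 :> R.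
Proof.
move=> M0 H; rewrite mulr_suml; apply: ler_sum => p Pp; have [pp h] := H p Pp.
by rewrite mulrAC ler_piMl// ler_pdivrMr// mul1r.
Qed.

Lemma sum_inv_window_le X (P : pred 'I_X) (M x y : R) : 0 < M -> 0 < x -> x <= y ->
  (forall p, P p -> [/\ prime p, M <= ln (p : nat)%:R & x <= (p : nat)%:R <= y]) ->
  \sum_(p : 'I_X | P p) (p : nat)%:R^-1 <= (ln (y / x) + 10) / M.
Proof.
move=> M0 x0 xy H; apply: le_trans (sum_inv_prime_pos M0 _) _.
  by move=> p /H[].
apply: ler_wpM2r; first by rewrite invr_ge0 ltW.
apply: le_trans (sum_primes_range X x0 xy); rewrite big_mkord.
rewrite big_mkcond [leRHS]big_mkcond; apply: ler_sum => p _ /=.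
have l0 : 0 <= ln (p : nat)%:R / (p : nat)%:R :> R by rewrite divr_ge0// prime_lnr_ge0.
by case: ifP => [/H[-> _ ->]//|_]; case: ifP.
Qed.

Lemma ln_pow2 n : ln (2 ^ n)%:R = n%:R * ln 2 :> R.
Proof. by rewrite natrX lnXn// -[LHS]mulr_natl. Qed.

Lemma ln28_gt1 (Y : nat) : 28 <= ln Y%:R :> R -> (1 < Y)%N.
Proof.
rewrite ltnNge => h; apply/negP => Y1; move: h.
have : ln Y%:R <= 0 :> R by apply: ln_le0; rewrite -[1]/(1%:R) ler_nat.
by move: (ln _) => u; lra.
Qed.

Lemma ln_2p16 : ln (2 ^+ 16) <= 16 :> R.
Proof. by rewrite -natrX ln_pow2; have := @ln2_lt1 R; move: (ln 2) => u; lra. Qed.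

Lemma sum_p_le X Y : 28 <= ln Y%:R :> R ->
  \sum_(p : 'I_X | prime p && (Y < p <= Y ^ 2)%N) (p : nat)%:R^-1 <= 2 :> R.
Proof.
move=> l28; have Y0 := ltnW (ln28_gt1 l28).
have y0 : 0 < Y%:R :> R by rewrite ltr0n.
apply: le_trans (@sum_inv_window_le X _ (ln Y%:R) Y%:R (Y%:R ^+ 2) _ y0 _ _) _; first by lra.
- by rewrite expr2 ler_peMl// ler1n.
- move=> p /andP[pp /andP[h1 h2]]; split => //.
    by rewrite ler_ln_nat// ltnW.
  by rewrite -natrX !ler_nat h2 ltnW.
rewrite expr2 mulfK ?gt_eqF// ler_pdivrMr; last by lra.
by move: (ln _) l28 => u; lra.
Qed.

Lemma sum_p_ge X Y : 28 <= ln Y%:R :> R -> (Y ^ 2 < X)%N ->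
  1 / 4 <= \sum_(p : 'I_X | prime p && (Y < p <= Y ^ 2)%N) (p : nat)%:R^-1 :> R.
Proof.
move=> l28 YX; have Y0 := ltnW (ln28_gt1 l28).
have y0 : 0 < Y%:R :> R by rewrite ltr0n.
have e : ln (Y ^ 2)%:R = 2 * ln Y%:R :> R by rewrite natrX lnXn// -[LHS]mulr_natl.
apply: le_trans (@sum_inv_prime_neg X _ (2 * ln Y%:R) _ _); last first.
- move=> p /andP[pp /andP[h1 h2]]; split => //.
  by rewrite -e ler_ln_nat// prime_gt0.
- by lra.
rewrite ler_pdivlMr; last by lra.
have h1 := @chebA_le R Y Y0; have Y20 : (0 < Y ^ 2)%N by rewrite expn_gt0 Y0.
have h2 := @chebA_ge R _ Y20; rewrite e in h2.
have h3 : @chebA R (Y ^ 2) = chebA Y + \sum_(p : 'I_X | prime p && (Y < p <= Y ^ 2)%N) ln (p : nat)%:R / (p : nat)%:R.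
  rewrite {1}/chebA (@big_cat_nat _ _ _ Y.+1)//=; last by rewrite ltnS -mulnn leq_pmulr.
  congr (_ + _); rewrite (@big_nat_widen _ _ _ _ _ X)//.
  rewrite (@big_nat_widenl _ _ _ _ 0%N)//= big_mkord; apply: eq_bigl => p.
  by rewrite ltnS -andbA [(_ <= _)%N && (_ < _)%N]andbC.
rewrite h3 in h2; move: (\sum_(_ | _) _) (chebA Y) (ln _) h1 h2 l28 => s c l; lra.
Qed.

Lemma sum_q_le X (Y p d d' : nat) : 28 <= ln Y%:R :> R -> (Y < p)%N -> (0 < d')%N -> (d' <= d)%N ->
  \sum_(q : 'I_X | prime q && (p * d < q * d' <= 2 ^ 16 * (p * d))%N) (q : nat)%:R^-1 <= 26 / ln Y%:R :> R.
Proof.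
move=> l28 Yp d'0 d'd; have Y0 := ltnW (ln28_gt1 l28).
have y0 : 0 < Y%:R :> R by rewrite ltr0n.
have D'0 : 0 < d'%:R :> R by rewrite ltr0n.
have pd0 : 0 < (p * d)%:R :> R by rewrite ltr0n muln_gt0 (leq_trans d'0 d'd) (leq_ltn_trans _ Yp).
have x0 : 0 < (p * d)%:R / d'%:R :> R by rewrite divr_gt0.
have lY : 0 < ln Y%:R :> R by lra.
apply: le_trans (@sum_inv_window_le X _ (ln Y%:R) ((p * d)%:R / d'%:R) (2 ^+ 16 * ((p * d)%:R / d'%:R)) lY x0 _ _) _.
- by apply: ler_peMl; [exact: ltW|rewrite -natrX ler1n expn_gt0].
- move=> q /andP[pq /andP[h1 h2]]; split => //.
    apply: ler_ln_nat => //; apply: ltnW.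
    have : (p * d' <= p * d)%N by rewrite leq_mul2l d'd orbT.
    move: h1 Yp d'0; clear; nia.
  by rewrite mulrA -natrX -natrM ler_pdivrMr// ler_pdivlMr// -!natrM !ler_nat ltnW.
rewrite mulfK ?gt_eqF// ler_pM2r ?invr_gt0//.
by have := ln_2p16; move: (ln _) => u; lra.
Qed.

Lemma sum_q_ge X (Y p d d' : nat) : (1 < Y)%N -> (0 < p)%N -> (0 < d')%N -> (d' <= d)%N -> (2 ^ 16 * (p * d) <= Y ^ 4)%N -> (Y ^ 4 < X)%N ->
  (4 * ln Y%:R)^-1 <= \sum_(q : 'I_X | prime q && (p * d < q * d' <= 2 ^ 16 * (p * d))%N) (q : nat)%:R^-1 :> R.
Proof.
move=> Y1 p0 d'0 d'd hY YX.
have lY : 0 < ln Y%:R :> R by apply: ln_gt0; rewrite ltr1n.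
have l4 : ln (Y ^ 4)%:R = 4 * ln Y%:R :> R by rewrite natrX lnXn ?ltr0n 1?ltnW// -[LHS]mulr_natl.
have qle (q : nat) : (q * d' <= 2 ^ 16 * (p * d))%N -> (q <= Y ^ 4)%N.
  by move=> h; apply: leq_trans hY; apply: leq_trans h; rewrite leq_pmulr.
apply: le_trans (@sum_inv_prime_neg X _ (4 * ln Y%:R) _ _); last first.
- move=> q /andP[pq /andP[h1 h2]]; split => //.
  by rewrite -l4; apply: ler_ln_nat; [exact: prime_gt0|exact: qle].
- by rewrite mulr_gt0.
rewrite -[leLHS]mul1r; apply: ler_wpM2r; first by rewrite invr_ge0 mulr_ge0// ltW.
set n := (p * d %/ d')%N; set m := (2 ^ 16 * (p * d) %/ d')%N.
have n0 : (0 < n)%N by rewrite /n divn_gt0//; apply: leq_trans d'd _; rewrite leq_pmull.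
have nm : (2 ^ 16 * n <= m)%N by rewrite /m leq_divRL// -mulnA leq_mul2l leq_divM orbT.
have mX : (m.+1 <= X)%N by apply: leq_ltn_trans YX; apply: qle; rewrite leq_divM.
apply: le_trans (sum_primes_ge n0 nm) _.
rewrite (@big_nat_widen _ _ _ _ _ X)//.
rewrite (@big_nat_widenl _ _ _ _ 0%N)//= big_mkord.
rewrite le_eqVlt; apply/orP; left; apply/eqP; apply: eq_bigl => q.
rewrite ltnS /n /m leq_divRL// ltn_divLR//.
by rewrite -andbA [(_ <= _)%N && (_ < _)%N]andbC.
Qed.

Definition close (a b : nat) := (a <= 2 ^ 8 * b)%N && (b <= 2 ^ 8 * a)%N.

Lemma closeC a b : close a b = close b a.
Proof. by rewrite /close andbC. Qed.

(** Each window pins [d / d' = d^2 / u] to [q / p] within a factor [2^16]; the square root of that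
    factor is the [2^8] of [close]. *)
Lemma close_of_window u d1 d1' d2 d2' p q : (0 < p)%N -> (0 < d1')%N -> (0 < d2')%N ->
  d1 * d1' = u -> d2 * d2' = u ->
  (p * d1 < q * d1' <= 2 ^ 16 * (p * d1))%N -> (p * d2 < q * d2' <= 2 ^ 16 * (p * d2))%N -> close d1 d2.
Proof.
move=> p0 d10 d20 e1 e2 /andP[h1 h2] /andP[h3 h4].
have main (a a' b b' : nat) : (0 < a')%N -> (0 < b')%N -> a * a' = u -> b * b' = u -> (p * a < q * a')%N -> (q * b' <= 2 ^ 16 * (p * b))%N -> (a <= 2 ^ 8 * b)%N.
  move=> a0 b0 ea eb i1 i2.
  rewrite -leq_sqr expnMn -expnM.
  have s1 : (p * a * b' <= a' * (2 ^ 16 * (p * b)))%N.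
    apply: (@leq_trans (a' * (q * b'))); last by rewrite leq_mul2l i2 orbT.
    by apply: leq_trans (leq_mul (ltnW i1) (leqnn b')) _; rewrite -!mulnA mulnCA.
  have s2 : (a * b' <= 2 ^ 16 * a' * b)%N.
    rewrite -(leq_pmul2l p0); apply: leq_trans (leq_trans s1 _); first by rewrite mulnA.
    by rewrite leq_eqVlt; apply/orP; left; apply/eqP; ring.
  have [u0|u0] := posnP u.
    have : a = 0%N by move: ea a0; rewrite u0; clear; nia.
    by move=> ->.
  have s3 := leq_mul s2 (leqnn (a * b)).
  have E1 : (a * b' * (a * b) = u * a ^ 2)%N by rewrite -eb; ring.
  have E2 : (2 ^ 16 * a' * b * (a * b) = u * (2 ^ 16 * b ^ 2))%N by rewrite -ea; ring.
  by move: s3; rewrite E1 E2 leq_pmul2l.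
by apply/andP; split; [exact: (main d1 d1' d2 d2')|exact: (main d2 d2' d1 d1')].
Qed.

(** Of a subset and its complement at least one is the larger divisor. *)
Lemma card_large_divisors X (U : {set 'I_X}) :
  (2 ^ #|U| <= 2 * #|[set D : {set 'I_X} | (D \subset U) && (pr (U :\: D) <= pr D)%N]|)%N.
Proof.
set A := [set D | _].
have sub : powerset U \subset A :|: ((fun D => U :\: D) @: A).
  apply/subsetP => D; rewrite !inE => DU; rewrite DU /=.
  have [//|/ltnW h] := leqP (pr (U :\: D)) (pr D).
  apply/imsetP; exists (U :\: D); last by rewrite setDDr setDv set0U (setIidPr DU).
  by rewrite inE subsetDl setDDr setDv set0U (setIidPr DU).
rewrite -card_powerset; apply: leq_trans (subset_leq_card sub) _.
apply: leq_trans (leq_card_setU _ _) _.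
by rewrite mul2n -addnn leq_add2l leq_imset_card.
Qed.

End CloseDivisors.

(** * Mean number of pairs of close divisors *)

Section ClosePairs.
Import mathcomp.boot.fintype mathcomp.boot.finset.
Context {R : realType}.
Notation rho := (expR 1 * ln 2 : R).

Definition above X (lev : 'I_X -> nat) l (V : {set 'I_X}) :=
  [set t : {set 'I_X} * {set 'I_X} | [&& t.1 \subset V, t.2 \subset V &
     [forall s in V, (l < lev s)%N ==> ((s \in t.1) == (s \in t.2))]]].

Definition closecnt X (lev : 'I_X -> nat) (r : 'I_X) (V : {set 'I_X}) :=
  #|[set t in above lev (lev r) V | close (r * pr t.1) (pr t.2)]|.

Definition closepairs X (U : {set 'I_X}) :=
  [set t : {set 'I_X} * {set 'I_X} | [&& t.1 \subset U, t.2 \subset U, t.1 != t.2 & close (pr t.1) (pr t.2)]].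

(* Indexes a pair of subsets by the largest element of their symmetric difference. *)
Lemma closepairs_le X (lev : 'I_X -> nat) (U : {set 'I_X}) :
  (forall s r : 'I_X, (s <= r)%N -> (lev s <= lev r)%N) ->
  (#|closepairs U| <= \sum_(r in U) 2 * closecnt lev r (U :\ r))%N.
Proof.
move=> Hlev.
pose A r := [set t in above lev (lev r) (U :\ r) | close (r * pr t.1) (pr t.2)].
pose f r (t : {set 'I_X} * {set 'I_X}) := (r |: t.1, t.2).
pose g r (t : {set 'I_X} * {set 'I_X}) := (t.2, r |: t.1).
apply: (@leq_trans (\sum_(r in U) (#|f r @: A r| + #|g r @: A r|))); last first.
  by apply: leq_sum => r _; rewrite mul2n -addnn leq_add// leq_imset_card.
apply: (@leq_trans (\sum_(r in U) (\sum_t (t \in f r @: A r) + \sum_t (t \in g r @: A r)))); last first.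
  have cardE (S : {set {set 'I_X} * {set 'I_X}}) : (\sum_t (t \in S) = #|S|)%N.
    by rewrite -sum1_card [RHS]big_mkcond; apply: eq_bigr => t _; case: (t \in S).
  by apply: leq_sum => r _; rewrite !cardE.
under eq_bigr do rewrite -big_split /=.
rewrite exchange_big /= -sum1_card big_mkcond /=; apply: leq_sum => -[D1 D2] _.
case: ifP => //; rewrite inE /= => /and4P[D1U D2U D12 cl].
pose S := (D1 :\: D2) :|: (D2 :\: D1).
have [s0 s0S] : exists s, s \in S.
  apply/set0Pn; apply: contraNneq D12 => S0; apply/eqP/setP => t.
  by move/setP: S0 => /(_ t); rewrite !inE; case: (t \in D1); case: (t \in D2).
have [r rS rmax] : exists2 r, r \in S & forall s, s \in S -> (s <= r)%N.
  by exists [arg max_(t > s0 in S) (t : nat)]; case: arg_maxnP => // i iS im s sS; exact: im.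
have SU s : s \in S -> s \in U.
  by rewrite !inE => /orP[] /andP[_]; [move/(subsetP D1U)|move/(subsetP D2U)].
have agree s : (lev r < lev s)%N -> (s \in D1) = (s \in D2).
  move=> h; have : s \notin S by apply/negP => /rmax /Hlev; rewrite leqNgt h.
  by rewrite !inE; case: (s \in D1); case: (s \in D2).
have main (E1 E2 : {set 'I_X}) : E1 \subset U -> E2 \subset U -> r \in E1 -> r \notin E2 ->
   (forall s, (lev r < lev s)%N -> (s \in E1) = (s \in E2)) -> close (pr E1) (pr E2) ->
   (E1 :\ r, E2) \in A r.
  move=> E1U E2U rE1 rE2 ag c; rewrite !inE /= -prU1 ?setD11// setD1K// c andbT.
  apply/and3P; split; first by rewrite setSD.
    by apply/subsetP => s sE; rewrite !inE (subsetP E2U _ sE) andbT; apply: contraNneq rE2 => <-.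
  apply/forallP => s; apply/implyP => sU; apply/implyP => h.
  have sr : s != r by apply: contraTneq h => ->; rewrite ltnn.
  by rewrite !inE sr /= ag.
rewrite (bigD1 r) ?SU//=; apply: leq_trans (leq_addr _ _).
move: rS; rewrite !inE => /orP[/andP[rD2 rD1]|/andP[rD1 rD2]].
  rewrite (_ : (D1, D2) \in f r @: A r)//; apply/imsetP; exists (D1 :\ r, D2); first exact: main.
  by rewrite /f /= setD1K.
rewrite (_ : (D1, D2) \in g r @: A r) ?addn1//; apply/imsetP; exists (D2 :\ r, D1).
  by apply: main => //; [move=> s /agree ->|rewrite closeC].
by rewrite /g /= setD1K.
Qed.

(** A pair is determined by its first member and the part of the second on levels up to [l]. *)
Lemma card_above X (lev : 'I_X -> nat) l (V : {set 'I_X}) :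
  (#|above lev l V| <= 2 ^ #|V| * 2 ^ cnt lev V l.+1)%N.
Proof.
pose f (t : {set 'I_X} * {set 'I_X}) := (t.1, t.2 :&: below lev l.+1).
have inj : {in above lev l V &, injective f}.
  move=> [A B] [A' B']; rewrite !inE /= => /and3P[AV BV /forallP H] /and3P[AV' BV' /forallP H'] [eA eB].
  rewrite /f /= in eA eB; rewrite -eA; rewrite -eA in H'; congr (_, _); apply/setP => s.
  have [sV|sV] := boolP (s \in V); last first.
    by rewrite (contraNF (subsetP BV s))// (contraNF (subsetP BV' s)).
  have := H s; have := H' s; rewrite sV /=.
  case: ltnP => [_ /eqP <- /eqP <- //|h _ _].
  by move/setP: eB => /(_ s); rewrite !inE ltnS h !andbT.
rewrite -(card_in_imset inj).
have sub : f @: above lev l V \subset setX (powerset V) (powerset (V :&: below lev l.+1)).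
  apply/subsetP => t /imsetP[[A B]]; rewrite inE /= => /and3P[AV BV _] ->.
  by rewrite !inE /f /= AV setSI.
by apply: leq_trans (subset_leq_card sub) _; rewrite cardsX !card_powerset.
Qed.

(** Let [r], of level [l], be the largest prime in which two close divisors differ. For given
    remaining parts, closeness confines [r] to a window of mass [O(2^-l)], and [card_above] counts
    the parts. The result is [2^J] times the sums treated by [ballot_weighted_upper]: on average,
    close pairs are no more than a constant times the [2^J] divisors. *)
Lemma closepairs_mass : exists2 C : R, 0 < C & forall i0 J X,
  \sum_(U : {set 'I_X} | [&& U \subset below (bl (R := R) i0 (X:=X)) J, ballot (bl (R := R) i0 (X:=X)) J U & cnt (bl (R := R) i0 (X:=X)) U J == J])
    wt (bx (R := R) i0 (X:=X)) U * #|closepairs U|%:R <= C * 2 ^+ J * (rho ^+ J * dec J).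
Proof.
have [[c1 c2]] := @ln_blk R; rewrite /= => -[c10 c20 Hc].
have [B B0 HB] := @ballot_weighted_upper R.
have d0 k : 0 < dec k :> R by exact: dec_gt0.
have rho1 := @rho_gt1 R; have rho0 : 0 < rho by lra.
exists (52 / c1 * B * 48); first by rewrite !mulr_gt0// invr_gt0.
move=> i0 J X.
set lev := bl (R := R) i0 (X:=X); set x := bx (R := R) i0 (X:=X).
have x0 : forall t, 0 <= x t by exact: bx_ge0.
have Hlev (s r : 'I_X) : (s <= r)%N -> (lev s <= lev r)%N.
  by move=> sr; rewrite /lev /bl leq_sub2r// blk_mono.
pose F (r : 'I_X) V : R := 2 * (closecnt lev r V)%:R.
apply: (@le_trans _ _ (\sum_(U : {set 'I_X} | [&& U \subset below lev J, ballot lev J U & cnt lev U J == J])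
    wt x U * \sum_(r in U) F r (U :\ r))).
  apply: ler_sum => U _; apply: ler_wpM2l; first exact: wt_ge0.
  apply: (@le_trans _ _ (\sum_(r in U) 2 * closecnt lev r (U :\ r))%N%:R); first by rewrite ler_nat closepairs_le.
  by rewrite natr_sum; apply: ler_sum => r _; rewrite natrM.
have := @ballot_mecke R _ x lev J F x0 (fun r V => _).
move=> /(_ (fun r V => mulr_ge0 (ler0n R 2) (ler0n R _))) h; apply: le_trans h _.
have inner (V : {set 'I_X}) : V \subset primeset X -> (cnt lev V J).+1 = J -> V \subset below lev J ->
    \sum_(r in below lev J) x r * F r V <= \sum_(0 <= l < J) 52 / c1 * 2 ^+ J * (2 ^+ cnt lev V l.+1 / 2 ^+ l.+1).
  move=> VP cV VB; rewrite sum_below big_nat [leRHS]big_nat; apply: ler_sum => l /andP[_ lJ].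
  have L0 : 0 < c1 * 2 ^+ l by rewrite mulr_gt0// exprn_gt0.
  have one (t : {set 'I_X} * {set 'I_X}) : t \in above lev l V ->
     \sum_(r in level lev l) x r * (close (r * pr t.1) (pr t.2))%:R <= 26 / (c1 * 2 ^+ l).
    case: t => E1 E2; rewrite inE /= => /and3P[E1V E2V _].
    have e1 : 0 < (pr E1)%:R :> R by rewrite ltr0n pr_gt0// (subset_trans E1V).
    have e2 : 0 < (pr E2)%:R :> R by rewrite ltr0n pr_gt0// (subset_trans E2V).
    pose a : R := (pr E2)%:R / (2 ^+ 8 * (pr E1)%:R).
    have K0 : 0 < 2 ^+ 8 :> R by rewrite exprn_gt0.
    have a0 : 0 < a by rewrite divr_gt0// mulr_gt0.
    apply: (@le_trans _ _ ((ln (2 ^+ 16 * a / a) + 10) / (c1 * 2 ^+ l))); last first.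
      rewrite mulfK ?gt_eqF// ler_pM2r ?invr_gt0//.
      by have := @ln_2p16 R; move: (ln _) => u; lra.
    apply: le_trans (sum_inv_window_le (P := fun r : 'I_X => [&& r \in level lev l, (i0 <= @blk R r)%N, prime r & close (r * pr E1) (pr E2)]) L0 a0 _ _).
    - rewrite big_mkcond [leRHS]big_mkcond; apply: ler_sum => r _ /=.
      case: (r \in level lev l) => //=; rewrite /x /bx /xinv.
      case: (i0 <= blk r)%N; rewrite ?mul0r//=; case: (prime r); rewrite ?mul0r//=.
      by case: (close _ _); rewrite ?mulr1 ?mulr0.
    - by apply: ler_peMl; [exact: ltW|rewrite -natrX ler1n expn_gt0].
    - move=> r /and4P[rl ir rp /andP[h1 h2]]; split => //.
        have /andP[h3 _] := Hc r (prime_gt1 rp); apply: le_trans h3.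
        apply: ler_wpM2l; first by nng.
        apply: ler_weXn2l; first by rewrite ler1n.
        by move: rl; rewrite inE /lev /bl => /eqP <-; rewrite leq_subr.
      rewrite /a; apply/andP; split.
        rewrite ler_pdivrMr ?mulr_gt0// -natrX -!natrM ler_nat; apply: leq_trans h2 _.
        by rewrite leq_eqVlt; apply/orP; left; apply/eqP; ring.
      rewrite mulrA ler_pdivlMr ?mulr_gt0//.
      rewrite -!natrX -!natrM ler_nat.
      rewrite [X in (_ <= X * _)%N](_ : _ = 2 ^ 8 * 2 ^ 8)%N; last by rewrite -expnD.
      by rewrite mulnCA -[X in (_ <= X)%N]mulnA leq_mul2l h1 orbT.
  apply: (@le_trans _ _ (\sum_(t in above lev l V) 2 * \sum_(r in level lev l) x r * (close (r * pr t.1) (pr t.2))%:R)).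
    rewrite -mulr_sumr exchange_big /= mulr_sumr; apply: ler_sum => r rl.
    rewrite -mulr_sumr /F /closecnt.
    rewrite [leLHS](_ : _ = 2 * (x r * #|[set t in above lev (lev r) V | close (r * pr t.1) (pr t.2)]|%:R)); last by ring.
    apply: ler_wpM2l => //; apply: ler_wpM2l => //.
    move: rl; rewrite inE => /eqP ->; rewrite -sum1_card natr_sum big_mkcond [leRHS]big_mkcond.
    apply: ler_sum => t _ /=; rewrite [t \in [set _ in _ | _]]inE.
    by case: (t \in above _ _ _) => //=; case: (close _ _).
  apply: (@le_trans _ _ (\sum_(t in above lev l V) 2 * (26 / (c1 * 2 ^+ l)))).
    by apply: ler_sum => t tA; apply: ler_wpM2l => //; exact: one.
  rewrite sumr_const -[leLHS]mulr_natl.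
  apply: (@le_trans _ _ ((2 ^ #|V| * 2 ^ cnt lev V l.+1)%:R * (2 * (26 / (c1 * 2 ^+ l))))).
    by apply: ler_wpM2r; [nng|rewrite ler_nat card_above].
  have eJ : 2 ^+ J = 2 * 2 ^+ #|V| :> R by rewrite -(cnt_sub VB) -exprS cV.
  rewrite eJ natrM !natrX exprS le_eqVlt; apply/orP; left; apply/eqP.
  move: (2 ^+ #|V| : R) (2 ^+ cnt lev V l.+1 : R) (2 ^+ l : R) (exprn_gt0 l (ltr0Sn R 1)) c10 => u v w w0 c0; clear -w0 c0.
  by field; rewrite !gt_eqF.
apply: (@le_trans _ _ (\sum_(V : {set 'I_X} | [&& V \subset below lev J, ballot lev J V & (cnt lev V J).+1 == J])
   52 / c1 * 2 ^+ J * \sum_(0 <= l < J) wt x V * 2 ^- (l.+1 - cnt lev V l.+1))).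
  apply: ler_sum => V /and3P[VB bV /eqP cV].
  have [VP|VP] := boolP (V \subset primeset X); last first.
    suff -> : wt x V = 0 by rewrite mul0r; apply: mulr_ge0; [nng|apply: sumr_ge0 => l _; nng].
    case/subsetPn: VP => t tV; rewrite inE => tp.
    by rewrite /wt (bigD1 t)//= /x /bx /xinv (negbTE tp) if_same mul0r.
  apply: le_trans (ler_wpM2l (wt_ge0 V x0) (inner V VP cV VB)) _.
  rewrite -!mulr_sumr mulrCA; apply: ler_wpM2l; first by nng.
  apply: ler_wpM2l; first exact: wt_ge0.
  rewrite big_nat [leRHS]big_nat; apply: ler_sum => l /andP[_ lJ].
  have cl : (cnt lev V l.+1 <= l.+1)%N by apply: (ballotP _ _ _ bV).
  rewrite -{2}(subnK cl) exprD invfM mulrCA divff ?mulr1//.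
rewrite -mulr_sumr exchange_big /=.
apply: (@le_trans _ _ (52 / c1 * 2 ^+ J * \sum_(0 <= l < J) B * rho ^+ J * (dec l.+1 * dec (J - l.+1)))).
  apply: ler_wpM2l; first by nng.
  rewrite big_nat [leRHS]big_nat; apply: ler_sum => l /andP[_ lJ].
  exact: (HB _ x lev J l.+1 x0 (fun l _ => level_bx_le i0 X l) lJ).
rewrite -mulr_sumr.
rewrite [leRHS](_ : _ = 52 / c1 * 2 ^+ J * (B * rho ^+ J * (48 * dec J))); last by ring.
apply: ler_wpM2l; first by nng.
apply: ler_wpM2l; first by nng.
have := @sum_dec_conv R J; rewrite big_nat_recl//= => h; apply: le_trans h.
by rewrite lerDr mulr_ge0// ltW.
Qed.

End ClosePairs.

(** * Second moment construction of the denominators *)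

Section CloseProducts.
Import mathcomp.boot.fintype mathcomp.boot.finset.
Context {R : realType}.
Notation rho := (expR 1 * ln 2 : R).

(** The extra primes correct the ratio of the complementary divisors, so that [p * pr D] and
    [q * pr (U :\: D)] are within [2^16]. Requiring [D] to be the larger half forces [p < q], which
    tells the two primes apart. *)
Definition window X (p q : nat) (U : {set 'I_X}) :=
  [set D : {set 'I_X} | [&& D \subset U, (pr (U :\: D) <= pr D)%N &
     (p * pr D < q * pr (U :\: D) <= 2 ^ 16 * (p * pr D))%N]].

(** At least half of the subsets are admissible [D]; for each, [p] has mass at least 1/4 and then
    [q] at least [1 / (4 ln Y)]. Thus [32 = 2 * 4 * 4]. *)
Lemma window_mass_ge X Y (U : {set 'I_X}) : 28 <= ln Y%:R :> R -> (2 ^ 16 <= Y)%N -> (Y ^ 4 < X)%N ->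
  U \subset primeset X -> (pr U <= Y)%N ->
  2 ^+ #|U| / (32 * ln Y%:R) <=
  \sum_(p : 'I_X | prime p && (Y < p <= Y ^ 2)%N) \sum_(q : 'I_X | prime q)
     (p : nat)%:R^-1 * (q : nat)%:R^-1 * #|window p q U|%:R :> R.
Proof.
move=> l28 Y16 YX UP uY.
have Y1 := ln28_gt1 l28.
have lY : 0 < ln Y%:R :> R by lra.
pose A := [set D : {set 'I_X} | (D \subset U) && (pr (U :\: D) <= pr D)%N].
have Y2X : (Y ^ 2 < X)%N by apply: leq_ltn_trans YX; rewrite leq_exp2l.
apply: (@le_trans _ _ (\sum_(D in A) \sum_(p : 'I_X | prime p && (Y < p <= Y ^ 2)%N) (p : nat)%:R^-1 * (4 * ln Y%:R)^-1)).
  apply: (@le_trans _ _ (\sum_(D in A) 1 / 4 * (4 * ln Y%:R)^-1)).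
    rewrite sumr_const -[leRHS]mulr_natr.
    have h := @card_large_divisors X U; rewrite -/A in h.
    have {}h : 2 ^+ #|U| <= 2 * #|A|%:R :> R by rewrite -natrX -natrM ler_nat.
    rewrite ler_pdivrMr ?mulr_gt0//.
    rewrite [leRHS](_ : _ = 2 * #|A|%:R)//; field.
    by rewrite gt_eqF.
  apply: ler_sum => D _; rewrite -mulr_suml; apply: ler_wpM2r.
    by rewrite invr_ge0 mulr_ge0// ltW.
  exact: sum_p_ge.
rewrite exchange_big /=; apply: ler_sum => p /andP[pp /andP[Yp pY2]].
apply: (@le_trans _ _ (\sum_(D in A) (p : nat)%:R^-1 * \sum_(q : 'I_X | prime q && (p * pr D < q * pr (U :\: D) <= 2 ^ 16 * (p * pr D))%N) (q : nat)%:R^-1)).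
  apply: ler_sum => D; rewrite inE => /andP[DU dd]; apply: ler_wpM2l; first by nng.
  have d'0 : (0 < pr (U :\: D))%N by rewrite pr_gt0// (subset_trans _ UP)// subsetDl.
  have dY : (pr D <= Y)%N by apply: leq_trans uY; rewrite (prD DU) leq_pmulr.
  apply: sum_q_ge => //; first exact: prime_gt0.
  apply: (@leq_trans (Y * (Y ^ 2 * Y))); last by rewrite -expnSr -expnS.
  by rewrite leq_mul// leq_mul.
rewrite -mulr_sumr.
under [leRHS]eq_bigr do rewrite -mulrA.
rewrite -mulr_sumr; apply: ler_wpM2l; first by nng.
rewrite (exchange_big_dep (fun q : 'I_X => prime q)) /=; last by move=> D q _ /andP[].
apply: ler_sum => q pq; rewrite sumr_const -[leLHS]mulr_natr; apply: ler_wpM2l; first by nng.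
rewrite ler_nat; apply: subset_leq_card; apply/subsetP => D.
by rewrite unfold_in /= !inE pq /= => /andP[/andP[-> ->] ->].
Qed.

(** Two sets in one window are equal or close, by [close_of_window]. For each such pair the sum over
    [p] and [q] is at most [2 * 26 / ln Y]. *)
Lemma window_square_le X Y (U : {set 'I_X}) : 28 <= ln Y%:R :> R -> U \subset primeset X ->
  \sum_(p : 'I_X | prime p && (Y < p <= Y ^ 2)%N) \sum_(q : 'I_X | prime q)
     (p : nat)%:R^-1 * (q : nat)%:R^-1 * #|window p q U|%:R ^+ 2 <=
  52 / ln Y%:R * (2 ^+ #|U| + #|closepairs U|%:R) :> R.
Proof.
move=> l28 UP; have lY : 0 < ln Y%:R :> R by lra.
pose E := [set t : {set 'I_X} * {set 'I_X} | [&& t.1 \subset U, t.2 \subset U & (pr (U :\: t.1) <= pr t.1)%N && ((t.1 == t.2) || close (pr t.1) (pr t.2))]].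
have cE : (#|E| <= 2 ^ #|U| + #|closepairs U|)%N.
  have sub : E \subset [set (D, D) | D in powerset U] :|: closepairs U.
    apply/subsetP => -[D1 D2]; rewrite !inE /= => /and3P[h1 h2 /andP[_]] /=; move: h1.
    case: eqP => [-> + _|_ h1 /= ->]; last by rewrite h1 h2 orbT.
    by move=> D2U; apply/orP; left; apply/imsetP; exists D2 => //; rewrite powersetE.
  apply: leq_trans (subset_leq_card sub) _; apply: leq_trans (leq_card_setU _ _) _.
  by rewrite leq_add2r -card_powerset leq_imset_card.
apply: (@le_trans _ _ (\sum_(t in E) \sum_(p : 'I_X | prime p && (Y < p <= Y ^ 2)%N) (p : nat)%:R^-1 *
   \sum_(q : 'I_X | prime q && (p * pr t.1 < q * pr (U :\: t.1) <= 2 ^ 16 * (p * pr t.1))%N) (q : nat)%:R^-1)).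
  rewrite [leRHS]exchange_big /=; apply: ler_sum => p /andP[pp _].
  rewrite -[leRHS]mulr_sumr; under eq_bigr do rewrite -mulrA.
  rewrite -[leLHS]mulr_sumr; apply: ler_wpM2l; first by nng.
  rewrite (exchange_big_dep (fun q : 'I_X => prime q)) /=; last by move=> D q _ /andP[].
  apply: ler_sum => q pq; rewrite sumr_const -[leRHS]mulr_natr; apply: ler_wpM2l; first by nng.
  rewrite -natrX ler_nat -mulnn -cardsX; apply: subset_leq_card; apply/subsetP => -[D1 D2].
  rewrite !inE /= => /andP[/and3P[h1 h2 h3] /and3P[h4 h5 h6]].
  rewrite unfold_in /= !inE /= h1 h4 h2 pq h3 /= andbT.
  have d0 (D : {set 'I_X}) : (0 < pr (U :\: D))%N by rewrite pr_gt0// (subset_trans _ UP)// subsetDl.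
  by rewrite (close_of_window (prime_gt0 pp) (d0 D1) (d0 D2) (esym (prD h1)) (esym (prD h4)) h3 h6) orbT.
apply: (@le_trans _ _ (\sum_(t in E) 52 / ln Y%:R)); last first.
  rewrite sumr_const -[leLHS]mulr_natr; apply: ler_wpM2l; first by rewrite divr_ge0// ltW.
  by rewrite -natrX -natrD ler_nat.
apply: ler_sum => -[D1 D2]; rewrite inE /= => /and3P[h1 h2 /andP[h3 _]].
have d0 : (0 < pr (U :\: D1))%N by rewrite pr_gt0// (subset_trans _ UP)// subsetDl.
apply: (@le_trans _ _ (\sum_(p : 'I_X | prime p && (Y < p <= Y ^ 2)%N) (p : nat)%:R^-1 * (26 / ln Y%:R))).
  apply: ler_sum => p /andP[pp /andP[Yp _]]; apply: ler_wpM2l; first by nng.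
  exact: sum_q_le.
rewrite -mulr_suml; have h := @sum_p_le R X Y l28.
apply: le_trans (ler_wpM2r _ h) _; first by rewrite divr_ge0// ltW.
by rewrite le_eqVlt; apply/orP; left; apply/eqP; field; rewrite gt_eqF.
Qed.

(* Ballot sets have few small primes, so [totient (pr U) / pr U] stays bounded below. *)
Lemma ballot_sum_inv_le i0 J X (U : {set 'I_X}) :
  (forall n, \sum_(0 <= l < n) l.+1%:R * (6 / 7) ^+ (i0 + l) <= 1 / 8 :> R) ->
  U \subset below (bl (R := R) i0 (X:=X)) J -> ballot (bl (R := R) i0 (X:=X)) J U ->
  \sum_(r in U) bx (R := R) i0 r <= 1 / 8.
Proof.
move=> H UB bU; apply: le_trans (H J).
have -> : \sum_(r in U) bx (R := R) i0 r = \sum_(r in below (bl (R := R) i0 (X:=X)) J) (if r \in U then bx (R := R) i0 r else 0).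
  rewrite -[RHS]big_mkcondr; apply: eq_bigl => r; rewrite andbC; case: (boolP (r \in U)) => // rU.
  by rewrite (subsetP UB).
rewrite sum_below big_nat [leRHS]big_nat; apply: ler_sum => l /andP[_ lJ].
rewrite -big_mkcondr.
apply: (@le_trans _ _ (\sum_(r in U :&: level (bl (R := R) i0 (X:=X)) l) (6 / 7) ^+ (i0 + l))).
  rewrite (eq_bigl (fun r => r \in U :&: level (bl (R := R) i0 (X:=X)) l)); last by move=> r; rewrite !inE andbC.
  by apply: ler_sum => r; rewrite in_setI => /andP[_]; exact: bx_level_le.
rewrite sumr_const -[leLHS]mulr_natl; apply: ler_wpM2r; first by apply: exprn_ge0; lra.
rewrite ler_nat; apply: leq_trans ((ballotP _ _ _ bU) l.+1 lJ).
by rewrite cntS leq_addl.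
Qed.

(* Second moment: [sum [r > 0] >= 2 t sum r - t^2 sum r^2], where [r] counts the
   sets in [window]. *)
Theorem close_products : exists (m : nat) (c : R), [/\ (0 < m)%N, 0 < c & forall J, exists Z : seq nat,
  [/\ uniq Z, forall z, z \in Z -> [/\ (2 ^ (m * 2 ^ J) <= z <= 2 ^ (7 * (m * 2 ^ J)))%N, (z <= 2 * totient z)%N &
     exists a b, [/\ (0 < a)%N, (a < b)%N, (b <= 2 ^ 16 * a)%N & z = (a * b)%N]] &
   c * (rho ^+ J * dec J) <= \sum_(z <- Z) z%:R^-1]].
Proof.
have [i0 [m0 [m00 [Hphi Hmass]]]] := @good_mass R.
have [C C0 HC] := @closepairs_mass R.
have l2 : 1 / 2 < ln 2 :> R := @ln2_gt R.
(* The 56 gives [ln Y >= 56 ln 2 > 28] and [2^16 <= Y]; [m0] is the size bound from [good_mass]. *)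
pose m := (m0 + 56)%N.
have m0' : 0 < m%:R :> R by rewrite ltr0n /m addn_gt0 m00.
(* [kap] is [2^J / ln Y], so the constants [a] and [b] of the first and second moments do not depend
   on [J]. *)
pose kap : R := (m%:R * ln 2)^-1.
have kap0 : 0 < kap by rewrite invr_gt0 mulr_gt0//; lra.
pose a : R := kap / 32; pose b : R := 52 * kap * (1 + 4 * C).
have a0 : 0 < a by rewrite divr_gt0.
have b0 : 0 < b by rewrite /b; apply: mulr_gt0; [rewrite mulr_gt0|lra].
exists m, (a ^+ 2 / b / 4); split; first by rewrite /m addn_gt0 m00.
  by rewrite !divr_gt0// exprn_gt0.
move=> J.
pose Y := (2 ^ (m * 2 ^ J))%N.
have TJ : (0 < 2 ^ J)%N by rewrite expn_gt0.
have Y16 : (2 ^ 16 <= Y)%N by rewrite leq_exp2l//; move: TJ; rewrite /m; move: (2 ^ J)%N => k; clear; nia.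
have Y1 : (1 < Y)%N by apply: leq_trans Y16; rewrite -[2%N]/(2 ^ 1)%N leq_exp2l.
have lnY : ln Y%:R = 2 ^+ J / kap :> R.
  by rewrite /Y ln_pow2 natrM natrX /kap invrK; ring.
have l28 : 28 <= ln Y%:R :> R.
  rewrite lnY /kap invrK.
  have h1 : 56 <= m%:R :> R by rewrite ler_nat /m leq_addl.
  have h2 : 1 <= 2 ^+ J :> R by rewrite -natrX ler1n.
  have h3 : 28 <= m%:R * ln 2 :> R by clear -h1 l2; nra.
  by move: (m%:R * ln 2) (2 ^+ J) h3 h2 => u v; clear; nra.
have lY : 0 < ln Y%:R :> R by lra.
have [n0 Hn0] := @blk_unbounded R (i0 + J).
pose X := (maxn (Y ^ 4) n0).+1.
have YX : (Y ^ 4 < X)%N by rewrite /X ltnS leq_maxl.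
have HJ : (i0 + J <= @blk R X.-1)%N by apply: leq_trans Hn0 _; apply: blk_mono; rewrite leq_maxr.
set lev := bl (R := R) i0 (X:=X); set x := bx (R := R) i0 (X:=X).
have {}Hmass := Hmass J X isT HJ; rewrite -/lev -/x in Hmass.
have {}HC := HC i0 J X; rewrite -/lev -/x in HC.
pose B (U : {set 'I_X}) := [&& U \subset below lev J, ballot lev J U & cnt lev U J == J].
pose V (U : {set 'I_X}) := (U \subset primeset X) && [forall t in U, i0 <= @blk R t]%N.
pose G (U : {set 'I_X}) := [&& B U, V U & (pr U <= Y)%N].
have wtV U : V U -> wt x U = (pr U)%:R^-1.
  move=> /andP[UP /forallP Ub]; rewrite -wt_pr//; apply: eq_bigr => t tU.
  by have := Ub t; rewrite tU /= /x /bx => ->.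
have wtN U : ~~ V U -> wt x U = 0.
  rewrite negb_and => /orP[/subsetPn[t tU]|].
    by rewrite inE => tp; rewrite /wt (bigD1 t)//= /x /bx /xinv (negbTE tp) if_same mul0r.
  rewrite negb_forall => /existsP[t]; rewrite negb_imply => /andP[tU tb].
  by rewrite /wt (bigD1 t)//= /x /bx (negbTE tb) mul0r.
pose S : R := \sum_(U | G U) (pr U)%:R^-1.
have S1 : 1 / 4 * (rho ^+ J * dec J) <= S.
  apply: le_trans Hmass _; rewrite /S big_mkcond [leRHS]big_mkcond; apply: ler_sum => U _.
  rewrite -/(B U) /G.
  have [VU|VU] := boolP (V U); last by rewrite wtN// !if_same; case: ifP.
  have [UP _] := andP VU; rewrite UP /=; case: (B U) => //=.
  case: ifP => h; last by case: ifP.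
  rewrite wtV// ifT//.
  have u0 := pr_gt0 UP.
  apply: (@leq_trans (pr U ^ 2)); first by rewrite -mulnn leq_pmulr.
  by apply: leq_trans h _; rewrite leq_exp2l// leq_mul2r /m leq_addr orbT.
have S0 : 0 <= S by apply: sumr_ge0 => U _.
have SC : \sum_(U | G U) (pr U)%:R^-1 * #|closepairs U|%:R <= C * 2 ^+ J * (rho ^+ J * dec J).
  apply: le_trans HC; rewrite big_mkcond [leRHS]big_mkcond; apply: ler_sum => U _.
  have wx : 0 <= wt x U by apply: wt_ge0; exact: bx_ge0.
  rewrite /G -/(B U); case: (B U) => //=; case: (boolP (V U)) => //= VU; last by nng.
  by rewrite wtV//; case: ifP => // _; nng.
pose Pp (p : 'I_X) := prime p && (Y < p <= Y ^ 2)%N.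
have GP U : G U -> [/\ U \subset primeset X, (pr U <= Y)%N, #|U| = J & \sum_(r in U) (r : nat)%:R^-1 <= 1 / 8 :> R].
  case/and3P => /and3P[UB bU /eqP cU] /andP[UP /forallP Ub] uY; split => //.
    by rewrite -cU (cnt_sub UB).
  apply: le_trans (ballot_sum_inv_le Hphi UB bU).
  rewrite le_eqVlt; apply/orP; left; apply/eqP; apply: eq_bigr => r rU.
  have := Ub r; rewrite rU /= /bx /xinv => ->.
  by have := subsetP UP r rU; rewrite inE => ->.
pose om (U : {set 'I_X}) (p q : 'I_X) : R := (pr U)%:R^-1 * ((p : nat)%:R^-1 * (q : nat)%:R^-1).
pose sm (f : {set 'I_X} -> 'I_X -> 'I_X -> R) := \sum_(U | G U) \sum_(p | Pp p) \sum_(q : 'I_X | prime q) om U p q * f U p q.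
have N1 : a * S <= sm (fun U p q => #|window p q U|%:R).
  rewrite /S mulr_sumr; apply: ler_sum => U /GP[UP uY cU _].
  have h := window_mass_ge l28 Y16 YX UP uY.
  rewrite mulrC.
  apply: (@le_trans _ _ ((pr U)%:R^-1 * (2 ^+ #|U| / (32 * ln Y%:R)))).
    apply: ler_wpM2l; first by nng.
    rewrite le_eqVlt; apply/orP; left; apply/eqP; rewrite cU lnY /a; field.
    by rewrite gt_eqF//= expf_neq0.
  apply: le_trans (ler_wpM2l _ h) _; first by nng.
  rewrite mulr_sumr; apply: ler_sum => p _; rewrite mulr_sumr; apply: ler_sum => q _.
  by rewrite le_eqVlt; apply/orP; left; apply/eqP; rewrite /om; ring.
have N2 : sm (fun U p q => #|window p q U|%:R ^+ 2) <= b * S.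
  apply: (@le_trans _ _ (\sum_(U | G U) 52 / ln Y%:R * ((pr U)%:R^-1 * 2 ^+ J + (pr U)%:R^-1 * #|closepairs U|%:R))).
    apply: ler_sum => U /GP[UP uY cU _].
    have h := window_square_le l28 UP; rewrite cU in h.
    rewrite -mulrDr mulrCA; apply: le_trans (ler_wpM2l _ h); last by nng.
    rewrite mulr_sumr; apply: ler_sum => p _; rewrite mulr_sumr; apply: ler_sum => q _.
    by rewrite le_eqVlt; apply/orP; left; apply/eqP; rewrite /om; ring.
  rewrite -mulr_sumr big_split /= -mulr_suml -/S.
  have lY' : 0 <= 52 / ln Y%:R :> R by rewrite divr_ge0// ltW.
  apply: (@le_trans _ _ (52 / ln Y%:R * (S * 2 ^+ J + C * 2 ^+ J * (4 * S)))).
    apply: ler_wpM2l => //; rewrite lerD2l; apply: le_trans SC _; apply: ler_wpM2l; first by nng.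
    by move: S1; move: (rho ^+ J * dec J) (S) => u v; clear; lra.
  rewrite lnY /b le_eqVlt; apply/orP; left; apply/eqP; field.
  by rewrite gt_eqF//= expf_neq0.
pose T := [set t : {set 'I_X} * ('I_X * 'I_X) | [&& G t.1, Pp t.2.1, prime t.2.2 & window t.2.1 t.2.2 t.1 != set0]].
pose zf (t : {set 'I_X} * ('I_X * 'I_X)) := (pr t.1 * (t.2.1 * t.2.2))%N.
have TP t : t \in T -> [/\ G t.1, prime t.2.1, prime t.2.2, (Y < t.2.1 < t.2.2)%N & (t.2.1 <= Y ^ 2)%N /\
   exists2 D : {set 'I_X}, D \subset t.1 & (t.2.1 * pr D < t.2.2 * pr (t.1 :\: D) <= 2 ^ 16 * (t.2.1 * pr D))%N].
  case: t => U [p q]; rewrite inE /= => /and4P[GU /andP[pp /andP[h1 h2]] pq /set0Pn[D]].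
  rewrite inE => /and3P[DU dd w]; split => //; last by split => //; exists D.
  rewrite h1 /=; case/andP: w => w _.
  have [UP _ _ _] := GP U GU.
  have d'0 : (0 < pr (U :\: D))%N by rewrite pr_gt0// (subset_trans _ UP)// subsetDl.
  rewrite -(ltn_pmul2r d'0); apply: leq_ltn_trans w.
  by rewrite leq_mul2l dd orbT.
have setE t : t \in T -> exists2 W : {set 'I_X}, W \subset primeset X & [/\ zf t = pr W, W = t.2.1 |: (t.2.2 |: t.1),
   forall r, (r \in t.1) = (r \in W) && (r <= Y)%N & \sum_(r in W) (r : nat)%:R^-1 <= 1 / 2 :> R].
  move=> /TP; case: t => U [p q] /= [GU pp pq /andP[h1 h2] _].
  have [UP uY _ sU] := GP U GU.
  have rY r : r \in U -> (r <= Y)%N.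
    move=> rU; apply: leq_trans uY; rewrite /pr (bigD1 r)//= leq_pmulr//.
    apply: prodn_cond_gt0 => s /andP[sU' _]; have := subsetP UP s sU'; by rewrite inE => /prime_gt0.
  have qU : q \notin U by apply/negP => /rY; rewrite leqNgt (ltn_trans h1 h2).
  have pU : p \notin q |: U.
    rewrite !inE negb_or; apply/andP; split; first by apply/eqP => e; move: h2; rewrite e ltnn.
    by apply/negP => /rY; rewrite leqNgt h1.
  exists (p |: (q |: U)); first by rewrite !subUset !sub1set !inE pp pq.
  split => //.
  - by rewrite /zf /= !prU1//; ring.
  - move=> r; rewrite !inE; case: eqP => [->|_] /=.
      by rewrite [RHS]leqNgt h1; apply/negP => /rY; rewrite leqNgt h1.
    case: eqP => [->|_] /=.
      by rewrite [RHS]leqNgt (ltn_trans h1 h2); apply/negP; exact/negP.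
    by case: (boolP (r \in U)) => //= /rY ->.
  - rewrite !big_setU1//= ?addrA.
    have Y8 : (8 <= Y)%N by apply: leq_trans Y16; rewrite -[8%N]/(2 ^ 3)%N leq_exp2l.
    have inv8 (r : nat) : (Y < r)%N -> r%:R^-1 <= 8^-1 :> R.
      by move=> h; rewrite lef_pV2 ?posrE ?ltr0n ?(leq_trans _ h)// ler_nat (leq_trans Y8)// ltnW.
    have := inv8 p h1; have := inv8 q (ltn_trans h1 h2); move: sU.
    by move: ((q : nat)%:R^-1) ((p : nat)%:R^-1) (\sum_(_ in _) _) => u v w; clear; lra.
(* [zf t] determines its set of primes [W]; those up to [Y] form the set, and of the other two the
   smaller is [p]. *)
have Tinj : {in T &, injective zf}.
  move=> t s tT sT e.
  have [W WP [e1 eW e2 _]] := setE t tT; have [W' WP' [e1' eW' e2' _]] := setE s sT.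
  have WW : W = W' by apply: pr_inj => //; rewrite -e1 -e1'.
  have [_ _ _ /andP[h1 h2] _] := TP t tT; have [_ _ _ /andP[h1' h2'] _] := TP s sT.
  have U1 : t.1 = s.1 by apply/setP => r; rewrite e2 e2' WW.
  have mem (r : 'I_X) : (Y < r)%N -> r \in W -> r = t.2.1 \/ r = t.2.2.
    move=> Yr; rewrite eW !inE => /or3P[/eqP|/eqP|]; [by left|by right|].
    by rewrite e2 [(r <= Y)%N]leqNgt Yr andbF.
  have m1 : s.2.1 \in W by rewrite WW eW' !inE eqxx.
  have m2 : s.2.2 \in W by rewrite WW eW' !inE eqxx orbT.
  case: t s {tT sT e e1 e1' e2 e2' eW eW'} U1 h1 h2 h1' h2' mem m1 m2 => U [p q] [U' [p' q']] /= -> h1 h2 h1' h2' mem m1 m2.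
  case: (mem p' h1' m1) => e; case: (mem q' (ltn_trans h1' h2') m2) => e'.
  - by move: h2'; rewrite e e' ltnn.
  - by rewrite e e'.
  - by move: h2'; rewrite e e' => h; have := ltn_trans h2 h; rewrite ltnn.
  - by move: h2'; rewrite e e' ltnn.
exists [seq zf t | t <- enum T]; split.
- rewrite map_inj_in_uniq ?enum_uniq// => t s; rewrite !mem_enum; exact: Tinj.
- move=> z /mapP[t]; rewrite mem_enum => tT ->.
  have [GU pp pq /andP[h1 h2] [h3 [D DU /andP[w1 w2]]]] := TP t tT.
  have [W WP [e1 _ _ sW]] := setE t tT.
  have [UP uY _ _] := GP _ GU.
  have u0 := pr_gt0 UP.
  have d'0 : (0 < pr (t.1 :\: D))%N by rewrite pr_gt0// (subset_trans _ UP)// subsetDl.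
  have d0 : (0 < pr D)%N by rewrite pr_gt0// (subset_trans DU).
  have dY : (pr D <= Y)%N by apply: leq_trans uY; rewrite (prD DU) leq_pmulr.
  split.
  + apply/andP; split.
      apply: leq_trans (ltnW h1) _; rewrite /zf mulnCA leq_pmulr// muln_gt0 u0 prime_gt0//.
    have -> : (2 ^ (7 * (m * 2 ^ J)) = Y * (Y ^ 2 * Y ^ 4))%N.
      by rewrite -expnD -expnS /Y -expnM mulnC.
    rewrite /zf leq_mul// leq_mul//.
    apply: (@leq_trans (t.2.2 * pr (t.1 :\: D))); first by rewrite leq_pmulr.
    apply: leq_trans w2 _.
    apply: (@leq_trans (Y * (Y ^ 2 * Y))); last by rewrite -expnSr -expnS.
    by rewrite leq_mul// leq_mul.
  + have := @totient_pr R _ _ WP; rewrite -e1 => h.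
    rewrite -(ler_nat R) natrM.
    have z0 : 0 <= (zf t)%:R :> R by [].
    have : (zf t)%:R * (1 / 2) <= (zf t)%:R * (1 - \sum_(r in W) (r : nat)%:R^-1) :> R.
      by apply: ler_wpM2l; [exact: z0|move: sW; move: (\sum_(_ in _) _) => u; clear; lra].
    by move=> /le_trans/(_ h); move: (zf t)%:R (totient _)%:R => v w; clear; lra.
  + exists (t.2.1 * pr D)%N, (t.2.2 * pr (t.1 :\: D))%N; split => //.
      by rewrite muln_gt0 prime_gt0.
    by rewrite /zf (prD DU); ring.
- rewrite big_map big_enum /=.
  have -> : \sum_(t in T) (zf t)%:R^-1 = sm (fun U p q => (window p q U != set0)%:R).
    rewrite /sm; under [RHS]eq_bigr do rewrite pair_big_dep /=.
    rewrite pair_big_dep /= big_mkcond [RHS]big_mkcond; apply: eq_bigr => -[U [p q]] _ /=.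
    rewrite inE /= /om /zf /=.
    case: (G U) => //=; case: (Pp p) => //=; case: (prime q) => //=.
    by case: (_ != _); rewrite ?mulr1 ?mulr0// !natrM !invfM.
  (* The choice maximising [2 la a - la^2 b], with value [a^2 / b]. *)
  pose la := a / b.
  have la0 : 0 < la by rewrite divr_gt0.
  have key : 2 * la * sm (fun U p q => #|window p q U|%:R) - la ^+ 2 * sm (fun U p q => #|window p q U|%:R ^+ 2)
     <= sm (fun U p q => (window p q U != set0)%:R).
    rewrite /sm !mulr_sumr -sumrB; apply: ler_sum => U _.
    rewrite !mulr_sumr -sumrB; apply: ler_sum => p _.
    rewrite !mulr_sumr -sumrB; apply: ler_sum => q _.
    have o0 : 0 <= om U p q by rewrite /om; nng.
    rewrite mulrCA [la ^+ 2 * _]mulrCA -mulrBr; apply: ler_wpM2l => //.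
    case: (eqVneq (window p q U) set0) => [->|_]; first by rewrite cards0 expr0n /= !mulr0 subr0.
    have -> : true%:R = 1 :> R by [].
    by rewrite -subr_ge0 (_ : _ - _ = (1 - la * #|window p q U|%:R) ^+ 2) ?sqr_ge0//; ring.
  apply: le_trans key.
  apply: (@le_trans _ _ (2 * la * (a * S) - la ^+ 2 * (b * S))).
    have -> : 2 * la * (a * S) - la ^+ 2 * (b * S) = a ^+ 2 / b * S by rewrite /la; field; rewrite gt_eqF.
    rewrite [leLHS](_ : _ = a ^+ 2 / b * (1 / 4 * (rho ^+ J * dec J))); last by field; rewrite gt_eqF.
    by apply: ler_wpM2l => //; rewrite divr_ge0 ?ltW// exprn_gt0.
  apply: lerB; last by apply: ler_wpM2l => //; rewrite exprn_ge0// ltW.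
  by apply: ler_wpM2l => //; rewrite mulr_ge0// ltW.
Qed.

End CloseProducts.

(** * Intervals around reduced fractions *)

Section FareyBalls.
Local Open Scope classical_set_scope.
Local Open Scope ring_scope.
Context {R : realType}.
Local Notation mu := (@lebesgue_measure R).

Lemma measurable_seqU (I : Type) (s : seq I) (A : I -> set R) :
  (forall i, measurable (A i)) -> measurable (\big[setU/set0]_(i <- s) A i).
Proof. by move=> mA; elim/big_ind: _ => // *; exact: measurableU. Qed.

Lemma measure_seqU_le (I : Type) (s : seq I) (A : I -> set R) (m : I -> R) :
  (forall i, measurable (A i)) -> (forall i, (mu (A i) <= (m i)%:E)%E) ->
  (mu (\big[setU/set0]_(i <- s) A i) <= (\sum_(i <- s) m i)%:E)%E.
Proof.
move=> mA Hm; elim: s => [|i s IH]; first by rewrite !big_nil measure0.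
rewrite !big_cons EFinD; apply: le_trans (@measureU2 _ _ _ mu _ _ (mA i) (measurable_seqU s mA)) _.
by apply: leeD; [exact: Hm|exact: IH].
Qed.

(** Adding one set at a time, its overlap with the previous union is at most the sum of pairwise
    overlaps. Summing over ordered pairs wastes a factor 2 but keeps the statement symmetric. *)
Lemma bonferroni (I : eqType) (s : seq I) (A : I -> set R) (l : I -> R) (m : I -> I -> R) :
  uniq s -> (forall i, measurable (A i)) -> (forall i, mu (A i) = (l i)%:E) ->
  (forall i j, i != j -> (mu (A i `&` A j) <= (m i j)%:E)%E) -> (forall i j, 0 <= m i j) ->
  ((\sum_(i <- s) l i - \sum_(i <- s) \sum_(j <- s | j != i) m i j)%:E <=
    mu (\big[setU/set0]_(i <- s) A i))%E.
Proof.
move=> + mA Hl Hm m0; elim: s => [|i s IH]; first by rewrite !big_nil measure0 subr0.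
move=> /andP[is_ us]; have {IH} := IH us.
rewrite !big_cons eqxx /=.
have mU := measurable_seqU s mA; set U := \big[setU/set0]_(j <- s) A j in mU *.
have Ufin : (mu U < +oo)%E.
  apply: le_lt_trans (measure_seqU_le s mA (fun j => _)) (ltry _) => //.
  by move=> j; rewrite Hl.
have Afin : (mu (A i) < +oo)%E by rewrite Hl ltry.
have [u eu] : exists u, mu U = u%:E.
  by exists (fine (mu U)); rewrite fineK// ge0_fin_numE// measure_ge0.
have mI := measurableI _ _ (mA i) mU.
have hI : (mu (A i `&` U) <= (\sum_(j <- s) m i j)%:E)%E.
  have -> : A i `&` U = \big[setU/set0]_(j <- s | true) (A i `&` (if i != j then A j else set0)).
    rewrite /U big_distrr/=; rewrite big_seq [RHS]big_seq.
    by apply: eq_bigr => j js; rewrite ifT//; apply: contraNneq is_ => ->.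
  apply: measure_seqU_le => j; first by apply: measurableI => //; case: ifP.
  by case: ifPn => [/Hm//|_]; rewrite setI0 measure0 lee_fin.
have [v ev] : exists v, mu (A i `&` U) = v%:E.
  exists (fine (mu (A i `&` U))); rewrite fineK// ge0_fin_numE ?measure_ge0//.
  by apply: le_lt_trans hI (ltry _).
have -> : mu (A i `|` U) = (mu (A i) + mu U - mu (A i `&` U))%E by exact: (@measureUfinl _ _ _ mu _ _ (mA i) mU Afin).
rewrite (Hl i) eu ev -!EFinD !lee_fin => IH.
rewrite ev lee_fin in hI.
have h1 : \sum_(j <- s | j != i) m i j = \sum_(j <- s) m i j.
  rewrite big_mkcond big_seq [RHS]big_seq; apply: eq_bigr => j js.
  by rewrite ifT//; apply: contraNneq is_ => <-.
have h2 : \sum_(k <- s) \sum_(j <- s | j != k) m k j <= \sum_(k <- s) \sum_(j <- i :: s | j != k) m k j.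
  by apply: ler_sum => k _; rewrite big_cons; case: ifP => // _; rewrite lerDr.
rewrite h1; move: IH h2 hI.
by move: (\sum_(k <- s) \sum_(j <- i :: s | j != k) m k j) (\sum_(k <- s) \sum_(j <- s | j != k) m k j) (\sum_(j <- s) m i j) (\sum_(j <- s) l j) => a b c d; clear; lra.
Qed.

(** [a w - b z] is a multiple of [d = gcd(z, w)], so it has at most [2 (H / d)] nonzero values in
    range. A value fixes [a] modulo [z' = z / d], and the quotient [a %/ z'] takes [d] values; [f]
    records sign, multiple and quotient. *)
Lemma overlap_count (z w H : nat) : (0 < z)%N -> (0 < w)%N ->
  (\sum_(a < z) \sum_(b < w) ((a * w != b * z) && (a * w <= b * z + H) && (b * z <= a * w + H)) <= 2 * H)%N.
Proof.
move=> z0 w0; set d := gcdn z w.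
have d0 : (0 < d)%N by rewrite gcdn_gt0 z0.
pose P (t : 'I_z * 'I_w) := (t.1 * w != t.2 * z)%N && (t.1 * w <= t.2 * z + H)%N && (t.2 * z <= t.1 * w + H)%N.
rewrite pair_big /=.
have -> : (\sum_(t : 'I_z * 'I_w) ((t.1 * w != t.2 * z) && (t.1 * w <= t.2 * z + H) && (t.2 * z <= t.1 * w + H)) = #|P|)%N.
  by rewrite -sum1_card [RHS]big_mkcond; apply: eq_bigr => t _; rewrite unfold_in /P; case: ifP.
have zd : (z %/ d * d = z)%N by rewrite divnK// dvdn_gcdl.
have wd : (w %/ d * d = w)%N by rewrite divnK// dvdn_gcdr.
set z' := (z %/ d)%N in zd; set w' := (w %/ d)%N in wd.
have z'0 : (0 < z')%N by rewrite lt0n; apply/eqP => e; move: zd; rewrite e; lia.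
have cop : coprime z' w'.
  by rewrite /coprime -(eqn_pmul2r d0) mul1n muln_gcdl zd wd.
pose q := (H %/ d)%N.
pose h (t : 'I_z * 'I_w) := ((t.1 * w - t.2 * z) + (t.2 * z - t.1 * w))%N.
pose f (t : 'I_z * 'I_w) : bool * nat * nat := ((t.2 * z < t.1 * w)%N, (h t %/ d)%N, (t.1 %/ z')%N).
have hd t : (h t %/ d * d = h t)%N.
  by rewrite divnK// /h dvdn_add// dvdn_sub// dvdn_mull// ?dvdn_gcdl ?dvdn_gcdr.
have aux (a a2 b b2 : nat) : (a2 <= a)%N -> (a %/ z' = a2 %/ z')%N -> (a * w + b2 * z = a2 * w + b * z)%N -> a = a2.
  move=> a2a ea e.
  have e1 : ((a - a2) * w' = (b - b2) * z')%N.
    have : ((a - a2) * w' * d = (b - b2) * z' * d)%N.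
      by rewrite -!mulnA wd zd; move: e a2a; clear; move: z w => z w; nia.
    by move/eqP; rewrite eqn_pmul2r// => /eqP.
  have : (z' %| (a - a2) * w')%N by rewrite e1 dvdn_mull.
  rewrite mulnC Gauss_dvdr// => dv.
  have lt : (a - a2 < z')%N.
    have := ltn_ceil a z'0; have := leq_divM a2 z'; rewrite ea; clear; lia.
  case: (posnP (a - a2)) => [e0|p0]; first by apply/eqP; rewrite eqn_leq a2a -subn_eq0 e0.
  by have := dvdn_leq p0 dv; rewrite leqNgt lt.
have inj : {in P &, injective f}.
  move=> [a b] [a2 b2] _ _ [e1 e2 e3].
  have hh : h (a, b) = h (a2, b2) by rewrite -hd -[RHS]hd e2.
  have e : (a * w + b2 * z = a2 * w + b * z)%N.
    move: e1 hh; rewrite /h /=; case: ltnP; case: ltnP => //; clear; lia.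
  have ea : a = a2.
    apply/val_inj; case/orP: (leq_total a2 a) => le; first exact: (aux _ _ _ _ le e3 e).
    exact/esym/(aux _ _ _ _ le (esym e3) (esym e)).
  rewrite ea; congr (_, _); apply/val_inj/eqP.
  by rewrite -(eqn_pmul2r z0); move: e; rewrite ea => /eqP; rewrite eqn_add2l eq_sym.
pose L := [seq (x, l) | x <- [seq (s, k) | s <- [:: true; false], k <- iota 1 q], l <- iota 0 d].
have sL : size L = (2 * q * d)%N by rewrite !size_allpairs !size_iota.
apply: (@leq_trans (size L)); last first.
  by rewrite sL -mulnA leq_mul2l leq_divM orbT.
rewrite cardE -(size_map f); apply: uniq_leq_size.
  by rewrite map_inj_in_uniq ?enum_uniq// => t s; rewrite !mem_enum; exact: inj.
move=> y /mapP[[a b]]; rewrite mem_enum unfold_in => /andP[/andP[/= n1 n2] n3] ->.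
have h0 : (0 < h (a, b) %/ d)%N.
  rewrite lt0n; apply/eqP => e; have := hd (a, b); rewrite e /h /=.
  by move: n1; clear; lia.
apply: allpairs_f; last by rewrite mem_iota add0n /= ltn_divLR// mulnC zd.
apply: allpairs_f; first by case: (_ < _)%N.
rewrite mem_iota h0 add1n ltnS /q; apply: leq_div2r; rewrite /h /=.
by move: n2 n3; clear; lia.
Qed.

Lemma ball_disjoint (x y r q : R) : r + q <= `|x - y| -> ball x r `&` ball y q = set0.
Proof.
move=> h; apply/seteqP; split => // t [/=]; rewrite -!ball_normE /= => h1 h2.
have := ler_distD t x y; rewrite [`|t - y|]distrC; move: h h1 h2.
by move: (`|x - y|) (`|x - t|) (`|y - t|) => a b c; lra.
Qed.

Lemma measure_ballI_le (x y r q : R) : 0 <= r -> 0 <= q ->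
  (mu (ball x r `&` ball y q) <= (2 * Num.min r q)%:E)%E.
Proof.
move=> r0 q0.
have mI : measurable (ball x r `&` ball y q) by apply: measurableI; exact: measurable_ball.
have [rq|qr] := leP r q.
  apply: (@le_trans _ _ (mu (ball x r))).
    by apply: le_measure; rewrite ?inE//; exact: measurable_ball.
  by rewrite lebesgue_measure_ball// lee_fin -[r *+ 2]mulr_natl.
apply: (@le_trans _ _ (mu (ball y q))).
  by apply: le_measure; rewrite ?inE//; exact: measurable_ball.
by rewrite lebesgue_measure_ball// lee_fin -[q *+ 2]mulr_natl.
Qed.

Definition center (s : R) (j z a : nat) : R := (j%:R + a%:R / z%:R) * s.

(** Distinct centres overlap only if [0 < |a w - b z| < z w (r + q)], and
    [min r q * (r + q) <= 2 r q] turns the total into a product, as if the two families were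
    independent up to a constant. *)
Lemma overlap_sum (s : R) (j z w : nat) (r q : R) : 0 < s -> (0 < z)%N -> (0 < w)%N -> 0 < r -> 0 < q ->
  \sum_(a < z | coprime a z) \sum_(b < w | coprime b w)
     (if (a * w != b * z)%N && (`|center s j z a - center s j w b| < r * s + q * s) then 2 * Num.min (r * s) (q * s) else 0)
  <= s * (8 * (z%:R * r) * (w%:R * q)).
Proof.
move=> s0 z0 w0 r0 q0.
have Z0 : 0 < z%:R :> R by rewrite ltr0n.
have W0 : 0 < w%:R :> R by rewrite ltr0n.
pose Hr : R := z%:R * w%:R * (r + q).
have Hr0 : 0 <= Hr by rewrite /Hr; nng.
pose H := Num.truncn Hr.
have /andP[H1 H2] := truncn_itv Hr0.
have m0 : 0 <= 2 * Num.min (r * s) (q * s) by rewrite mulr_ge0// le_min; apply/andP; split; nng.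
pose c a b : nat := ((a * w != b * z) && (a * w <= b * z + H) && (b * z <= a * w + H))%N.
apply: (@le_trans _ _ (\sum_(a < z) \sum_(b < w) (2 * Num.min (r * s) (q * s)) * (c a b)%:R)).
  rewrite big_mkcond; apply: ler_sum => a _; case: ifP => _; last first.
    by apply: sumr_ge0 => b _; rewrite mulr_ge0.
  rewrite big_mkcond; apply: ler_sum => b _; case: ifP => _; last by rewrite mulr_ge0.
  case: ifP => [/andP[n1 n2]|_]; last by rewrite mulr_ge0.
  suff -> : c a b = 1%N by rewrite mulr1.
  have n3 : `|(a * w)%:R - (b * z)%:R| < Hr.
    have e : center s j z a - center s j w b = ((a * w)%:R - (b * z)%:R) * (s / (z%:R * w%:R)).
      by rewrite /center !natrM; field; rewrite !gt_eqF.
    move: n2; rewrite e normrM [X in _ * X]gtr0_norm; last by rewrite divr_gt0// mulr_gt0.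
    rewrite mulrA ltr_pdivrMr ?mulr_gt0// -mulrDl [X in _ < X]mulrAC ltr_pM2r// /Hr.
    by rewrite mulrC.
  have n4 : `|(a * w)%:R - (b * z)%:R| < H.+1%:R :> R by apply: lt_le_trans n3 _; exact: ltW.
  rewrite /c n1 /=; move: n4; rewrite ltr_norml => /andP[k1 k2].
  have k3 : (a * w < b * z + H.+1)%N by rewrite -(ltr_nat R) natrD; move: k2; move: ((_ * _)%:R) ((_ * _)%:R) (H.+1%:R) => x y u; lra.
  have k4 : (b * z < a * w + H.+1)%N by rewrite -(ltr_nat R) natrD; move: k1; move: ((_ * _)%:R) ((_ * _)%:R) (H.+1%:R) => x y u; lra.
  by move: k3 k4; rewrite !addnS !ltnS => -> ->.
apply: (@le_trans _ _ (2 * Num.min (r * s) (q * s) * (2 * H)%:R)).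
  under eq_bigr do rewrite -mulr_sumr.
  rewrite -mulr_sumr; apply: ler_wpM2l => //.
  apply: le_trans (_ : (\sum_(a < z) \sum_(b < w) c a b)%N%:R <= _); last by rewrite ler_nat overlap_count.
  by rewrite natr_sum; apply: ler_sum => a _; rewrite natr_sum.
apply: (@le_trans _ _ (2 * Num.min (r * s) (q * s) * (2 * Hr))).
  by apply: ler_wpM2l => //; rewrite natrM; apply: ler_wpM2l.
have -> : Num.min (r * s) (q * s) = Num.min r q * s by rewrite minr_pMl// ltW.
rewrite /Hr.
rewrite [leLHS](_ : _ = s * (4 * z%:R * w%:R * (Num.min r q * (r + q)))); last by ring.
apply: ler_wpM2l; first exact: ltW.
rewrite [leRHS](_ : _ = 4 * z%:R * w%:R * (2 * (r * q))); last by ring.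
apply: ler_wpM2l; first by nng.
have [rq|qr] := leP r q.
  by move: rq r0; clear; nra.
by move: qr q0; clear; nra.
Qed.

(* Shrinking all radii by the factor [16 W] makes the first order term of the
   Bonferroni inequality dominate, so no upper bound on [W] is needed. *)
Lemma farey_mass (I : eqType) (t : seq I) (zz : I -> nat) (e : I -> R) (s : R) (j : nat) :
  0 < s -> uniq t -> {in t &, injective zz} -> (forall i, i \in t -> (1 < zz i)%N /\ (zz i <= 2 * totient (zz i))%N) ->
  (forall i, 0 < e i) -> 1 <= \sum_(i <- t) (zz i)%:R * e i ->
  ((s / 32)%:E <= mu (\bigcup_(p in [set p : I * nat | [&& p.1 \in t, (p.2 < zz p.1)%N & coprime p.2 (zz p.1)]])
     ball (center s j (zz p.1) p.2) (e p.1 * s)))%E.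
Proof.
move=> s0 ut inj Hz e0 W1.
set W := \sum_(i <- t) _ in W1.
pose r i := e i / (16 * W).
have W0 : 0 < W by lra.
have r0 i : 0 < r i by rewrite /r divr_gt0// mulr_gt0.
have re i : r i <= e i by rewrite /r ler_pdivrMr ?mulr_gt0//; have := e0 i; move: W1; clear; nra.
have sW : \sum_(i <- t) (zz i)%:R * r i = 1 / 16.
  rewrite /r; under eq_bigr do rewrite mulrA.
  by rewrite -mulr_suml -/W; field; rewrite gt_eqF.
pose P := [seq (i, a) | i <- t, a <- [seq a <- iota 0 (zz i) | coprime a (zz i)]].
have uP : uniq P.
  apply: allpairs_uniq_dep => //.
  by move=> i it; rewrite filter_uniq// iota_uniq.
  by move=> [i a] [k b] _ _ /= [-> ->].
pose A (p : I * nat) := ball (center s j (zz p.1) p.2) (r p.1 * s).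
have mA p : measurable (A p) by exact: measurable_ball.
have rs0 i : 0 < r i * s by rewrite mulr_gt0.
pose m (p p' : I * nat) : R := if ball (center s j (zz p.1) p.2) (r p.1 * s) `&` ball (center s j (zz p'.1) p'.2) (r p'.1 * s) == set0 then 0 else 2 * Num.min (r p.1 * s) (r p'.1 * s).
have mP : forall p, p \in P -> [/\ p.1 \in t, (p.2 < zz p.1)%N & coprime p.2 (zz p.1)].
  move=> p /allpairsPdep[i [a [it]]]; rewrite mem_filter mem_iota add0n => /andP[ca /= az] ->.
  by split.
have sub : \big[setU/set0]_(p <- P) A p `<=` \bigcup_(p in [set p : I * nat | [&& p.1 \in t, (p.2 < zz p.1)%N & coprime p.2 (zz p.1)]])
     ball (center s j (zz p.1) p.2) (e p.1 * s).
  rewrite big_seq; elim/big_ind: _ => // [X Y h1 h2 x []//|p /mP[p1 p2 p3] x Ax]; [exact: h1|exact: h2|].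
  exists p; first by rewrite /= p1 p2 p3.
  apply: le_ball Ax; rewrite ler_pM2r//.
apply: le_trans (le_measure mu _ _ sub); last 2 first.
- by rewrite inE; exact: measurable_seqU.
- by rewrite inE; apply: open_measurable; apply: bigcup_open => p _; exact: ball_open.
have m0 p p' : 0 <= m p p'.
  rewrite /m; case: ifP => // _; rewrite mulr_ge0// le_min.
  by rewrite (ltW (rs0 p.1)) (ltW (rs0 p'.1)).
have mE p p' : p != p' -> (mu (A p `&` A p') <= (m p p')%:E)%E.
  move=> _; rewrite /m /A; case: ifP => [/eqP ->|_]; first by rewrite measure0.
  by apply: measure_ballI_le; exact: ltW.
have AE p : mu (A p) = (2 * (r p.1 * s))%:E.
  by rewrite /A lebesgue_measure_ball ?ltW// -[_ *+ 2]mulr_natl.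
have sumP (F : I -> nat -> R) : \sum_(p <- P) F p.1 p.2 = \sum_(i <- t) \sum_(a < zz i | coprime a (zz i)) F i a.
  rewrite /P big_allpairs_dep /=; apply: eq_bigr => i _.
  by rewrite big_filter -[X in iota 0 X]subn0 big_mkord.
apply: le_trans (@bonferroni _ P A (fun p => 2 * (r p.1 * s)) m uP mA AE mE m0).
rewrite lee_fin.
have h1 : s / 16 <= \sum_(p <- P) 2 * (r p.1 * s).
  rewrite (sumP (fun i _ => 2 * (r i * s))).
  have -> : s / 16 = \sum_(i <- t) (zz i)%:R * r i * s by rewrite -mulr_suml sW; ring.
  rewrite big_seq [leRHS]big_seq; apply: ler_sum => i /Hz[_ h].
  rewrite sumr_const -[leRHS]mulr_natl.
  have -> : #|[pred a : 'I_(zz i) | coprime a (zz i)]| = totient (zz i).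
    rewrite totient_count_coprime big_mkord -sum1_card big_mkcond; apply: eq_bigr => a _.
    by rewrite unfold_in /= coprime_sym; case: (coprime _ _).
  rewrite mulrA [_ * 2]mulrC -natrM -mulrA; apply: ler_wpM2r; first exact: ltW.
  by rewrite ler_nat.
(* With radii normalised to total 1/16, the overlaps amount to [8 s (1/16)^2 = s / 32], half of the
   first order term. *)
suff h2 : \sum_(p <- P) \sum_(p' <- P | p' != p) m p p' <= s / 32.
  by move: h1 h2; move: (\sum_(_ <- _) _) (\sum_(_ <- _) _) => a b; clear; lra.
pose M i a k b : R := if (a * zz k != b * zz i)%N && (`|center s j (zz i) a - center s j (zz k) b| < r i * s + r k * s) then 2 * Num.min (r i * s) (r k * s) else 0.
have M0 i a k b : 0 <= M i a k b.
  rewrite /M; case: ifP => // _; rewrite mulr_ge0// le_min.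
  by rewrite (ltW (rs0 i)) (ltW (rs0 k)).
apply: (@le_trans _ _ (\sum_(p <- P) \sum_(p' <- P) M p.1 p.2 p'.1 p'.2)).
  rewrite big_seq [leRHS]big_seq; apply: ler_sum => p pP.
  rewrite big_mkcond big_seq [leRHS]big_seq; apply: ler_sum => p' pP'.
  case: ifP => // pp'; rewrite /m; case: ifP => // I0.
  have [p1 p2 p3] := mP _ pP; have [p1' p2' p3'] := mP _ pP'.
  rewrite /M ifT//; apply/andP; split.
    apply/eqP => E; move: pp' => /eqP; apply.
    have d1 : (zz p.1 %| zz p'.1)%N.
      by rewrite -(@Gauss_dvdr _ p.2) 1?coprime_sym// E dvdn_mull.
    have d2 : (zz p'.1 %| zz p.1)%N.
      by rewrite -(@Gauss_dvdr _ p'.2) 1?coprime_sym// -E dvdn_mull.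
    have ez : zz p.1 = zz p'.1 by apply/eqP; rewrite eqn_dvd d1.
    have ei := inj _ _ p1 p1' ez.
    move: E; rewrite ez => /eqP; rewrite eqn_pmul2r; last by have [h _] := Hz _ p1'; exact: ltnW.
    by case: p p' ei {pP pP' I0 p1 p2 p3 p1' p2' p3' d1 d2 ez} => a b [c d] /= -> /eqP ->.
  rewrite ltNge; apply/negP => h; move: I0 => /eqP; apply; exact: ball_disjoint.
rewrite (sumP (fun i a => \sum_(p' <- P) M i a p'.1 p'.2)).
apply: (@le_trans _ _ (\sum_(i <- t) \sum_(k <- t) s * (8 * ((zz i)%:R * r i) * ((zz k)%:R * r k)))).
  rewrite big_seq [leRHS]big_seq; apply: ler_sum => i it.
  under eq_bigr do rewrite (sumP (fun k b => M i _ k b)).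
  rewrite exchange_big big_seq [leRHS]big_seq; apply: ler_sum => k kt /=.
  apply: overlap_sum => //.
    by have [h _] := Hz _ it; exact: ltnW.
  by have [h _] := Hz _ kt; exact: ltnW.
rewrite le_eqVlt; apply/orP; left; apply/eqP.
under eq_bigr do rewrite -mulr_sumr -mulr_sumr sW.
rewrite -mulr_sumr -mulr_suml -mulr_sumr sW; by field.
Qed.

End FareyBalls.

(** * Good approximations infinitely often *)

Section Rate.
Local Open Scope classical_set_scope.
Local Open Scope ring_scope.
Context {R : realType}.
Notation rho := (expR 1 * ln 2 : R).

(** [c - 1 = - ln rho / ln 2] is negative because [rho > 1]. *)
Lemma powR_c_lt (a b : R) : 0 < a -> a <= b -> b `^ (@c_const R - 1) <= a `^ (@c_const R - 1).
Proof.
move=> a0 ab; have b0 := lt_le_trans a0 ab.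
rewrite /powR !gt_eqF// ler_expR; apply: ler_wnM2l; last by rewrite ler_ln.
rewrite /c_const addrAC subrr add0r oppr_le0; apply: divr_ge0; last first.
  by rewrite ltW// (lt_trans _ (@ln2_gt R))//; lra.
have l2 : 0 < ln 2 :> R by apply: lt_trans (@ln2_gt R); lra.
have -> : 1 + ln (ln 2) = ln rho by rewrite lnM ?posrE ?expR_gt0// expRK.
by rewrite ln_ge0// ltW// rho_gt1.
Qed.

Lemma powR_rho J : (2 ^+ J) `^ (@c_const R - 1) = rho ^- J.
Proof.
have l2 : 0 < ln 2 :> R by apply: lt_trans (@ln2_gt R); lra.
have r0 : 0 < rho by rewrite mulr_gt0// expR_gt0.
rewrite /powR gt_eqF ?exprn_gt0// lnXn//.
have -> : (@c_const R - 1) * (ln 2 *+ J) = - (ln rho *+ J).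
  rewrite lnM ?posrE ?expR_gt0// expRK /c_const -[ln 2 *+ J]mulr_natr -[(1 + _) *+ J]mulr_natr.
  by field; rewrite gt_eqF.
by rewrite expRN -lnXn// lnK// posrE exprn_gt0.
Qed.

Lemma logp_ge1 (x : R) : 1 <= logp x.
Proof. by rewrite /logp le_max lexx. Qed.

Lemma logp_le (x y : R) : 0 < x -> x <= y -> logp x <= logp y.
Proof. by move=> x0 xy; rewrite /logp ge_max !le_max lexx /= ler_ln ?xy ?orbT// posrE (lt_le_trans x0). Qed.

(** The hypotheses place [ln N] between multiples of [2^J] by constants depending only on [m], so
    [log N] and [log_2 N] may be traded for [2^J] and [J] at a constant cost. *)
Lemma rate_ge (m : nat) : (0 < m)%N -> exists2 c : R, 0 < c <= 1 & forall J i N : nat,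
  (i <= 2 ^ J)%N -> (2 ^ (m * 2 ^ J) <= N ^ 2)%N -> (N <= 2 ^ i * 2 ^ (7 * (m * 2 ^ J)))%N ->
  c * (rho ^- J * Num.sqrt J.+1%:R) <= logp (N%:R : R) `^ (@c_const R - 1) * log2p (N%:R : R) `^ 2^-1.
Proof.
move=> m0; have m0' : 1 <= m%:R :> R by rewrite ler1n.
have l2 : 1 / 2 < ln 2 :> R := @ln2_gt R.
have l2' : ln 2 < 1 :> R := @ln2_lt1 R.
pose a : R := 8 * m%:R; have a0 : 0 < a by rewrite /a; lra.
have rho0 : 0 < rho by rewrite mulr_gt0 ?expR_gt0//; lra.
exists (a `^ (@c_const R - 1) * Num.sqrt (8^-1)).
  rewrite mulr_gt0 ?powR_gt0 ?sqrtr_gt0//=.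
  rewrite mulr_ile1 ?powR_ge0 ?sqrtr_ge0//.
    apply: le_trans (powR_c_lt ltr01 _) _; first by rewrite /a; lra.
    by rewrite powR1.
  by rewrite -[leRHS]sqrtr1 ler_wsqrtr//; lra.
move=> J i N iJ h1 h2.
have N0 : (0 < N)%N by move: h1; case: N {h2} => //; rewrite leqNgt expn_gt0.
have N0' : 0 < N%:R :> R by rewrite ltr0n.
set X : R := 2 ^+ J; have X1 : 1 <= X by rewrite /X -natrX ler1n expn_gt0.
have up : ln N%:R <= a * X.
  apply: le_trans (ler_ln_nat N0 h2) _.
  rewrite -expnD ln_pow2 natrD !natrM natrX -/X.
  have iX : i%:R <= X by rewrite /X -natrX ler_nat.
  apply: (@le_trans _ _ (i%:R + 7 * (m%:R * X))).
    by apply: ler_piMr; [apply: addr_ge0 => //; apply: mulr_ge0 => //; apply: mulr_ge0 => //; lra|exact: ltW].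
  rewrite /a; have : X <= m%:R * X by rewrite ler_peMl//; lra.
  by move: iX; rewrite -mulrA; move: (m%:R * X) (i%:R) => u v; lra.
have lo : X / 4 <= ln N%:R.
  have e0 : (0 < 2 ^ (m * 2 ^ J))%N by rewrite expn_gt0.
  have := @ler_ln_nat R _ _ e0 h1; rewrite (ln_pow2 (m * 2 ^ J)) natrM natrX -/X natrX lnXn// -[ln _ *+ 2]mulr_natl.
  have : X / 2 <= m%:R * X * ln 2.
    have : X <= m%:R * X by rewrite ler_peMl//; lra.
    by move: l2; move: (m%:R * X) => u; move: X1; clear; nra.
  by move: (m%:R * X * ln 2) (ln N%:R) => u v; lra.
have h3 : a `^ (@c_const R - 1) * rho ^- J <= logp (N%:R : R) `^ (@c_const R - 1).
  rewrite -powR_rho -/X -powRM//; [|lra..].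
  apply: powR_c_lt; first by apply: lt_le_trans (logp_ge1 _); lra.
  rewrite /logp ge_max up andbT; apply: le_trans (ler_peMl _ _) => //; first by lra.
  by rewrite /a; lra.
have h4 : J.+1%:R / 8 <= log2p (N%:R : R).
  have [J7|J7] := leqP J 7.
    apply: le_trans (logp_ge1 _); rewrite ler_pdivrMr// mul1r ler_nat//.
  apply: (@le_trans _ _ (ln (X / 4))).
    have -> : ln (X / 4) = (J%:R - 2) * ln 2.
      rewrite lnM ?posrE ?invr_gt0//; last by lra.
      rewrite lnV ?posrE// /X lnXn// (_ : 4 = 2 ^+ 2) ?lnXn//; last by rewrite expr2 -natrM.
      by rewrite -[ln 2 *+ J]mulr_natl -[ln 2 *+ 2]mulr_natl; ring.
    have J8 : 8 <= J%:R :> R by rewrite ler_nat.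
    rewrite -natr1; move: (J%:R) J8 l2 => u; clear; nra.
  have X4 : 0 < X / 4 by lra.
  have lN : 0 < ln N%:R :> R by apply: lt_le_trans lo.
  apply: (@le_trans _ _ (ln (logp (N%:R : R)))); last by rewrite /log2p /logp le_max lexx orbT.
  rewrite ler_ln ?posrE//; last by apply: lt_le_trans (logp_ge1 _).
  by apply: le_trans lo _; rewrite /logp le_max lexx orbT.
have h5 : Num.sqrt (8^-1) * Num.sqrt J.+1%:R <= log2p (N%:R : R) `^ 2^-1.
  rewrite powR12_sqrt; last by apply: le_trans (logp_ge1 _).
  by rewrite -sqrtrM ?invr_ge0// ler_wsqrtr// mulrC.
rewrite [leLHS](_ : _ = (a `^ (@c_const R - 1) * rho ^- J) * (Num.sqrt (8^-1) * Num.sqrt J.+1%:R)); last by ring.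
apply: ler_pM => //; first by rewrite mulr_ge0 ?powR_ge0// invr_ge0 exprn_ge0// ltW.
Qed.

Lemma dist_int_le (x : R) (n : int) : dist_int x <= `|x - n%:~R|.
Proof.
rewrite /dist_int; have /andP[h1 h2] := floor_itv x; rewrite intrD in h2.
have [nf|fn] := leP n (Num.floor x).
  have : n%:~R <= (Num.floor x)%:~R :> R by rewrite ler_int.
  move=> h; rewrite ge_min; apply/orP; left; rewrite ger0_norm; lra.
have : (Num.floor x + 1)%:~R <= n%:~R :> R by rewrite ler_int -[_ + 1]addrC lez1D.
rewrite intrD => h; rewrite ge_min; apply/orP; right; rewrite ler0_norm; lra.
Qed.

Lemma delta_min_le (al : R) (N i j : nat) : (0 < j)%N -> (j < i)%N -> (i <= N)%N ->
  delta_min al N <= dist_int (((i ^ 2)%:R - (j ^ 2)%:R) * al).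
Proof.
move=> j0 ji iN; have i0 := ltn_trans j0 ji.
have iN' : (i.-1 < N)%N by rewrite prednK.
have jN' : (j.-1 < N)%N by rewrite prednK// (leq_trans (ltnW ji)).
apply: (@le_trans _ _ (\big[Num.min/1]_(j' < N | Ordinal iN' != j')
     dist_int ((((a_sq (Ordinal iN').+1)%:R - (a_sq j'.+1)%:R) : R) * al))).
  exact: bigmin_le_cond.
apply: le_trans (bigmin_le_cond _ (j := Ordinal jN') _ _) _.
  by rewrite -val_eqE /= -(inj_eq succn_inj) !prednK// gtn_eqF.
by rewrite /a_sq /= !prednK.
Qed.

Lemma sum_harmonic_ge (l0 n : nat) : ln (l0 + n).+1%:R - ln l0.+1%:R <= \sum_(l0 <= l < l0 + n) l.+1%:R^-1 :> R.
Proof.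
elim: n => [|n IH]; first by rewrite addn0 subrr big_geq.
rewrite addnS big_nat_recr ?leq_addr//=.
have h : ln (l0 + n).+2%:R - ln (l0 + n).+1%:R <= (l0 + n).+1%:R^-1 :> R.
  have p0 k : 0 < k.+1%:R :> R by rewrite ltr0n.
  rewrite -ln_div ?posrE//; apply: le_trans (ln_le_sub1 _) _; first by rewrite divr_gt0.
  by rewrite -[(l0 + n).+2%:R]natr1 mulrDl mul1r divff ?gt_eqF// addrAC subrr add0r.
by move: IH h; move: (\sum_(_ <= _ < _) _) (_^-1) => u v; lra.
Qed.

Lemma sum_harmonic_unbounded (l0 : nat) (B : R) : exists n, B <= \sum_(l0 <= l < l0 + n) l.+1%:R^-1 :> R.
Proof.
pose C : R := expR (B + ln l0.+1%:R).
have C0 : 0 <= C by exact: expR_ge0.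
exists (Num.truncn C); apply: le_trans (sum_harmonic_ge _ _).
rewrite lerBrDr -[leLHS]expRK -/C ler_ln ?posrE ?expR_gt0//.
have /andP[_ h] := truncn_itv C0; apply: le_trans (ltW h) _.
by rewrite ler_nat ltnS leq_addl.
Qed.

Definition rate (N : nat) : R := logp (N%:R : R) `^ (@c_const R - 1) * log2p (N%:R : R) `^ 2^-1 / N%:R ^+ 2.

Definition frequent (N0 : nat) : set R :=
  [set al | exists N, [/\ (N0 <= N)%N, (2 <= N)%N & delta_min al N <= rate N]].

Definition cell (i j : nat) : set R := `[j%:R * 4 ^- i, j.+1%:R * 4 ^- i[.

(** For [z = A B] from [close_products] put [M1 = 2^i (A + B)] and [M2 = 2^i (B - A)]. Then
    [M1^2 - M2^2 = 4^(i+1) z], so [alpha] near [(j + a / z) 4^-(i+1)] has a small [delta_min] at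
    [N = M1]. Scale [l] supplies mass of order [1 / l], and the divergent harmonic series meets the
    hypothesis of [farey_mass]. Passing to the interior secures measurability. *)
Lemma frequent_interval (N0 i j : nat) :
  ((4 ^- i.+1 / 32 : R)%:E <= lebesgue_measure ((frequent N0)° `&` cell i.+1 j))%E.
Proof.
have [m [c0 [m0 c00 HZ]]] := @close_products R.
have [Zf {}HZ] := boolp.choice HZ.
have [c1 /andP[c10 c11] Hrate] := rate_ge m0.
have rho0 : 0 < rho by apply: lt_trans (@rho_gt1 R).
have rho1 := @rho_gt1 R.
pose s : R := 4 ^- i.+1.
have s0 : 0 < s by rewrite invr_gt0 exprn_gt0.
have s1 : s <= 1 by rewrite invf_le1 ?exprn_gt0// exprn_ege1// ler1n.
pose eJ J : R := c1 * (rho ^- J * Num.sqrt J.+1%:R) * s / 2 ^+ 16.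
have eJ0 J : 0 < eJ J.
  by rewrite /eJ !divr_gt0 ?mulr_gt0 ?sqrtr_gt0 ?exprn_gt0// invr_gt0 exprn_gt0.
(* [p.2.-1.+1] equals [p.2] when positive and keeps [e] positive everywhere, as [farey_mass]
   asks. *)
pose e (p : nat * nat) : R := eJ (3 * p.1)%N / (p.2.-1.+1%:R) ^+ 2.
have e0 p : 0 < e p by rewrite divr_gt0// exprn_gt0.
(* Large enough for both [N0 <= M1] and [i + 1 <= 2^(3 l)]. *)
pose l0 := (N0 ^ 2 + i.+1)%N.
pose kap : R := c1 * s / 2 ^+ 16 * c0 / 3.
have kap0 : 0 < kap by rewrite /kap !(divr_gt0, mulr_gt0)// exprn_gt0.
have [n Hn] := sum_harmonic_unbounded l0 kap^-1.
pose t := [seq (l, z) | l <- iota l0 n, z <- Zf (3 * l)%N].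
have tP p : p \in t -> (l0 <= p.1)%N /\ p.2 \in Zf (3 * p.1)%N.
  by case/allpairsPdep => l [z [+ h ->]]; rewrite mem_iota => /andP[].
have Zbd l z : z \in Zf (3 * l)%N -> (2 ^ (m * 2 ^ (3 * l)) <= z <= 2 ^ (7 * (m * 2 ^ (3 * l))))%N.
  by have [_ + _] := HZ (3 * l)%N => /(_ z) H /H[].
(* With [J = 3 l], a step in [l] multiplies [2^J] by 8, more than the exponent 7 bounding [z], so
   different scales have disjoint ranges of denominators. *)
have lt_blocks (l l' z z' : nat) : (l < l')%N -> z \in Zf (3 * l)%N -> z' \in Zf (3 * l')%N -> (z < z')%N.
  move=> ll /Zbd/andP[_ h1] /Zbd/andP[h2 _]; apply: leq_ltn_trans h1 _; apply: leq_trans h2.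
  rewrite ltn_exp2l// mulnCA ltn_pmul2l//.
  apply: (@leq_trans (2 ^ (3 + 3 * l))); last by rewrite leq_exp2l// -mulnS leq_mul2l.
  by rewrite expnD ltn_pmul2r ?expn_gt0.
have inj : {in t &, injective snd}.
  move=> [l z] [l' z'] /tP[/= _ h] /tP[/= _ h'] /= zz; congr (_, _) => //.
  case: (ltngtP l l') => // ll; [have := lt_blocks _ _ _ _ ll h h'|have := lt_blocks _ _ _ _ ll h' h];
   by rewrite zz ltnn.
have ut : uniq t.
  apply: allpairs_uniq_dep; first exact: iota_uniq.
    by move=> l _; have [] := HZ (3 * l)%N.
  by move=> [l z] [l' z'] _ _ /= [-> ->].
have big2 J : (J < 2 ^ (m * 2 ^ J))%N.
  apply: leq_trans (ltn_expl J (ltnSn 1)) _; rewrite leq_exp2l//.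
  by apply: leq_trans (ltnW (ltn_expl J (ltnSn 1))) _; rewrite leq_pmull.
have z1 p : p \in t -> (1 < p.2)%N.
  move=> /tP[_ /Zbd/andP[h _]]; apply: leq_trans h; rewrite -[2%N]/(2 ^ 1)%N leq_exp2l// muln_gt0 m0 expn_gt0//.
have W1 : 1 <= \sum_(p <- t) p.2%:R * e p.
  rewrite /t big_allpairs_dep /=.
  apply: (@le_trans _ _ (\sum_(l0 <= l < l0 + n) kap * l.+1%:R^-1)).
    by rewrite -mulr_sumr -ler_pdivrMl// mulr1.
  rewrite /index_iota addKn; apply: ler_sum => l _.
  have [_ _ hZ] := HZ (3 * l)%N.
  rewrite big_seq.
  rewrite (eq_bigr (fun z : nat => eJ (3 * l)%N * z%:R^-1)); last first.
    move=> z /Zbd/andP[h _]; rewrite /e /= prednK; last by apply: leq_trans h; rewrite expn_gt0.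
    field; rewrite pnatr_eq0 -lt0n; apply: leq_trans h; by rewrite expn_gt0.
  rewrite -big_seq -mulr_sumr; apply: le_trans (ler_wpM2l (ltW (eJ0 _)) hZ).
  have -> : eJ (3 * l)%N * (c0 * (rho ^+ (3 * l) * dec (3 * l))) = c1 * s / 2 ^+ 16 * c0 / (3 * l).+1%:R.
    rewrite /eJ /dec; field.
    by rewrite !gt_eqF//= ?sqrtr_gt0 ?exprn_gt0.
  rewrite /kap -[leLHS]mulrA; apply: ler_wpM2l.
    by rewrite ltW// !(divr_gt0, mulr_gt0)// exprn_gt0.
  by rewrite -invfM lef_pV2 ?posrE ?mulr_gt0// -natrM ler_nat; clear; lia.
have zt p : p \in t -> (1 < p.2)%N /\ (p.2 <= 2 * totient p.2)%N.
  move=> pt; split; first exact: z1.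
  have [_ h] := tP p pt; have [_ + _] := HZ (3 * p.1)%N.
  by move=> /(_ _ h)[].
have := @farey_mass R _ t snd e s j s0 ut inj zt e0 W1.
move=> h; apply: le_trans h _; apply: le_measure.
- by rewrite inE; apply: open_measurable; apply: bigcup_open => p _; exact: ball_open.
- by rewrite inE; apply: measurableI; [apply: open_measurable; exact: open_interior|exact: measurable_itv].
apply: bigcup_sub => -[[l z] a] /= /and3P[pt az cop].
have z1' := z1 _ pt; rewrite /= in z1'; have z0 := ltnW z1'.
have [ll zZ] := tP _ pt; rewrite /= in ll zZ.
have /andP[zlo zhi] := Zbd l z zZ.
have [_ HZ' _] := HZ (3 * l)%N; have [_ _ [A [B [A0 AB BA zAB]]]] := HZ' z zZ.
have Z0 : 0 < z%:R :> R by rewrite ltr0n.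
have eE : e (l, z) = eJ (3 * l)%N / z%:R ^+ 2 by rewrite /e /= prednK.
have rJ1 J : rho ^- J <= 1.
  by rewrite invf_le1 ?exprn_gt0// exprn_ege1// ltW.
have eJ1 : eJ (3 * l)%N <= z%:R.
  have sq : Num.sqrt (3 * l).+1%:R <= z%:R :> R.
    apply: (@le_trans _ _ (Num.sqrt (z%:R ^+ 2))); last by rewrite sqrtr_sqr ger0_norm.
    rewrite ler_wsqrtr// -natrX ler_nat; apply: (@leq_trans z); last by rewrite -mulnn leq_pmulr.
    by apply: leq_trans zlo; exact: big2.
  apply: (@le_trans _ _ (1 * (1 * z%:R) * 1 / 1)); last by rewrite divr1 mulr1 !mul1r.
  have q0 : 0 <= rho ^- (3 * l) by rewrite invr_ge0 exprn_ge0// ltW.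
  rewrite /eJ; apply: ler_pM.
  - by rewrite !mulr_ge0 ?sqrtr_ge0// ltW.
  - by rewrite invr_ge0 exprn_ge0.
  - apply: ler_pM => //; [|exact: ltW|].
      by rewrite !mulr_ge0 ?sqrtr_ge0// ltW.
    apply: ler_pM => //; [exact: ltW|by rewrite mulr_ge0// sqrtr_ge0|].
    by apply: ler_pM.
  - by rewrite lef_pV2 ?posrE ?exprn_gt0// exprn_ege1// ler1n.
have ez : e (l, z) * z%:R <= 1.
  rewrite eE expr2 invfM mulrA divfK ?gt_eqF//.
  by rewrite ler_pdivrMr// mul1r.
have sub1 : ball (center s j z a) (e (l, z) * s) `<=` frequent N0.
  move=> al; rewrite -ball_normE /= => bal.
  pose M1 := (2 ^ i * (A + B))%N; pose M2 := (2 ^ i * (B - A))%N.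
  have pi0 : (0 < 2 ^ i)%N by rewrite expn_gt0.
  have M20 : (0 < M2)%N by rewrite muln_gt0 pi0 subn_gt0.
  have M21 : (M2 < M1)%N by rewrite ltn_pmul2l//; move: A0; clear; lia.
  have e4 : (4 ^ i.+1 = 2 ^ i * 2 ^ i * 4)%N.
    by rewrite expnS -[in LHS](expnM 2 2 i) -expnD mulnC addnn -mul2n.
  have EM : (M1 ^ 2 = M2 ^ 2 + 4 ^ i.+1 * z)%N.
    rewrite e4 zAB /M1 /M2 -(subnK (ltnW AB)) addnK.
    by move: (2 ^ i)%N (B - A)%N => u v; clear; ring.
  have NM : (M1 ^ 2 <= 4 ^ i.+1 * (2 ^ 16 * z))%N.
    apply: (@leq_trans ((2 ^ i * (2 * B)) ^ 2)).
      by rewrite leq_sqr leq_mul2l; apply/orP; right; move: AB; clear; lia.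
    have -> : ((2 ^ i * (2 * B)) ^ 2 = 2 ^ i * 2 ^ i * 4 * B ^ 2)%N by rewrite -mulnn; ring.
    by rewrite e4 leq_mul2l zAB mulnA -mulnn leq_mul2r BA !orbT.
  have zM : (z <= M1 ^ 2)%N.
    by rewrite EM; apply: leq_trans (leq_addl _ _); rewrite leq_pmull// expn_gt0.
  have NM2 : (M1 <= 2 ^ i.+1 * 2 ^ (7 * (m * 2 ^ (3 * l))))%N.
    apply: (@leq_trans (2 ^ i * (2 * B))).
      by rewrite leq_mul2l; apply/orP; right; move: AB; clear; lia.
    rewrite expnSr -mulnA leq_mul2l; apply/orP; right; rewrite leq_mul2l /=.
    by apply: leq_trans zhi; rewrite zAB leq_pmull.
  have iJ : (i.+1 <= 2 ^ (3 * l))%N.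
    apply: leq_trans (ltnW (ltn_expl _ (ltnSn 1))); move: ll; rewrite /l0; clear; lia.
  have hr := Hrate (3 * l)%N i.+1 M1 iJ (leq_trans zlo zM) NM2.
  exists M1; split.
  - rewrite -leq_sqr; apply: leq_trans zM; apply: leq_trans zlo; apply: leq_trans (ltnW (big2 _)).
    by move: ll; rewrite /l0; clear; lia.
  - by apply: leq_trans M21.
  apply: le_trans (delta_min_le al M20 M21 (leqnn _)) _.
  have -> : (M1 ^ 2)%:R - (M2 ^ 2)%:R = (4 ^ i.+1 * z)%:R :> R by rewrite EM natrD addrAC subrr add0r.
  apply: le_trans (dist_int_le _ (z * j + a)%N%:Z) _.
  have -> : (4 ^ i.+1 * z)%:R * al - ((z * j + a)%N%:Z)%:~R = (al - center s j z a) * (s^-1 * z%:R).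
    rewrite /center /s invrK -[((z * j + a)%N%:Z)%:~R]/((z * j + a)%:R) natrD !natrM natrX.
    by field; rewrite !gt_eqF// exprn_gt0.
  have sz0 : 0 < s^-1 * z%:R by rewrite mulr_gt0// invr_gt0.
  rewrite normrM [X in _ * X]gtr0_norm// distrC.
  apply: (@le_trans _ _ (e (l, z) * s * (s^-1 * z%:R))).
    by apply: ler_wpM2r; exact: ltW.
  rewrite mulrA mulfK ?gt_eqF// eE expr2 invfM mulrA divfK ?gt_eqF//.
  have M10 : 0 < M1%:R :> R by rewrite ltr0n (ltn_trans M20).
  apply: (@le_trans _ _ (c1 * (rho ^- (3 * l) * Num.sqrt (3 * l).+1%:R) / M1%:R ^+ 2)).
    rewrite /eJ -!mulrA; apply: ler_wpM2l; first exact: ltW.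
    apply: ler_wpM2l; first by rewrite invr_ge0 exprn_ge0// ltW.
    apply: ler_wpM2l; first exact: sqrtr_ge0.
    rewrite -invfM ler_pdivrMr ?mulr_gt0 ?exprn_gt0// ler_pdivlMl ?exprn_gt0//.
    rewrite /s ler_pdivrMr ?exprn_gt0// -!natrX -!natrM ler_nat.
    by apply: leq_trans NM _; rewrite mulnC.
  by rewrite /rate; apply: ler_wpM2r => //; rewrite invr_ge0 exprn_ge0// ltW.
move=> x bx; split.
  rewrite /interior; apply: (filterS sub1); apply: open_nbhs_nbhs; split => //; exact: ball_open.
(* Coprimality to [z > 1] excludes [a = 0]; with radius at most [s / z] the ball then stays inside
   the cell. *)
have a0 : (0 < a)%N by case: (a) cop => //; rewrite /coprime gcd0n; move: z1'; clear; lia.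
have A1 : 1 <= a%:R :> R by rewrite ler1n.
have A2 : a%:R + 1 <= z%:R :> R by rewrite natr1 ler_nat.
have E1 : e (l, z) <= z%:R^-1 by rewrite -[leRHS]mul1r ler_pdivlMr.
have c1' : z%:R^-1 <= a%:R / z%:R :> R by rewrite ler_peMl// invr_ge0.
have c2' : a%:R / z%:R + z%:R^-1 <= 1 :> R by rewrite -[X in _ + X]mul1r -mulrDl ler_pdivrMr// mul1r.
have c3 : e (l, z) * s <= z%:R^-1 * s by apply: ler_wpM2r => //; exact: ltW.
have c4 : z%:R^-1 * s <= a%:R / z%:R * s by apply: ler_wpM2r => //; exact: ltW.
have c5 : (a%:R / z%:R + z%:R^-1) * s <= 1 * s by apply: ler_wpM2r => //; exact: ltW.
move: bx; rewrite -ball_normE /= ltr_distl /center mulrDl => /andP[b1 b2].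
rewrite /cell /= in_itv /= -/s -natr1 [(j%:R + 1) * s]mulrDl.
move: c3 c4 c5 b1 b2; rewrite mulrDl mul1r.
move: (e (l, z) * s) (z%:R^-1 * s) (a%:R / z%:R * s) (j%:R * s) => p q r u; clear.
move=> h1 h2 h3 h4 h5; apply/andP; split; lra.
Qed.

End Rate.

(** * From a proportion in every cell to full measure *)

Section Density.
Local Open Scope classical_set_scope.
Local Open Scope ring_scope.
Context {R : realType}.
Local Notation mu := (@lebesgue_measure R).

(** At a density point of the complement, the complement would fill nearly all of [ball x s]. But
    the cell of length [s] containing [x] lies in that ball and gives [O] at least [s / 32] out of
    [2 s], leaving at most 63/64. *)
Lemma density_ae (O : set R) : open O ->
  (forall i j, ((4 ^- i.+1 / 32 : R)%:E <= mu (O `&` cell i.+1 j))%E) ->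
  {ae mu, forall x, 0 <= x -> O x}.
Proof.
move=> oO HO; pose D := `[0, +oo[%classic `\` O.
have mO : measurable O := open_measurable oO.
have mD : measurable D by apply: measurableD.
have FF : Filter (nbhs (almost_everywhere mu)) := ae_filter_ringOfSetsType mu.
apply: filterS (lebesgue_density mD) => x Hx x0.
apply: contrapT => nO.
have Dx : D x by split => //; rewrite /= in_itv /= x0.
have i1 : \1_D x = 1 :> R by rewrite indicE mem_set.
rewrite i1 in Hx.
have nb : nbhs 1%:E [set y : \bar R | ((63 / 64)%:E < y)%E].
  apply: open_nbhs_nbhs; split; first exact: open_ereal_gt_ereal.
  by rewrite /= lte_fin; lra.
have [e /= e0 He] := Hx _ nb.
pose i := Num.truncn e^-1.
have s0 : 0 < 4 ^- i.+1 :> R by rewrite invr_gt0 exprn_gt0.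
have se : 4 ^- i.+1 < e.
  have ei0 : 0 <= e^-1 by rewrite invr_ge0 ltW.
  have /andP[_ h] := truncn_itv ei0; rewrite -/i in h.
  rewrite -[e]invrK ltf_pV2 ?posrE ?invr_gt0 ?exprn_gt0//.
  apply: lt_le_trans h _; rewrite -natrX ler_nat; exact: ltnW (ltn_expl _ _).
set s := 4 ^- i.+1 in s0 se.
pose j := Num.truncn (x / s).
have xs0 : 0 <= x / s by rewrite divr_ge0// ltW.
have /andP[j1 j2] := truncn_itv xs0; rewrite -/j in j1 j2.
rewrite ler_pdivlMr// in j1; rewrite ltr_pdivrMr// in j2.
have cb : cell i.+1 j `<=` ball x s.
  move=> y; rewrite /cell /= in_itv /= -/s => /andP[y1 y2]; rewrite -ball_normE /= ltr_distl.
  move: j2 y2; rewrite -natr1 mulrDl mul1r; move: (j%:R * s) j1 y1 => u j1 y1 j2 y2.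
  by apply/andP; split; lra.
have mb : measurable (ball x s) by exact: measurable_ball.
have mC : measurable (O `&` cell i.+1 j) by apply: measurableI => //; exact: measurable_itv.
have mDb : measurable (D `&` ball x s) by exact: measurableI.
have key : (mu (D `&` ball x s) + mu (O `&` cell i.+1 j) <= mu (ball x s))%E.
  have dis : (D `&` ball x s) `&` (O `&` cell i.+1 j) = set0.
    by apply/seteqP; split => // y [[[_ ny] _] [oy _]].
  have <- : mu ((D `&` ball x s) `|` (O `&` cell i.+1 j)) = (mu (D `&` ball x s) + mu (O `&` cell i.+1 j))%E.
    exact: (@measureU _ _ _ mu _ _ mDb mC dis).
  apply: le_measure; rewrite ?inE//; first exact: measurableU.
  by move=> y [[_ yb]|[_ yc]] //; exact: cb.
have bs : mu (ball x s) = (2 * s)%:E by rewrite lebesgue_measure_ball ?ltW// -[s *+ 2]mulr_natl.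
have h1 : (mu (D `&` ball x s) + (s / 32)%:E <= (2 * s)%:E)%E.
  by rewrite -bs; apply: le_trans key; apply: leeD => //; exact: HO.
have h2 : ((63 / 64)%:E < mu (D `&` ball x s) * (mu (ball x s))^-1)%E.
  apply: (He s) => //.
  by rewrite /= sub0r normrN gtr0_norm.
have [d ed] : exists d, mu (D `&` ball x s) = d%:E.
  exists (fine (mu (D `&` ball x s))); rewrite fineK// ge0_fin_numE ?measure_ge0//.
  apply: (@le_lt_trans _ _ (mu (ball x s))); last by rewrite bs ltry.
  by apply: le_measure; rewrite ?inE//; apply: subIsetr.
move: h1 h2; rewrite ed bs inver ifF; last by rewrite gt_eqF// mulr_gt0.
rewrite -EFinD -EFinM !(lee_fin, lte_fin) ltr_pdivlMr ?mulr_gt0//.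
by move: s0; clear; lra.
Qed.

Lemma ae_frequent : {ae mu, forall al, 0 <= al -> forall N0, @frequent R N0 al}.
Proof.
have H N0 : {ae mu, forall x, 0 <= x -> (@frequent R N0)° x}.
  by apply: density_ae; [exact: open_interior|move=> i j; exact: frequent_interval].
have FF : Filter (nbhs (almost_everywhere mu)) := ae_filter_ringOfSetsType mu.
have := ae_foralln H; apply: filterS => x Hx x0 N0.
exact: interior_subset (Hx N0 x0).
Qed.

End Density.

(** * The exceptional set *)

Section LowerBound.
Local Open Scope classical_set_scope.
Local Open Scope ring_scope.
Context {R : realType}.
Local Notation mu := (@lebesgue_measure R).
Notation rho := (expR 1 * ln 2 : R).

Lemma seqU_mem (I : eqType) (s : seq I) (A : I -> set R) i x : i \in s -> A i x ->
  (\big[setU/set0]_(j <- s) A j) x.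
Proof.
elim: s => // j s IH; rewrite inE big_cons => /orP[/eqP <-|js] Ax; first by left.
by right; exact: IH.
Qed.

Lemma sum_harmonic_le (a b : nat) : (0 < a)%N -> (a <= b)%N ->
  \sum_(a <= J < b) J.+1%:R^-1 <= ln b%:R - ln a%:R :> R.
Proof.
move=> a0 /subnKC <-; elim: (b - a)%N => [|n IH]; first by rewrite addn0 subrr big_geq.
rewrite addnS big_nat_recr ?leq_addr//=.
have p0 : 0 < (a + n)%:R :> R by rewrite ltr0n addn_gt0 a0.
have h : (a + n).+1%:R^-1 <= ln (a + n).+1%:R - ln (a + n)%:R :> R.
  rewrite -ln_div ?posrE//; apply: le_trans (ln_ge_1subV _); last by rewrite divr_gt0.
  rewrite invf_div -natr1 le_eqVlt; apply/orP; left; apply/eqP; field.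
  by rewrite gt_eqF//; lra.
by move: IH h; move: (\sum_(_ <= _ < _) _) (_^-1) => u v; lra.
Qed.

Lemma exists_int_dist (x : R) : exists b : bool, dist_int x = `|x - (Num.floor x + b%:Z)%:~R|.
Proof.
have /andP[h1 h2] := floor_itv x; rewrite intrD mulr1z in h2.
rewrite /dist_int; have [h|h] := leP (x - (Num.floor x)%:~R) ((Num.floor x)%:~R + 1 - x).
  by exists false; rewrite addr0 ger0_norm// subr_ge0.
by exists true; rewrite intrD (_ : (true%:Z)%:~R = 1)// ler0_norm; lra.
Qed.

Lemma dist_intN (x : R) : dist_int (- x) = dist_int x.
Proof.
have le y : dist_int (- y) <= dist_int (y : R).
  have [b ->] := exists_int_dist y.
  apply: le_trans (dist_int_le _ (- (Num.floor y + b%:Z))) _.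
  by rewrite intrN opprK -normrN opprD opprK.
by apply/eqP; rewrite eq_le le -{1}[x]opprK le.
Qed.

(** The nearest integer is the floor, at most [z], or its successor. *)
Lemma dist_int_nat (z : nat) (al p : R) : 0 <= al <= 1 -> dist_int (z%:R * al) < p ->
  exists2 a, (a < z.+2)%N & `|z%:R * al - a%:R| < p.
Proof.
move=> /andP[a0 a1]; have [b ->] := exists_int_dist (z%:R * al) => h.
have x0 : 0 <= z%:R * al by rewrite mulr_ge0.
have f0 : (0 <= Num.floor (z%:R * al))%R by rewrite floor_ge0.
have fz : (Num.floor (z%:R * al) <= z%:Z)%R.
  rewrite -(ler_int R); apply: le_trans (floor_le _) _.
  by rewrite -[leRHS]/(z%:R) ler_piMr.
case: (Num.floor _) f0 fz h => // n _ nz h.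
exists (n + b)%N; first by move: nz; rewrite lez_nat; case: b {h}; lia.
by move: h; rewrite -PoszD.
Qed.

Lemma powR_pow2 (h : nat) (e : R) : (2 ^+ h) `^ e = (2 `^ e) ^+ h.
Proof.
by rewrite -(powR_mulrn h (ler0n R 2)) -(powR_mulrn h (powR_ge0 2 e)) -!powRrM mulrC.
Qed.

Lemma logp_le_id (x : R) : 1 <= x -> logp x <= x.
Proof.
move=> x1; rewrite /logp ge_max x1 /=; have x0 : 0 < x by lra.
by have := ln_le_sub1 x0; lra.
Qed.

Lemma rate_le1 (N : nat) : (0 < N)%N -> rate N <= 1 :> R.
Proof.
move=> N0; have N1 : 1 <= N%:R :> R by rewrite ler1n.
have l1 := logp_ge1 (N%:R : R).
rewrite /rate ler_pdivrMr ?exprn_gt0 ?ltr0n// mul1r.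
apply: (@le_trans _ _ (1 * N%:R ^+ 2)); last by rewrite mul1r.
apply: ler_pM; rewrite ?powR_ge0//.
  by apply: le_trans (powR_c_lt ltr01 l1) _; rewrite powR1.
have l2 : log2p (N%:R : R) <= N%:R.
  by apply: le_trans (logp_le_id l1) _; exact: logp_le_id.
have l3 : 1 <= log2p (N%:R : R) := logp_ge1 _.
rewrite powR12_sqrt; last by lra.
have N0' : 0 <= N%:R :> R by [].
rewrite -[leRHS]ger0_norm ?exprn_ge0// -sqrtr_sqr ler_wsqrtr//.
apply: le_trans l2 _; rewrite -exprM; apply: ler_eXnr => //.
Qed.

(* [k], [J], [l], [h] are successive base-2 logarithms of [N], rounded down. *)
Lemma rate_upper (eps : R) (N k J l h : nat) : 0 < eps ->
  (2 ^ k <= N < 2 ^ k.+1)%N -> (2 ^ J <= k < 2 ^ J.+1)%N -> (2 ^ l <= J)%N -> (2 ^ h <= l)%N ->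
  rate N / (log3p (N%:R : R)) `^ (1 + eps) <=
  (2^-1) `^ (@c_const R - 1) * 8 `^ (1 + eps) * (rho ^- J * Num.sqrt J.+1%:R * (2 `^ (1 + eps)) ^- h) / 4 ^+ k.
Proof.
move=> e0 /andP[kN Nk] /andP[Jk kJ] lJ hl.
have l2 : 1 / 2 < ln 2 :> R := @ln2_gt R.
have l2' : ln 2 < 1 :> R := @ln2_lt1 R.
have l20 : 0 < ln 2 :> R by lra.
have N0 : (0 < N)%N by apply: leq_trans kN; rewrite expn_gt0.
have J0 : (1 < J)%N.
  apply: leq_trans lJ; rewrite -[2%N]/(2 ^ 1)%N leq_exp2l//.
  by apply: leq_trans hl; rewrite expn_gt0.
pose X : R := 2 ^+ J; have X1 : 1 <= X by rewrite /X -natrX ler1n expn_gt0.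
have lo : X / 2 <= logp (N%:R : R).
  have h1 : k%:R * ln 2 <= ln N%:R :> R by rewrite -ln_pow2; apply: ler_ln_nat => //; rewrite expn_gt0.
  have h2 : X <= k%:R by rewrite /X -natrX ler_nat.
  rewrite /logp le_max; apply/orP; right; apply: le_trans h1.
  by move: (k%:R) h2 l2 X1 => u; clear; nra.
have up : logp (N%:R : R) <= 2 * X.
  rewrite /logp ge_max; apply/andP; split; first by lra.
  apply: le_trans (ler_ln_nat N0 (ltnW Nk)) _; rewrite ln_pow2.
  have h2 : k.+1%:R <= 2 * X by rewrite /X -exprS -natrX ler_nat.
  by apply: le_trans (ler_piMr _ (ltW l2')) h2.
have b1 : logp (N%:R : R) `^ (@c_const R - 1) <= (2^-1) `^ (@c_const R - 1) * rho ^- J.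
  rewrite -powR_rho -/X -powRM//; last by lra.
  by apply: powR_c_lt; [|rewrite mulrC]; lra.
have b2 : log2p (N%:R : R) `^ 2^-1 <= Num.sqrt J.+1%:R.
  rewrite powR12_sqrt; last by apply: le_trans (logp_ge1 _).
  rewrite ler_wsqrtr// /log2p.
  apply: le_trans (logp_le _ up) _; first by apply: lt_le_trans (logp_ge1 _).
  rewrite /logp ge_max ler1n /= /X -exprS lnXn// -[leLHS]mulr_natl.
  by apply: ler_piMr => //; exact: ltW.
have X20 : 0 < X / 2 by lra.
have b3 : J%:R / 4 <= log2p (N%:R : R).
  apply: (@le_trans _ _ (ln (X / 2))).
    rewrite ln_div ?posrE//; last by lra.
    rewrite /X lnXn// -[ln 2 *+ J]mulr_natl.
    have : 2 <= J%:R :> R by rewrite ler_nat.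
    by move: (J%:R) l2 => u; clear; nra.
  rewrite /log2p /logp le_max; apply/orP; right; rewrite -/(logp _).
  by rewrite ler_ln ?posrE//; apply: lt_le_trans (logp_ge1 _).
have b4 : 2 ^+ h / 8 <= log3p (N%:R : R).
  have hl' : 2 ^+ h <= l%:R :> R by rewrite -natrX ler_nat.
  apply: (@le_trans _ _ (l%:R / 8)); first by rewrite ler_pM2r// invr_gt0.
  have [l8|l8] := leqP l 8.
    by apply: le_trans (logp_ge1 _); rewrite ler_pdivrMr// mul1r ler_nat.
  apply: (@le_trans _ _ (ln (2 ^+ l / 4))).
    rewrite ln_div ?posrE ?exprn_gt0// lnXn// -[ln 2 *+ l]mulr_natl.
    rewrite (_ : 4 = 2 ^+ 2)%R ?lnXn//; last by rewrite expr2 -natrM.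
    rewrite -[ln 2 *+ 2]mulr_natl.
    have : 8 <= l%:R :> R by rewrite ler_nat ltnW.
    by move: (l%:R) l2 => u; clear; nra.
  rewrite /log3p /logp le_max; apply/orP; right.
  rewrite ler_ln ?posrE; [|by rewrite divr_gt0// exprn_gt0|by apply: lt_le_trans (logp_ge1 _)].
  apply: le_trans b3; rewrite ler_pM2r ?invr_gt0//.
  by rewrite -natrX ler_nat.
pose q : R := 2 `^ (1 + eps); have q0 : 0 < q by exact: powR_gt0.
have b5 : (8 `^ (1 + eps))^-1 * q ^+ h <= (log3p (N%:R : R)) `^ (1 + eps).
  have -> : (8 `^ (1 + eps))^-1 * q ^+ h = (2 ^+ h / 8) `^ (1 + eps).
    rewrite mulrC /q -powR_pow2 powRM//.
    congr (_ * _); by rewrite -[8^-1]powR_inv1// -powRrM mulN1r powRN.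
  apply: ge0_ler_powR => //; rewrite ?nnegrE.
  - by lra.
  - by rewrite divr_ge0// exprn_ge0.
  - by apply: le_trans (logp_ge1 _).
have b6 : 0 < (log3p (N%:R : R)) `^ (1 + eps) by apply: powR_gt0; apply: lt_le_trans (logp_ge1 _).
have b7 : (log3p (N%:R : R) `^ (1 + eps))^-1 <= 8 `^ (1 + eps) * q ^- h.
  rewrite -[8 `^ _]invrK -invfM lef_pV2 ?posrE//.
  by rewrite mulr_gt0 ?invr_gt0 ?powR_gt0 ?exprn_gt0.
have b8 : (N%:R ^+ 2)^-1 <= (4 ^+ k)^-1 :> R.
  rewrite lef_pV2 ?posrE ?exprn_gt0 ?ltr0n//.
  rewrite (_ : 4 = 2 ^+ 2)%R; last by rewrite expr2 -natrM.
  by rewrite exprAC -natrX -[X in _ <= X]natrX -[X in X <= _]natrX ler_nat leq_sqr.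
rewrite /rate -/q.
rewrite [leRHS](_ : _ = (2^-1) `^ (@c_const R - 1) * rho ^- J * Num.sqrt J.+1%:R / 4 ^+ k * (8 `^ (1 + eps) * q ^- h)); last by ring.
have r0 : 0 <= rho ^- J by rewrite invr_ge0 exprn_ge0// mulr_ge0 ?expR_ge0// ltW.
apply: ler_pM => //.
- by rewrite !mulr_ge0 ?powR_ge0// invr_ge0 exprn_ge0.
- by rewrite invr_ge0 ltW.
apply: ler_pM => //; first by rewrite mulr_ge0 ?powR_ge0.
by apply: ler_pM; [exact: powR_ge0|exact: powR_ge0|exact: b1|exact: b2].
Qed.

(** The right-hand side of [rate_upper], with [C] for its constant. *)
Definition radius (eps C : R) (h J k : nat) : R :=
  C * (rho ^- J * Num.sqrt J.+1%:R * (2 `^ (1 + eps)) ^- h) / 4 ^+ k.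

Definition near_rational (N : nat) (r : R) (z a : nat) : set R :=
  if isprod N z then ball (a%:R / z%:R : R) (r / z%:R) else set0.

Definition near_rationals (X N : nat) (r : R) : set R :=
  \big[setU/set0]_(z <- index_iota 0 X)
    \big[setU/set0]_(a <- index_iota 0 z.+2) near_rational N r z a.

Lemma measurable_near_rational N r z a : measurable (near_rational N r z a).
Proof. by rewrite /near_rational; case: ifP => // _; exact: measurable_ball. Qed.

Lemma measurable_near_rationals X N r : measurable (near_rationals X N r).
Proof.
apply: measurable_seqU => z; apply: measurable_seqU => a; exact: measurable_near_rational.
Qed.

(** For each product [z] there are [z + 2 <= 3 z] balls of length [2 r / z]. *)
Lemma near_rationals_mass X N r : 0 <= r ->
  (mu (near_rationals X N r) <= (6 * r * #|[set z : 'I_X | isprod N z]%SET|%:R)%:E)%E.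
Proof.
move=> r0.
have mA := measurable_near_rational N r.
have inner z : (mu (\big[setU/set0]_(a <- index_iota 0 z.+2) near_rational N r z a) <= (if isprod N z then 6 * r else 0)%:E)%E.
  apply: (@le_trans _ _ (\sum_(a <- index_iota 0 z.+2) (if isprod N z then 2 * (r / z%:R) else 0))%:E).
    apply: measure_seqU_le => // a; rewrite /near_rational; case: ifP => _; last by rewrite measure0.
    by rewrite lebesgue_measure_ball ?divr_ge0// -[_ *+ 2]mulr_natl.
  rewrite lee_fin sumr_const_nat subn0; case: ifP => [h|_]; last by rewrite mul0rn.
  have z0 : (0 < z)%N.
    by case/existsP: h => A /existsP[B /and3P[A0 B0 /eqP ->]]; rewrite muln_gt0 A0.
  rewrite -[leLHS]mulr_natl.
  rewrite [leLHS](_ : _ = 2 * r * (z.+2%:R / z%:R)); last by ring.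
  rewrite [leRHS](_ : _ = 2 * r * 3); last by ring.
  apply: ler_wpM2l; first by rewrite mulr_ge0.
  by rewrite ler_pdivrMr ?ltr0n// -natrM ler_nat; move: z0; clear; lia.
apply: (@le_trans _ _ (\sum_(z <- index_iota 0 X) (if isprod N z then 6 * r else 0))%:E).
  by apply: measure_seqU_le => // z; apply: measurable_seqU.
rewrite lee_fin big_mkord -sum1_card natr_sum mulr_sumr big_mkcond /=.
rewrite le_eqVlt; apply/orP; left; apply/eqP; rewrite [RHS]big_mkcond; apply: eq_bigr => z _.
by rewrite inE; case: ifP => _; rewrite ?mulr1.
Qed.

(** [2^k.+2] bounds [a + b] for [a, b <= N < 2^(k+1)], and [4 ^ 2 ^ J.+2] bounds every product of
    two such factors, as [k < 2^(J+1)]. *)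
Definition exceptional (eps C : R) (h : nat) : set R :=
  \big[setU/set0]_(J <- index_iota (2 ^ 2 ^ h) (2 ^ 2 ^ h.+1))
    \big[setU/set0]_(k <- index_iota (2 ^ J) (2 ^ J.+1))
      near_rationals (4 ^ 2 ^ J.+2).+1 (2 ^ k.+2) (radius eps C h J k).

Lemma measurable_exceptional eps C h : measurable (exceptional eps C h).
Proof. by apply: measurable_seqU => J; apply: measurable_seqU => k; exact: measurable_near_rationals. Qed.

(** For fixed [J] and [h], count times radius leaves [1 / (J + 1)]; over the range of [J] the
    harmonic sum is at most [(2^(h+1) - 2^h) ln 2 <= 2^h]. *)
Lemma exceptional_mass (eps C : R) : 0 <= C -> exists D : R, forall h,
  (mu (exceptional eps C h) <= (D * (2 / (2 `^ (1 + eps))) ^+ h)%:E)%E.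
Proof.
move=> C0; have [K K0 HK] := @isprod_sum_le R.
have l2 : 1 / 2 < ln 2 :> R := @ln2_gt R.
have l2' : ln 2 < 1 :> R := @ln2_lt1 R.
pose q : R := 2 `^ (1 + eps); have q0 : 0 < q by exact: powR_gt0.
have rho0 : 0 < rho by rewrite mulr_gt0 ?expR_gt0//; lra.
(* [24 = 6 * 4] and [rho^2] pay for shifting the indices of the count to [k + 1] and [J + 2]. *)
pose D := 24 * C * K * rho ^+ 2; have D0 : 0 <= D.
  by apply: mulr_ge0; [apply: mulr_ge0; [apply: mulr_ge0|exact: ltW]|apply: exprn_ge0; exact: ltW].
exists D => h.
have r0 J k : 0 <= radius eps C h J k.
  by rewrite /radius -/q !mulr_ge0 ?sqrtr_ge0// invr_ge0 ?exprn_ge0// ltW.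
pose M J : R := \sum_(k <- index_iota (2 ^ J) (2 ^ J.+1)) 6 * radius eps C h J k * #|[set z : 'I_(4 ^ 2 ^ J.+2).+1 | isprod (2 ^ k.+2) z]%SET|%:R.
have h1 : (mu (exceptional eps C h) <= (\sum_(J <- index_iota (2 ^ 2 ^ h) (2 ^ 2 ^ h.+1)) M J)%:E)%E.
  apply: measure_seqU_le => J; first by apply: measurable_seqU => k; exact: measurable_near_rationals.
  apply: measure_seqU_le => k; first exact: measurable_near_rationals.
  exact: near_rationals_mass.
apply: le_trans h1 _; rewrite lee_fin.
have h2 J : M J <= D * q ^- h * J.+1%:R^-1.
  pose cnt k : R := #|[set z : 'I_(4 ^ 2 ^ J.+2).+1 | isprod (2 ^ k.+1) z]%SET|%:R / 4 ^+ k.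
  have cnt0 k : 0 <= cnt k by rewrite /cnt divr_ge0// exprn_ge0.
  pose E := C * (rho ^- J * Num.sqrt J.+1%:R * q ^- h).
  have E0 : 0 <= E.
    by rewrite /E !mulr_ge0 ?sqrtr_ge0// invr_ge0 ?exprn_ge0// ltW.
  have -> : M J = 24 * E * \sum_(2 ^ J <= k < 2 ^ J.+1) cnt k.+1.
    rewrite /M mulr_sumr; apply: eq_bigr => k _; rewrite /radius /cnt -/q -/E exprS.
    by field; rewrite gt_eqF// exprn_gt0.
  have s1 : \sum_(2 ^ J <= k < 2 ^ J.+1) cnt k.+1 <= \sum_(0 <= k < 2 ^ J.+2) cnt k.
    rewrite -(big_add1 _ _ (2 ^ J) (2 ^ J.+1).+1 predT cnt) /=.
    have p0 : (0 < 2 ^ J)%N by rewrite expn_gt0.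
    have le1 : ((2 ^ J).+1 <= (2 ^ J.+1).+1)%N by rewrite ltnS leq_exp2l.
    have le2 : ((2 ^ J.+1).+1 <= 2 ^ J.+2)%N by rewrite !expnS; move: p0; clear; lia.
    rewrite (@big_cat_nat _ _ _ (2 ^ J).+1 0)//=; last by apply: leq_trans le2.
    rewrite [X in _ <= _ + X](@big_cat_nat _ _ _ (2 ^ J.+1).+1 (2 ^ J).+1)//=.
    have a0 : 0 <= \sum_(0 <= i < (2 ^ J).+1) cnt i by apply: sumr_ge0.
    have b0 : 0 <= \sum_((2 ^ J.+1).+1 <= i < 2 ^ J.+2) cnt i by apply: sumr_ge0.
    by rewrite addrCA lerDl addr_ge0.
  have s2 := HK J.+2.
  have {}s2 : \sum_(2 ^ J <= k < 2 ^ J.+1) cnt k.+1 <= K * (rho ^+ J.+2 * dec J).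
    apply: le_trans s1 _; apply: le_trans s2 _; apply: ler_wpM2l; first exact: ltW.
    apply: ler_wpM2l; first by rewrite exprn_ge0// ltW.
    rewrite /dec lef_pV2 ?posrE ?mulr_gt0 ?sqrtr_gt0//.
    by apply: ler_pM => //; [rewrite ler_nat; lia| rewrite ler_wsqrtr// ler_nat; lia].
  apply: le_trans (ler_wpM2l _ s2) _; first by rewrite mulr_ge0.
  rewrite le_eqVlt; apply/orP; left; apply/eqP.
  have sJ : 0 < Num.sqrt J.+1%:R :> R by rewrite sqrtr_gt0.
  have J0 : 0 < J.+1%:R :> R by rewrite ltr0n.
  have rJ : 0 < rho ^+ J by rewrite exprn_gt0.
  have qh : 0 < q ^+ h by rewrite exprn_gt0.
  rewrite /E /D /dec !exprS mulr1.
  move: (J.+1%:R : R) J0 sJ (rho ^+ J) rJ (q ^+ h) qh => b b0 sb c c0 d dd0.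
  move: (expR 1 * ln 2) => r; field.
  by rewrite !gt_eqF.
apply: (@le_trans _ _ (\sum_(J <- index_iota (2 ^ 2 ^ h) (2 ^ 2 ^ h.+1)) D * q ^- h * J.+1%:R^-1)).
  by apply: ler_sum => J _; exact: h2.
rewrite -mulr_sumr.
have h3 : \sum_(J <- index_iota (2 ^ 2 ^ h) (2 ^ 2 ^ h.+1)) J.+1%:R^-1 <= 2 ^+ h :> R.
  apply: le_trans (sum_harmonic_le _ _) _; rewrite ?expn_gt0//.
    by rewrite leq_exp2l// leq_exp2l.
  rewrite !ln_pow2 -mulrBl !natrX exprS.
  have : 0 <= 2 ^+ h :> R by rewrite exprn_ge0.
  by move: (2 ^+ h) l2' => u; clear; nra.
have qh0 : 0 <= D * q ^- h by rewrite mulr_ge0// invr_ge0 exprn_ge0// ltW.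
apply: le_trans (ler_wpM2l qh0 h3) _.
by rewrite expr_div_n -/q le_eqVlt; apply/orP; left; apply/eqP; ring.
Qed.

Lemma ae_not_exceptional (eps C : R) : 0 < eps -> 0 <= C ->
  {ae mu, forall x, exists h0, forall h, (h0 <= h)%N -> ~ exceptional eps C h x}.
Proof.
move=> e0 C0; have [D HD] := exceptional_mass eps C0.
pose y : R := 2 / (2 `^ (1 + eps)).
have y0 : 0 <= y by rewrite divr_ge0// powR_ge0.
have y1 : y < 1.
  rewrite /y ltr_pdivrMr ?powR_gt0// mul1r powRD; last by rewrite pnatr_eq0 implybT.
  rewrite powRr1// ltr_pMr// /powR gt_eqF// expR_gt1 mulr_gt0//.
  by have := @ln2_gt R; lra.
have mE h : measurable (exceptional eps C h) by exact: measurable_exceptional.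
have sumE : (\sum_(n <oo) mu (exceptional eps C n) < +oo)%E.
  apply: (@le_lt_trans _ _ (`|D| * (1 - y)^-1)%:E); last exact: ltry.
  apply: lime_le; first by apply: is_cvg_nneseries => n _ _; exact: measure_ge0.
  apply: nearW => n.
  apply: (@le_trans _ _ (\sum_(0 <= h < n) (`|D| * y ^+ h)%:E)).
    apply: lee_sum => h _; apply: le_trans (HD h) _; rewrite lee_fin.
    by apply: ler_wpM2r; [rewrite exprn_ge0|exact: ler_norm].
  rewrite sumEFin lee_fin -mulr_sumr; apply: ler_wpM2l; first exact: normr_ge0.
  exact: sum_geo_le.
have z := @lim_sup_set_cvg0 _ _ R mu _ mE sumE.
exists (lim_sup_set (exceptional eps C)); split => //.
  apply: bigcap_measurable => // n _; apply: bigcup_measurable => j _; exact: mE.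
move=> x /= nx n _.
apply: contrapT => H; apply: nx; exists n => h nh Eh; apply: H.
by exists h.
Qed.

End LowerBound.

(** * Lower bound for the minimal distance and conclusion *)

Section Final.
Local Open Scope classical_set_scope.
Local Open Scope ring_scope.
Context {R : realType}.
Local Notation mu := (@lebesgue_measure R).

(** By contraposition: if [(a^2 - b^2) alpha] is too close to an integer, then [alpha] is close to a
    fraction with denominator [(a - b)(a + b)], a product of two integers up to [2^(k+2)]. *)
Lemma not_exceptional_dist (eps C al p : R) (N k J h a b : nat) : 0 <= al <= 1 ->
  (N < 2 ^ k.+1)%N -> (2 ^ J <= k < 2 ^ J.+1)%N -> (2 ^ 2 ^ h <= J < 2 ^ 2 ^ h.+1)%N ->
  p <= radius eps C h J k -> ~ exceptional eps C h al -> (0 < b)%N -> (b < a)%N -> (a <= N)%N ->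
  p <= dist_int (((a ^ 2)%:R - (b ^ 2)%:R) * al).
Proof.
move=> al01 Nk kJ Jh pr nE b0 ba aN; rewrite leNgt; apply/negP => lt; apply: nE.
pose z := ((a - b) * (a + b))%N.
have ez : (a ^ 2)%:R - (b ^ 2)%:R = z%:R :> R.
  by rewrite /z -subn_sqr natrB// leq_sqr ltnW.
have z0 : (0 < z)%N by rewrite muln_gt0 subn_gt0 ba addn_gt0 b0 orbT.
rewrite ez in lt; have {}lt := lt_le_trans lt pr.
have [n nz hn] := dist_int_nat al01 lt.
have A1 : (a - b <= 2 ^ k.+2)%N.
  apply: leq_trans (leq_subr _ _) _; apply: leq_trans aN _; apply: leq_trans (ltnW Nk) _.
  by rewrite leq_exp2l.
have B1 : (a + b <= 2 ^ k.+2)%N.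
  by rewrite expnS; move: Nk aN ba; clear; lia.
apply: (seqU_mem (i := J)); first by rewrite mem_index_iota.
apply: (seqU_mem (i := k)); first by rewrite mem_index_iota.
apply: (seqU_mem (i := z)).
  rewrite mem_index_iota /= ltnS /z; apply: leq_trans (leq_mul A1 B1) _.
  rewrite -expnMn leq_exp2l//.
  by case/andP: kJ => _; rewrite !expnS; clear; lia.
apply: (seqU_mem (i := n)); first by rewrite mem_index_iota.
rewrite /near_rational ifT; last first.
  apply/existsP; exists (Ordinal (A1 : (a - b < (2 ^ k.+2).+1)%N)).
  apply/existsP; exists (Ordinal (B1 : (a + b < (2 ^ k.+2).+1)%N)).
  by rewrite /= subn_gt0 ba addn_gt0 b0 orbT eqxx.
have Z0 : 0 < z%:R :> R by rewrite ltr0n.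
rewrite -ball_normE /= distrC ltr_pdivlMr// -[X in _ * X]gtr0_norm// -normrM mulrBl divfK ?gt_eqF//.
by rewrite mulrC.
Qed.

Lemma ae_lower (eps : R) : 0 < eps -> {ae mu, forall al, 0 <= al <= 1 ->
  exists N0, forall N, (N0 <= N)%N -> rate N / (log3p (N%:R : R)) `^ (1 + eps) <= delta_min al N}.
Proof.
move=> e0; pose C : R := (2^-1) `^ (@c_const R - 1) * 8 `^ (1 + eps).
have C0 : 0 <= C by rewrite mulr_ge0// powR_ge0.
have FF : Filter (nbhs (almost_everywhere mu)) := ae_filter_ringOfSetsType mu.
apply: filterS (ae_not_exceptional e0 C0) => al [h0 Hal] al01.
(* The tower makes each of the four successive binary logarithms large enough for the next, the last
   being at least [h0]. *)
exists (2 ^ (2 ^ (2 ^ (2 ^ h0))))%N => N NN.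
have tl n t : (2 ^ t <= n)%N -> (2 ^ trunc_log 2 n <= n < 2 ^ (trunc_log 2 n).+1)%N /\ (t <= trunc_log 2 n)%N.
  move=> tn; have n0 : (0 < n)%N by apply: leq_trans tn; rewrite expn_gt0.
  by split; [exact: trunc_log_bounds|exact: trunc_log_max].
have [kN k0] := tl _ _ NN; set k := trunc_log 2 N in kN k0.
have [Jk J0] := tl _ _ k0; set J := trunc_log 2 k in Jk J0.
have [lJ l0] := tl _ _ J0; set l := trunc_log 2 J in lJ l0.
have [hl hh0] := tl _ _ l0; set h := trunc_log 2 l in hl hh0.
have [/andP[hl1 hl2] /andP[lJ1 lJ2] /andP[_ Nk]] := And3 hl lJ kN.
have hb := rate_upper e0 kN Jk lJ1 hl1.
rewrite -/C in hb.
have Jh : (2 ^ 2 ^ h <= J < 2 ^ 2 ^ h.+1)%N.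
  apply/andP; split; first by apply: leq_trans lJ1; rewrite leq_exp2l.
  by apply: leq_trans lJ2 _; rewrite leq_exp2l.
have Nn0 : (0 < N)%N by apply: leq_trans NN; rewrite expn_gt0.
have l31 : 1 <= (log3p (N%:R : R)) `^ (1 + eps).
  apply: (@le_trans _ _ (1 `^ (1 + eps))); first by rewrite powR1.
  apply: ge0_ler_powR; rewrite ?nnegrE//.
  - by lra.
  - by apply: le_trans (logp_ge1 _).
  - exact: logp_ge1.
have main a b : (0 < b)%N -> (b < a)%N -> (a <= N)%N ->
    rate N / (log3p (N%:R : R)) `^ (1 + eps) <= dist_int (((a ^ 2)%:R - (b ^ 2)%:R) * al).
  by move=> b0 ba aN; apply: (not_exceptional_dist al01 Nk Jk Jh hb (Hal h hh0)).
(* The neutral value 1 of the iterated minimum has to be bounded below too. *)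
have B1 : rate N / (log3p (N%:R : R)) `^ (1 + eps) <= 1.
  rewrite ler_pdivrMr ?mul1r; last by lra.
  by apply: le_trans (rate_le1 Nn0) l31.
apply: le_bigmin => // i _; apply: le_bigmin => // j ij; rewrite /a_sq.
case: (ltngtP i j) ij => [lt|lt|e] ij.
- rewrite -dist_intN -mulNr opprB; exact: main.
- exact: main.
- by move: ij; rewrite -val_eqE /= e eqxx.
Qed.

End Final.

Theorem theorem5 (R : realType) (eps : R) (heps : 0 < eps) :
  {ae (@lebesgue_measure R), forall alpha : R, 0 <= alpha <= 1 ->
    (forall N0 : nat, exists N : nat, (N0 <= N)%N /\ (2 <= N)%N /\
       delta_min alpha N <=
         (logp (N%:R : R)) `^ (@c_const R - 1) * (log2p (N%:R : R)) `^ (2^-1)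
         / (N%:R ^+ 2))
    /\
    (exists N0 : nat, forall N : nat, (N0 <= N)%N ->
       (logp (N%:R : R)) `^ (@c_const R - 1) * (log2p (N%:R : R)) `^ (2^-1)
         / (N%:R ^+ 2 * (log3p (N%:R : R)) `^ (1 + eps))
       <= delta_min alpha N)}.
Proof.
have FF : Filter (nbhs (almost_everywhere (@lebesgue_measure R))) :=
  ae_filter_ringOfSetsType (@lebesgue_measure R).
apply: filterS2 (@ae_frequent R) (ae_lower heps) => al Hf Hl /[dup] /andP[al0 _] al01.
split=> [N0|]; first by have [N [h1 h2 h3]] := Hf al0 N0; exists N.
have [N0 HN0] := Hl al01; exists N0 => N /HN0.
by rewrite /rate [(_ ^+ 2 * _)^-1]invfM mulrA.
Qed.
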